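(* Let $(M,\varepsilon,J)$ be a tamed almost symplectic manifold and let $(M,L_1,L_2)$ be the corresponding generalized almost Kähler manifold, with bi-Hermitian data $(g,b,J_+,J_-)$; denote by $\rho^{\pm}:T^{\mathbb C}M\to T^{1,0}_{\pm}M$ the projections. If $(M,L_1,L_2)$ is generalized Kähler then $J_{\pm}$ are integrable and $\rho^{\pm}_*(L_2)$ are holomorphic Poisson structures on $(M,J_{\pm})$, respectively. Furthermore, the converse holds if also $J_+-J_-$ is invertible; moreover, in this case, if $(M,L_1,L_2)$ is generalized Kähler then $\rho^{\pm}_*(L_2)$ are holomorphic symplectic structures on $(M,J_{\pm})$, respectively.
   Context: Manifolds are connected and smooth. A generalized (almost) complex structure on $M$ is a complex subbundle $L$ of $T^{\mathbb C}M\oplus(T^{\mathbb C}M)^*$, maximal isotropic for $\langle X+\alpha,Y+\beta\rangle=\tfrac12(\alpha(Y)+\beta(X))$, with $L\cap\overline L=0$ (and, for a generalized complex structure, with sections closed under the Courant bracket $[X+\alpha,Y+\beta]=[X,Y]+\tfrac12 d(\iota_X\beta-\iota_Y\alpha)+\iota_Xd\beta-\iota_Yd\alpha$). It corresponds to the section $\mathcal J$ of $\mathrm{End}(TM\oplus T^*M)$ with $\mathrm i$-eigenbundle $L$. A generalized (almost) Kähler manifold $(M,L_1,L_2)$ has two generalized (almost) complex structures whose $\mathcal J_1,\mathcal J_2$ commute and $\mathcal J_1\mathcal J_2$ is negative definite with respect to $\langle\cdot,\cdot\rangle$. Generalized almost Kähler structures correspond bijectively to quadruples $(g,b,J_+,J_-)$,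 with $g$ a Riemannian metric, $b$ a two-form and $J_\pm$ almost Hermitian structures on $(M,g)$, via $L_1=L^+\oplus L^-$, $L_2=L^+\oplus\overline{L^-}$, $L^\pm=\{X+(b\pm g)(X)\mid X\in V^\pm\}$, $V^\pm=T^{1,0}_\pm M$ the $\mathrm i$-eigenbundles of $J_\pm$. A tamed almost symplectic manifold $(M,\varepsilon,J)$ is a manifold with a nondegenerate two-form $\varepsilon$ and an almost complex structure $J$ such that $\varepsilon(JX,X)>0$ for nonzero $X$. The corresponding generalized almost Kähler structure is given by $J_+=J$, $J_-=-\varepsilon^{-1}J^*\varepsilon$ (with $\varepsilon(X)=\varepsilon(X,\cdot)$, $J^*$ the transpose) and $g$, $b$ the symmetric and skew-symmetric parts of $(X,Y)\mapsto\varepsilon(JX,Y)$; for it $J_++J_-$ is invertible and $L_2=\{X+\mathrm i\,\varepsilon(X)\mid X\in T^{\mathbb C}M\}$. $\rho^\pm$ is the projection with kernel $T^{0,1}_\pm M=\overline{T^{1,0}_\pm M}$. Pointwise, for a linear map $f:V\to W$, $f_*(L)=\{f(X)+\xi\mid X\in V,\ \xi\in W^*,\ X+f^*(\xi)\in L\}$. That $\rho^\pm_*(L_2)\subseteq T^{1,0}_\pm M\oplus(T^{1,0}_\pm M)^*$ is a holomorphic Poisson structure on $(M,J_\pm)$ means that it is the graph of a holomorphic Poisson bivector (a holomorphic section of $\Lambda^2T^{1,0}_\pm M$ with vanishing Schouten bracket with itself); it is holomorphic symplectic if the bivector is moreover nondegenerate. ''The converse'' is: if $J_\pm$ are integrable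 and $\rho^\pm_*(L_2)$ are holomorphic Poisson structures on $(M,J_\pm)$, then $(M,L_1,L_2)$ is generalized Kähler. *)

(* Defs.v *)
From mathcomp Require Import all_boot all_order all_algebra.
From mathcomp Require Import complex.
From mathcomp Require Import all_classical all_reals all_analysis.
Import Order.TTheory GRing.Theory Num.Theory.
Import numFieldNormedType.Exports.

Set Implicit Arguments.
Unset Strict Implicit.
Unset Printing Implicit Defensive.

Local Open Scope classical_set_scope.
Local Open Scope ring_scope.

(* Conventions.
   - Vectors and covectors are row vectors.  A covector a evaluates on a vector
     v as a *m v^T.  An endomorphism A acts by v |-> v *m A, hence its transpose
     acts on covectors by a |-> a *m A^T.  A bilinear form w is the matrix with
     w(X, Y) = X *m w *m Y^T, so the covector w(X, -) is X *m w, and a bivector s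
     is the matrix with s(a, b) = a *m s *m b^T.  Matrices of composites
     therefore appear in reversed order.
   - T_xM is R^n, read in the chart chart_at x chosen around x, and
     T_xM^C is C^n with C = R[i].  A field on M (vector field, form, ...) is a
     function from M to matrices; its expression in the chart around x near x is
     obtained with the Jacobians of the coordinate changes (loc_* below).
   - An element X + a of (TM + T*M)^C is row_mx X a.
   - Real tensors are complexified by cplx when needed.
   - Local sections are total functions on M constrained only near a point. *)

Section Smooth.
Context {R : realType}.

Fixpoint Ck n (k : nat) (U : set 'rV[R]_n) (f : 'rV[R]_n -> R) : Prop :=
  if k is k'.+1 then
    (forall p, U p -> differentiable f p) /\
    (forall v : 'rV[R]_n, Ck k' U (fun p => 'D_v f p))
  else forall p, U p -> {for p, continuous f}.

(* meant for U open *)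
Definition smooth_on n (U : set 'rV[R]_n) (f : 'rV[R]_n -> R) : Prop :=
  forall k, Ck k U f.

Definition smooth_near n a b (p : 'rV[R]_n)
    (F : 'rV[R]_n -> 'M[R[i]]_(a, b)) : Prop :=
  exists U : set 'rV[R]_n, [/\ open U, U p &
    forall i j, smooth_on U (fun q => complex.Re (F q i j)) /\
                smooth_on U (fun q => complex.Im (F q i j))].

Definition pd n (f : 'rV[R]_n -> R[i]) (j : 'I_n) (p : 'rV[R]_n) : R[i] :=
  Complex ('D_(delta_mx 0 j) (fun q => complex.Re (f q)) p)
          ('D_(delta_mx 0 j) (fun q => complex.Im (f q)) p).

Definition cplx a b (A : 'M[R]_(a, b)) : 'M[R[i]]_(a, b) :=
  map_mx (real_complex R) A.

Definition conj_mx a b (A : 'M[R[i]]_(a, b)) : 'M[R[i]]_(a, b) :=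
  map_mx (@conjc R) A.

Record chart (n : nat) (M : topologicalType) := Chart {
  dom : set M;
  cmap : M -> 'rV[R]_n;
  cinv : 'rV[R]_n -> M;
  dom_open : open dom;
  cod_open : open (cmap @` dom);
  cmapK : forall x, dom x -> cinv (cmap x) = x;
  cmap_cont : forall x, dom x -> {for x, continuous cmap};
  cinv_cont : forall p, (cmap @` dom) p -> {for p, continuous cinv}
}.

End Smooth.

Arguments chart R n M : clear implicits.

Record manifold (R : realType) (n : nat) := Manifold {
  carrier :> topologicalType;
  manifold_hausdorff : hausdorff_space carrier;
  manifold_second_countable : @second_countable carrier;
  manifold_connected : connected [set: carrier];
  atlas : set (chart R n carrier);
  atlas_cover : forall x, exists c, atlas c /\ dom c x;
  atlas_smooth : forall c d, atlas c -> atlas d -> forall j : 'I_n,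
    smooth_on (cmap c @` (dom c `&` dom d))
              (fun p => cmap d (cinv c p) 0 j)
}.

Section Fields.
Context {R : realType} {n : nat} (M : manifold R n).
Local Notation C := R[i].

Definition chart_at (x : M) : chart R n M := projT1 (cid (atlas_cover x)).
Definition coord (x : M) : M -> 'rV[R]_n := cmap (chart_at x).
Definition point (x : M) : 'rV[R]_n -> M := cinv (chart_at x).

(* Tangent vectors at y: from the chart around x to the chart around z. *)
Definition chart_jac (x z y : M) : 'M[C]_n :=
  cplx (jacobian (coord z \o point x) (coord x y)).

Definition loc_vec (x : M) (X : M -> 'rV[C]_n) (p : 'rV[R]_n) : 'rV[C]_n :=
  let y := point x p in X y *m chart_jac y x y.
Definition loc_cov (x : M) (a : M -> 'rV[C]_n) (p : 'rV[R]_n) : 'rV[C]_n :=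
  let y := point x p in a y *m (chart_jac x y y)^T.
Definition loc_end (x : M) (A : M -> 'M[C]_n) (p : 'rV[R]_n) : 'M[C]_n :=
  let y := point x p in chart_jac x y y *m A y *m chart_jac y x y.
Definition loc_form (x : M) (w : M -> 'M[C]_n) (p : 'rV[R]_n) : 'M[C]_n :=
  let y := point x p in chart_jac x y y *m w y *m (chart_jac x y y)^T.
Definition loc_biv (x : M) (s : M -> 'M[C]_n) (p : 'rV[R]_n) : 'M[C]_n :=
  let y := point x p in (chart_jac y x y)^T *m s y *m chart_jac y x y.

Definition vec (s : M -> 'rV[C]_(n + n)) (y : M) : 'rV[C]_n := lsubmx (s y).
Definition cov (s : M -> 'rV[C]_(n + n)) (y : M) : 'rV[C]_n := rsubmx (s y).

Definition smooth_vec_at (x : M) (X : M -> 'rV[C]_n) : Prop :=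
  smooth_near (coord x x) (loc_vec x X).
Definition smooth_gen_at (x : M) (s : M -> 'rV[C]_(n + n)) : Prop :=
  smooth_near (coord x x) (loc_vec x (vec s)) /\
  smooth_near (coord x x) (loc_cov x (cov s)).
Definition smooth_end (A : M -> 'M[C]_n) : Prop :=
  forall x, smooth_near (coord x x) (loc_end x A).
Definition smooth_form (w : M -> 'M[C]_n) : Prop :=
  forall x, smooth_near (coord x x) (loc_form x w).
Definition smooth_biv (s : M -> 'M[C]_n) : Prop :=
  forall x, smooth_near (coord x x) (loc_biv x s).

Definition lie (x : M) (X Y : M -> 'rV[C]_n) : 'rV[C]_n :=
  let p := coord x x in
  \row_j \sum_i (loc_vec x X p 0 i * pd (fun q => loc_vec x Y q 0 j) i p
               - loc_vec x Y p 0 i * pd (fun q => loc_vec x X q 0 j) i p).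

Definition dfun (x : M) (f : M -> C) : 'rV[C]_n :=
  \row_j pd (fun q => f (point x q)) j (coord x x).

(* da(X, Y) = X a(Y) - Y a(X) - a([X, Y]) *)
Definition dcov (x : M) (a : M -> 'rV[C]_n) : 'M[C]_n :=
  \matrix_(i, j) (pd (fun q => loc_cov x a q 0 j) i (coord x x)
                - pd (fun q => loc_cov x a q 0 i) j (coord x x)).

Definition ev (F : fieldType) (a v : 'rV[F]_n) : F := (a *m v^T) 0 0.

Definition courant (x : M) (u v : M -> 'rV[C]_(n + n)) : 'rV[C]_(n + n) :=
  row_mx (lie x (vec u) (vec v))
    (2^-1 *: dfun x (fun y => ev (cov v y) (vec u y) - ev (cov u y) (vec v y))
     + vec u x *m dcov x (cov v) - vec v x *m dcov x (cov u)).

(* Lie derivative of the bivector s along X *)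
Definition lie_biv (x : M) (X : M -> 'rV[C]_n) (s : M -> 'M[C]_n) : 'M[C]_n :=
  let p := coord x x in
  let Xh q := loc_vec x X q 0 in
  let sh := loc_biv x s in
  \matrix_(j, k) \sum_i (Xh p i * pd (fun q => sh q j k) i p
                       - sh p i k * pd (fun q => Xh q j) i p
                       - sh p j i * pd (fun q => Xh q k) i p).

(* component of the Schouten bracket [s, s] of a bivector, up to a nonzero
   constant depending on conventions *)
Definition schouten (x : M) (s : M -> 'M[C]_n) (i j k : 'I_n) : C :=
  let p := coord x x in
  let sh := loc_biv x s in
  \sum_l (sh p l i * pd (fun q => sh q j k) l p
        + sh p l j * pd (fun q => sh q k i) l p
        + sh p l k * pd (fun q => sh q i j) l p).

Definition pairing (F : fieldType) (u v : 'rV[F]_(n + n)) : F :=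
  2^-1 * (ev (rsubmx u) (lsubmx v) + ev (rsubmx v) (lsubmx u)).

Definition subspace (F : fieldType) m (L : set 'rV[F]_m) : Prop :=
  L 0 /\ forall (a : F) u v, L u -> L v -> L (a *: u + v).

Definition isotropic (L : set 'rV[C]_(n + n)) : Prop :=
  forall u v, L u -> L v -> pairing u v = 0.

Definition maximal_isotropic (L : set 'rV[C]_(n + n)) : Prop :=
  [/\ subspace L, isotropic L &
      forall L', subspace L' -> isotropic L' -> L `<=` L' -> L' `<=` L].

Definition subbundle (L : M -> set 'rV[C]_(n + n)) : Prop :=
  exists r : nat, forall x, exists e : 'I_r -> M -> 'rV[C]_(n + n),
    (forall i, smooth_gen_at x (e i)) /\
    \forall y \near x,
      (forall u, L y u <-> exists a : 'I_r -> C, u = \sum_i a i *: e i y) /\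
      (forall a : 'I_r -> C,
         \sum_i a i *: e i y = 0 -> forall i, a i = 0).

Definition generalized_almost_complex (L : M -> set 'rV[C]_(n + n)) : Prop :=
  [/\ subbundle L, forall x, maximal_isotropic (L x)
    & forall x, L x `&` (@conj_mx R _ _ @` L x) = [set 0]].

Definition courant_closed (L : M -> set 'rV[C]_(n + n)) : Prop :=
  forall x (u v : M -> 'rV[C]_(n + n)),
    smooth_gen_at x u -> smooth_gen_at x v ->
    (\forall y \near x, L y (u y) /\ L y (v y)) -> L x (courant x u v).

Definition generalized_complex (L : M -> set 'rV[C]_(n + n)) : Prop :=
  generalized_almost_complex L /\ courant_closed L.

(* A is a complex structure on T_xM + T_x^*M with i-eigenspace L *)
Definition endo_of (L : set 'rV[C]_(n + n)) (A : 'M[R]_(n + n)) : Prop :=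
  A *m A = - 1%:M /\ L = [set u | u *m cplx A = 'i%C *: u].

Definition generalized_almost_Kahler
    (L1 L2 : M -> set 'rV[C]_(n + n)) : Prop :=
  [/\ generalized_almost_complex L1, generalized_almost_complex L2 &
      forall x, exists A1 A2 : 'M[R]_(n + n),
        [/\ endo_of (L1 x) A1, endo_of (L2 x) A2, A1 *m A2 = A2 *m A1 &
            forall w : 'rV[R]_(n + n), w != 0 ->
              pairing (w *m A2 *m A1) w < 0]].

Definition generalized_Kahler (L1 L2 : M -> set 'rV[C]_(n + n)) : Prop :=
  [/\ generalized_almost_Kahler L1 L2, generalized_complex L1
    & generalized_complex L2].

Definition almost_complex (J : M -> 'M[R]_n) : Prop :=
  smooth_end (fun x => cplx (J x)) /\ forall x, J x *m J x = - 1%:M.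

Definition T10 (J : M -> 'M[R]_n) (x : M) : set 'rV[C]_n :=
  [set X | X *m cplx (J x) = 'i%C *: X].
Definition T01 (J : M -> 'M[R]_n) (x : M) : set 'rV[C]_n :=
  @conj_mx R _ _ @` T10 J x.

Definition integrable_J (J : M -> 'M[R]_n) : Prop :=
  forall x (X Y : M -> 'rV[C]_n), smooth_vec_at x X -> smooth_vec_at x Y ->
    (\forall y \near x, T10 J y (X y) /\ T10 J y (Y y)) ->
    T10 J x (lie x X Y).

(* projection of T^C M onto T^{1,0} with kernel T^{0,1} *)
Definition rho (J : M -> 'M[R]_n) (x : M) : 'M[C]_n :=
  2^-1 *: (1%:M - 'i%C *: cplx (J x)).

(* (T^{1,0})^* is identified, by rho^*, with the annihilator of T^{0,1} *)
Definition T10dual (J : M -> 'M[R]_n) (x : M) : set 'rV[C]_n :=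
  [set a | forall Y, T01 J x Y -> ev a Y = 0].

Definition rho_push (J : M -> 'M[R]_n) (L : M -> set 'rV[C]_(n + n)) (x : M) :
    set 'rV[C]_(n + n) :=
  [set u | exists X a, [/\ T10dual J x a, L x (row_mx X (a *m (rho J x)^T))
                         & u = row_mx (X *m rho J x) a]].

Definition bivector10 (J : M -> 'M[R]_n) (s : M -> 'M[C]_n) : Prop :=
  smooth_biv s /\
  forall x, (s x)^T = - s x /\ (rho J x)^T *m s x *m rho J x = s x.

(* For X of type (0,1), the Dolbeault operator of T^{1,0} is
   dbar_X W = rho [X, W]; by the Leibniz rule the induced operator on
   Lambda^2 T^{1,0} is the projection of the Lie derivative along X. *)
Definition holomorphic_biv (J : M -> 'M[R]_n) (s : M -> 'M[C]_n) : Prop :=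
  forall x (X : M -> 'rV[C]_n), smooth_vec_at x X ->
    (\forall y \near x, T01 J y (X y)) ->
    (rho J x)^T *m lie_biv x X s *m rho J x = 0.

Definition holomorphic_Poisson_biv
    (J : M -> 'M[R]_n) (s : M -> 'M[C]_n) : Prop :=
  [/\ bivector10 J s, holomorphic_biv J s
    & forall x i j k, schouten x s i j k = 0].

Definition graph10 (J : M -> 'M[R]_n) (s : M -> 'M[C]_n) (x : M) :
    set 'rV[C]_(n + n) :=
  [set u | exists2 a, T10dual J x a & u = row_mx (a *m s x) a].

Definition holomorphic_Poisson
    (J : M -> 'M[R]_n) (G : M -> set 'rV[C]_(n + n)) : Prop :=
  exists s, holomorphic_Poisson_biv J s /\ forall x, G x = graph10 J s x.

Definition holomorphic_symplectic
    (J : M -> 'M[R]_n) (G : M -> set 'rV[C]_(n + n)) : Prop :=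
  exists s, [/\ holomorphic_Poisson_biv J s, forall x, G x = graph10 J s x
    & forall x a, T10dual J x a -> a *m s x = 0 -> a = 0].

Section BiHermitian.
Variables (g b Jp Jm : M -> 'M[R]_n).

Definition Lplus (x : M) : set 'rV[C]_(n + n) :=
  [set u | exists2 X, T10 Jp x X & u = row_mx X (X *m cplx (b x + g x))].
Definition Lminus (x : M) : set 'rV[C]_(n + n) :=
  [set u | exists2 X, T10 Jm x X & u = row_mx X (X *m cplx (b x - g x))].

Definition gak_L1 (x : M) : set 'rV[C]_(n + n) :=
  [set w | exists u v, [/\ Lplus x u, Lminus x v & w = u + v]].
Definition gak_L2 (x : M) : set 'rV[C]_(n + n) :=
  [set w | exists u v, [/\ Lplus x u, Lminus x v & w = u + conj_mx v]].
End BiHermitian.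

Definition tamed_almost_symplectic (eps J : M -> 'M[R]_n) : Prop :=
  [/\ smooth_form (fun x => cplx (eps x)),
      forall x, (eps x)^T = - eps x,
      forall x, eps x \in unitmx,
      almost_complex J
    & forall x (X : 'rV[R]_n), X != 0 -> 0 < ev (X *m J x *m eps x) X].

Variables (eps J : M -> 'M[R]_n).

(* X |-> - eps^-1 (J^* (eps X)) *)
Definition Jminus (x : M) : 'M[R]_n :=
  - (eps x *m (J x)^T *m invmx (eps x)).

(* symmetric and skew parts of (X, Y) |-> eps(JX, Y) *)
Definition tamed_g (x : M) : 'M[R]_n :=
  2^-1 *: (J x *m eps x + (J x *m eps x)^T).
Definition tamed_b (x : M) : 'M[R]_n :=
  2^-1 *: (J x *m eps x - (J x *m eps x)^T).

Definition tamed_L1 : M -> set 'rV[C]_(n + n) :=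
  gak_L1 tamed_g tamed_b J Jminus.
Definition tamed_L2 : M -> set 'rV[C]_(n + n) :=
  gak_L2 tamed_g tamed_b J Jminus.

End Fields.

(* Main.v *)
(* L2 is the graph of i eps, and a graph of a two-form is closed under the
   Courant bracket exactly when the form is closed, so a generalized Kaehler
   structure has d eps = 0. As L1 and L2 meet in the graph of i eps over T10 of
   J+, and L1 and conj L2 in the graph of - i eps over T10 of J-, both J+ and J-
   are then integrable.

   A vector field is handled through its components in the chart around one
   point x, with a torsion-free connection for which J+ is parallel at x; it
   exists because J+ is integrable. As T10 of J- is the orthogonal of T10 of J+
   with respect to eps, the integrability of J- says that (D_V eps)(X, Y) = 0 for
   V in T01 of J+ and X, Y in T01 of J-. With d eps = 0 this makes the bivector
   s = - i rho^T eps^-1 rho, whose graph is rho_* L2, holomorphic with vanishing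
   Schouten bracket. The roles of J+ and J- are symmetric.

   When D = J+ - J- is invertible, f = D^-1 eps is a nondegenerate two-form which
   is compatible with J+ and J-, and s = -+ f^-1 rho / 2; in particular s is
   nondegenerate on the dual of T10. If s is holomorphic Poisson, then its
   inverse f rho^T is a closed form, for both signs. Linear combinations of these
   two forms, up to conjugation, are eps and the form whose graph is L1. *)

Require Import Defs.
From mathcomp Require Import all_boot all_order all_algebra.
From mathcomp Require Import complex.
From mathcomp Require Import all_classical all_reals all_analysis.
Import Defs.
Import Order.TTheory GRing.Theory Num.Theory.
Import numFieldNormedType.Exports.
From mathcomp Require Import ring.
Local Open Scope classical_set_scope.
Local Open Scope ring_scope.

Set Implicit Arguments.
Unset Strict Implicit.
Unset Printing Implicit Defensive.

(** Every bracket in the statement involves first derivatives only, so at each point everything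
    reduces to identities between matrices and their first derivatives in one chart. This is why a
    connection that makes J+ parallel at a single point can replace holomorphic coordinates, and why
    no Newlander-Nirenberg theorem is involved. The connection knows nothing of J-, which enters
    through orthogonality: involutivity of T01 of J- is a symmetry of D eps in two directions of T01
    of J-, and closedness of eps moves the derivative onto a direction V in T01 of J+.

    Invertibility of D makes T^C M the direct sum of the two bundles T10, which is why L1 is then
    the graph of a two-form. As f is real, conjugating f rho^T merely replaces rho by 1 - rho.
    Taming enters through the definiteness of g: it makes J+ + J- invertible, whence the graph
    description of L2 and the nondegenerate imaginary part of the form of L1, and it gives the sign
    of the product of the two generalized structures. *)

Lemma near_open (T : topologicalType) (x : T) (P : T -> Prop) :
  (\forall y \near x, P y) ->
  exists W : set T, [/\ open W, W x & forall y, W y -> P y].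
Proof. by rewrite /prop_near1 nbhsE => -[W [oW Wx] WP]; exists W. Qed.

(** * Smoothness of real functions of several variables *)

Section DifferentiableExt.
Variables (R : realType) (V W : normedModType R).

(** The difference vanishes near [x], so the zero map satisfies the expansion that defines its
    differential there. Local expressions of fields are constrained only near a point, so smoothness
    facts have to be transported along equalities valid near that point. *)
Lemma near_eq_differentiable (f g : V -> W) (x : V) :
  (\forall y \near x, f y = g y) -> differentiable f x -> differentiable g x.
Proof.
move=> fg df; suff dh : differentiable (g - f) x.
  by rewrite -[g](subrK f); apply: differentiableD.
have h0 : (g - f) x = 0.
  by have := nbhs_singleton fg; rewrite /= !fctE => ->; rewrite subrr.
have E : (g - f) \o shift x = cst ((g - f) x) + (\0 : {linear V -> W}) +o_ 0 id.
  apply/eqaddoP => _/posnumP[e]; near=> y.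
  have -> : ((g - f) \o shift x - (cst ((g - f) x) + (\0 : V -> W))) y
            = g (y + x) - f (y + x).
    by rewrite -[RHS]subr0 -[X in _ = _ - X]h0 -[X in _ = _ - X]addr0.
  have -> : g (y + x) - f (y + x) = 0.
    apply/eqP; rewrite subr_eq0 eq_sym; apply/eqP; near: y.
    have := fg; rewrite (near_shift 0 x) /=.
    by apply: filterS => y; rewrite /= subr0.
  by rewrite normr0 mulr_ge0.
have c0 : continuous (\0 : {linear V -> W}) by move=> y; apply: cvg_cst.
by apply/diff_locallyP; rewrite (diff_unique c0 E).
Unshelve. all: by end_near. Qed.

End DifferentiableExt.

Section SmoothFunctions.
Variables (R : realType) (n : nat).
Implicit Types (U : set 'rV[R]_n) (f g : 'rV[R]_n -> R) (k : nat).

Lemma Ck_ext k U f g : open U -> (forall p, U p -> f p = g p) ->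
  Ck k U f -> Ck k U g.
Proof.
move=> oU; elim: k f g => [|k IH] f g fg /=.
  move=> cf p Up; have near_fg : {near p, f =1 g}.
    by near=> q; apply: fg; near: q; apply: open_nbhs_nbhs.
  have cp : f @ p --> f p := cf p Up.
  by rewrite (fg p Up) in cp; apply: cvg_trans (near_eq_cvg near_fg) cp.
have near_fg p : U p -> \forall q \near p, f q = g q.
  by move=> Up; near=> q; apply: fg; near: q; apply: open_nbhs_nbhs.
case=> df Df; split=> [p Up|v].
  exact: near_eq_differentiable (near_fg p Up) (df p Up).
by apply: IH (Df v) => p Up; apply: near_eq_derive; apply: near_fg.
Unshelve. all: by end_near. Qed.

Lemma Ck_sub k U V f : V `<=` U -> Ck k U f -> Ck k V f.
Proof.
move=> VU; elim: k f => [|k IH] f /=; first by move=> cf p /VU/cf.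
by case=> df Df; split=> [p /VU/df|v]; last exact: IH (Df v).
Qed.

(** Needed for the product and inverse rules: their derivatives still contain the undifferentiated
    functions, which must be fed to the induction at the lower order. *)
Lemma CkW k U f : Ck k.+1 U f -> Ck k U f.
Proof.
elim: k f => [|k IH] f [df Df] /=.
  by move=> p Up; apply: differentiable_continuous (df p Up).
by split=> // v; apply: IH.
Qed.

Lemma Ck_cst k U (c : R) : open U -> Ck k U (fun=> c).
Proof.
move=> oU; elim: k c => [|k IH] c /=; first by move=> p _; apply: cst_continuous.
split=> [p _|v]; first exact: (@differentiable_cst _ _ _ c p).
by apply: (@Ck_ext _ _ (fun=> 0)) => // p _; rewrite derive_cst.
Qed.

Lemma CkD k U f g : open U -> Ck k U f -> Ck k U g ->
  Ck k U (fun p => f p + g p).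
Proof.
move=> oU; elim: k f g => [|k IH] f g /=.
  by move=> cf cg p Up; apply: (cvgD (cf p Up) (cg p Up)).
case=> df Df [dg Dg]; split=> [p Up|v].
  by apply: differentiableD; [apply: df|apply: dg].
apply: Ck_ext (IH _ _ (Df v) (Dg v)) => // p Up.
rewrite (_ : 'D_v (fun p => f p + g p) p = 'D_v (f + g) p) //.
by rewrite deriveD //; [apply: diff_derivable (df p Up)|apply: diff_derivable (dg p Up)].
Qed.

Lemma CkM k U f g : open U -> Ck k U f -> Ck k U g ->
  Ck k U (fun p => f p * g p).
Proof.
move=> oU; elim: k f g => [|k IH] f g.
  by move=> cf cg p Up; apply: (cvgM (cf p Up) (cg p Up)).
move=> Cf Cg; have [df Df] := Cf; have [dg Dg] := Cg; split=> [p Up|v].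
  by apply: differentiableM; [apply: df|apply: dg].
apply: Ck_ext (CkD oU (IH _ _ (CkW Cf) (Dg v)) (IH _ _ (CkW Cg) (Df v))) => //.
move=> p Up; rewrite (_ : 'D_v (fun p => f p * g p) p = 'D_v (f * g) p) //.
by rewrite (deriveM (diff_derivable (df p Up)) (diff_derivable (dg p Up))).
Qed.

Lemma CkN k U f : open U -> Ck k U f -> Ck k U (fun p => - f p).
Proof.
move=> oU Cf; apply: Ck_ext (CkM oU (Ck_cst k (-1) oU) Cf) => // p _.
by rewrite mulN1r.
Qed.

Lemma CkV k U f : open U -> (forall p, U p -> f p != 0) -> Ck k U f ->
  Ck k U (fun p => (f p)^-1).
Proof.
move=> oU f0; elim: k => [|k IH].
  by move=> cf p Up; apply: (cvgV (f0 p Up) (cf p Up)).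
move=> Cf; have [df Df] := Cf; split=> [p Up|v].
  by apply: differentiableV; [apply: df|apply: f0].
have CV := IH (CkW Cf).
apply: Ck_ext (CkN oU (CkM oU (CkM oU CV CV) (Df v))) => // p Up.
rewrite (deriveV (f0 p Up) (diff_derivable (df p Up))).
by rewrite /GRing.scale /= mulNr -exprVn expr2.
Qed.

End SmoothFunctions.

(** * Smoothness of complex functions and of matrices of such functions *)

Section ComplexSmooth.
Variables (R : realType) (n : nat) (U : set 'rV[R]_n).
Hypothesis oU : open U.
Local Notation C := R[i].
Implicit Types f g : 'rV[R]_n -> C.

Definition csmooth f : Prop :=
  smooth_on U (fun q => complex.Re (f q)) /\
  smooth_on U (fun q => complex.Im (f q)).

Lemma csmooth_ext f g : (forall p, U p -> f p = g p) -> csmooth f -> csmooth g.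
Proof.
move=> fg [rf jf]; split=> k.
  by apply: Ck_ext (rf k) => // p Up; rewrite fg.
by apply: Ck_ext (jf k) => // p Up; rewrite fg.
Qed.

Lemma csmooth_cst (c : C) : csmooth (fun=> c).
Proof. by split=> k; apply: Ck_cst. Qed.

Lemma csmoothD f g : csmooth f -> csmooth g -> csmooth (fun p => f p + g p).
Proof.
move=> [rf jf] [rg jg]; split=> k.
  by apply: Ck_ext (CkD oU (rf k) (rg k)) => // p _; case: (f p); case: (g p).
by apply: Ck_ext (CkD oU (jf k) (jg k)) => // p _; case: (f p); case: (g p).
Qed.

Lemma csmoothM f g : csmooth f -> csmooth g -> csmooth (fun p => f p * g p).
Proof.
move=> [rf jf] [rg jg]; split=> k.
  apply: Ck_ext (CkD oU (CkM oU (rf k) (rg k))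
    (CkN oU (CkM oU (jf k) (jg k)))) => // p _.
  by case: (f p); case: (g p).
apply: Ck_ext (CkD oU (CkM oU (rf k) (jg k)) (CkM oU (jf k) (rg k))) => // p _.
by case: (f p); case: (g p).
Qed.

Lemma csmoothV f : (forall p, U p -> f p != 0) -> csmooth f ->
  csmooth (fun p => (f p)^-1).
Proof.
move=> f0 [rf jf].
(* The squared modulus: the inverse is the conjugate divided by this real function, to which [CkV]
   applies. *)
pose m p := complex.Re (f p) * complex.Re (f p)
          + complex.Im (f p) * complex.Im (f p).
have m0 p : U p -> m p != 0.
  move=> /f0; rewrite /m; case: (f p) => a b /=; apply: contra.
  rewrite -!expr2 paddr_eq0 ?sqr_ge0 // !sqrf_eq0 => /andP[/eqP -> /eqP ->].
  by [].
have Cm k : Ck k U (fun p => (m p)^-1).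
  exact: CkV (CkD oU (CkM oU (rf k) (rf k)) (CkM oU (jf k) (jf k))).
split=> k.
  apply: Ck_ext (CkM oU (rf k) (Cm k)) => // p _.
  by rewrite /m; case: (f p) => a b /=; rewrite !expr2.
apply: Ck_ext (CkN oU (CkM oU (jf k) (Cm k))) => // p _.
by rewrite /m; case: (f p) => a b /=; rewrite !expr2.
Qed.

Lemma csmooth_conj f : csmooth f -> csmooth (fun p => conjc (f p)).
Proof.
move=> [rf jf]; split=> k; first by apply: Ck_ext (rf k) => // p _; case: (f p).
by apply: Ck_ext (CkN oU (jf k)) => // p _; case: (f p).
Qed.

Lemma csmooth_sum (I : Type) (r : seq I) (P : pred I)
    (F : I -> 'rV[R]_n -> C) :
  (forall i, P i -> csmooth (F i)) -> csmooth (fun p => \sum_(i <- r | P i) F i p).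
Proof.
move=> sF; elim: r => [|i r IH].
  by apply: csmooth_ext (csmooth_cst 0) => p _; rewrite big_nil.
case Pi: (P i); last by apply: csmooth_ext IH => p _; rewrite big_cons Pi.
by apply: csmooth_ext (csmoothD (sF i Pi) IH) => p _; rewrite big_cons Pi.
Qed.

Lemma csmooth_prod (I : Type) (r : seq I) (P : pred I)
    (F : I -> 'rV[R]_n -> C) :
  (forall i, P i -> csmooth (F i)) ->
  csmooth (fun p => \prod_(i <- r | P i) F i p).
Proof.
move=> sF; elim: r => [|i r IH].
  by apply: csmooth_ext (csmooth_cst 1) => p _; rewrite big_nil.
case Pi: (P i); last by apply: csmooth_ext IH => p _; rewrite big_cons Pi.
by apply: csmooth_ext (csmoothM (sF i Pi) IH) => p _; rewrite big_cons Pi.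
Qed.

Lemma csmooth_det m (F : 'rV[R]_n -> 'M[C]_m) :
  (forall i j, csmooth (fun p => F p i j)) -> csmooth (fun p => \det (F p)).
Proof.
move=> sF; apply: csmooth_sum => s _; apply: csmoothM.
  exact: csmooth_cst.
by apply: csmooth_prod.
Qed.

Lemma csmooth_invmx m (F : 'rV[R]_n -> 'M[C]_m) :
  (forall p, U p -> F p \in unitmx) ->
  (forall i j, csmooth (fun p => F p i j)) ->
  forall i j, csmooth (fun p => invmx (F p) i j).
Proof.
move=> uF sF i j.
apply: (@csmooth_ext (fun p => (\det (F p))^-1 * cofactor (F p) j i)).
  by move=> p Up; rewrite /invmx uF // !mxE.
apply: csmoothM.
  apply: csmoothV; last exact: csmooth_det.
  by move=> p /uF; rewrite unitmxE unitfE.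
apply: csmoothM; first exact: csmooth_cst.
apply: csmooth_det => k l; apply: csmooth_ext (sF (lift j k) (lift i l)) => p _.
by rewrite !mxE.
Qed.

End ComplexSmooth.

Section SmoothNear.
Variables (R : realType) (n : nat).
Local Notation C := R[i].
Implicit Types p q : 'rV[R]_n.

Lemma csmooth_sub (U V : set 'rV[R]_n) (f : 'rV[R]_n -> C) :
  V `<=` U -> csmooth U f -> csmooth V f.
Proof. by move=> VU [rf jf]; split=> k; apply: Ck_sub (rf k) || apply: Ck_sub (jf k). Qed.

Lemma smooth_near_ext a b p (F G : 'rV[R]_n -> 'M[C]_(a, b)) :
  (\forall q \near p, F q = G q) -> smooth_near p F -> smooth_near p G.
Proof.
move=> /near_open[W [oW Wp WFG]] [U [oU Up sF]].
exists (U `&` W); split=> //; first exact: openI.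
move=> i j; apply: (@csmooth_ext _ _ _ _ (fun q => F q i j)).
- exact: openI.
- by move=> q [_ /WFG /= ->].
- by apply: csmooth_sub (sF i j) => q [].
Qed.

Lemma smooth_near_cst a b p (A : 'M[C]_(a, b)) : smooth_near p (fun=> A).
Proof.
exists setT; split=> //; first exact: openT.
by move=> i j; apply: csmooth_cst; apply: openT.
Qed.

(** Two functions smooth on different neighbourhoods are restricted to the intersection, so that an
    operation on them has to be treated on one open set only. *)
Lemma smooth_near2 a b c d e f p (F : 'rV[R]_n -> 'M[C]_(a, b))
   (G : 'rV[R]_n -> 'M[C]_(c, d)) (H : 'rV[R]_n -> 'M[C]_(e, f)) :
  (forall U : set 'rV[R]_n, open U ->
    (forall i j, csmooth U (fun q => F q i j)) ->
    (forall i j, csmooth U (fun q => G q i j)) ->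
    forall i j, csmooth U (fun q => H q i j)) ->
  smooth_near p F -> smooth_near p G -> smooth_near p H.
Proof.
move=> FGH [U [oU Up sF]] [V [oV Vp sG]].
exists (U `&` V); split=> //; first exact: openI.
apply: FGH; first exact: openI.
  by move=> i j; apply: csmooth_sub (sF i j) => q [].
by move=> i j; apply: csmooth_sub (sG i j) => q [].
Qed.

Lemma smooth_nearD a b p (F G : 'rV[R]_n -> 'M[C]_(a, b)) :
  smooth_near p F -> smooth_near p G -> smooth_near p (fun q => F q + G q).
Proof.
apply: smooth_near2 => U oU sF sG i j.
by apply: csmooth_ext (csmoothD oU (sF i j) (sG i j)) => // q _; rewrite mxE.
Qed.

Lemma smooth_nearM a b c p (F : 'rV[R]_n -> 'M[C]_(a, b))
    (G : 'rV[R]_n -> 'M[C]_(b, c)) :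
  smooth_near p F -> smooth_near p G -> smooth_near p (fun q => F q *m G q).
Proof.
apply: smooth_near2 => U oU sF sG i j.
apply: (@csmooth_ext _ _ _ oU (fun q => \sum_k F q i k * G q k j)).
  by move=> q _; rewrite mxE.
by apply: csmooth_sum => // k _; apply: csmoothM.
Qed.

Lemma smooth_nearZ a b p (c : C) (F : 'rV[R]_n -> 'M[C]_(a, b)) :
  smooth_near p F -> smooth_near p (fun q => c *: F q).
Proof.
move=> sF; apply: smooth_near_ext (smooth_nearM (smooth_near_cst p c%:M) sF).
by near=> q; rewrite mul_scalar_mx.
Unshelve. all: by end_near. Qed.

Lemma smooth_nearN a b p (F : 'rV[R]_n -> 'M[C]_(a, b)) :
  smooth_near p F -> smooth_near p (fun q => - F q).
Proof.
move=> sF; apply: smooth_near_ext (smooth_nearZ (-1) sF).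
by near=> q; rewrite scaleN1r.
Unshelve. all: by end_near. Qed.

Lemma smooth_near_tr a b p (F : 'rV[R]_n -> 'M[C]_(a, b)) :
  smooth_near p F -> smooth_near p (fun q => (F q)^T).
Proof.
move=> [U [oU Up sF]]; exists U; split=> // i j.
by apply: csmooth_ext (sF j i) => // q _; rewrite mxE.
Qed.

Lemma smooth_near_conj a b p (F : 'rV[R]_n -> 'M[C]_(a, b)) :
  smooth_near p F -> smooth_near p (fun q => conj_mx (F q)).
Proof.
move=> [U [oU Up sF]]; exists U; split=> // i j.
by apply: csmooth_ext (csmooth_conj oU (sF i j)) => // q _; rewrite mxE.
Qed.

Lemma smooth_near_inv a p (F : 'rV[R]_n -> 'M[C]_a) :
  (\forall q \near p, F q \in unitmx) ->
  smooth_near p F -> smooth_near p (fun q => invmx (F q)).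
Proof.
move=> /near_open[W [oW Wp WF]] [U [oU Up sF]].
exists (U `&` W); split=> //; first exact: openI.
apply: csmooth_invmx; first exact: openI.
  by move=> q [_ /WF].
by move=> i j; apply: csmooth_sub (sF i j) => q [].
Qed.

End SmoothNear.

(** * First derivatives of complex matrix-valued functions *)

Section Jets.
Variables (R : realType) (n : nat).
Local Notation C := R[i].
Implicit Types (p : 'rV[R]_n) (f g : 'rV[R]_n -> C).

Definition cdiff f p : Prop :=
  differentiable (fun q => complex.Re (f q)) p /\
  differentiable (fun q => complex.Im (f q)) p.

Lemma pd_ext f g p l : (\forall q \near p, f q = g q) -> pd f l p = pd g l p.
Proof.
move=> fg; congr Complex; apply: near_eq_derive;
  by apply: filterS fg => q /= ->.
Qed.

Lemma cdiff_ext f g p : (\forall q \near p, f q = g q) -> cdiff f p -> cdiff g p.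
Proof.
move=> fg [rf jf]; split; [move: rf|move: jf]; apply: near_eq_differentiable;
  by apply: filterS fg => q /= ->.
Qed.

Lemma cdiff_cst (c : C) p : cdiff (fun=> c) p.
Proof. by split; apply: (@differentiable_cst _ _ _ _ p). Qed.

Lemma pd_cst (c : C) l p : pd (fun=> c) l p = 0.
Proof. by rewrite /pd !derive_cst. Qed.

Lemma cdiffD f g p : cdiff f p -> cdiff g p -> cdiff (fun q => f q + g q) p.
Proof.
move=> [rf jf] [rg jg]; split.
  rewrite (_ : (fun _ => _) = (fun q => complex.Re (f q)) + (fun q => complex.Re (g q))).
    exact: differentiableD.
  by apply/funext => q; rewrite /GRing.add /=; case: (f q); case: (g q).
rewrite (_ : (fun _ => _) = (fun q => complex.Im (f q)) + (fun q => complex.Im (g q))).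
  exact: differentiableD.
by apply/funext => q; rewrite /GRing.add /=; case: (f q); case: (g q).
Qed.

Lemma pdD f g p l : cdiff f p -> cdiff g p ->
  pd (fun q => f q + g q) l p = pd f l p + pd g l p.
Proof.
move=> [rf jf] [rg jg]; rewrite /pd.
rewrite (_ : (fun q => complex.Re (f q + g q)) =
  (fun q => complex.Re (f q)) + (fun q => complex.Re (g q))); last first.
  by apply/funext => q; rewrite /GRing.add /=; case: (f q); case: (g q).
rewrite (_ : (fun q => complex.Im (f q + g q)) =
  (fun q => complex.Im (f q)) + (fun q => complex.Im (g q))); last first.
  by apply/funext => q; rewrite /GRing.add /=; case: (f q); case: (g q).
rewrite (deriveD (diff_derivable rf) (diff_derivable rg)).
by rewrite (deriveD (diff_derivable jf) (diff_derivable jg)).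
Qed.

Lemma ReM_fct f g : (fun q => complex.Re (f q * g q)) =
  (fun q => complex.Re (f q)) * (fun q => complex.Re (g q))
  - (fun q => complex.Im (f q)) * (fun q => complex.Im (g q)).
Proof.
by apply/funext => q; rewrite /GRing.add /GRing.opp /GRing.mul /=; case: (f q); case: (g q).
Qed.

Lemma ImM_fct f g : (fun q => complex.Im (f q * g q)) =
  (fun q => complex.Re (f q)) * (fun q => complex.Im (g q))
  + (fun q => complex.Im (f q)) * (fun q => complex.Re (g q)).
Proof.
by apply/funext => q; rewrite /GRing.add /GRing.opp /GRing.mul /=; case: (f q); case: (g q).
Qed.

Lemma cdiffM f g p : cdiff f p -> cdiff g p -> cdiff (fun q => f q * g q) p.
Proof.
move=> [rf jf] [rg jg]; split; rewrite (ReM_fct, ImM_fct).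
  by apply: differentiableB; apply: differentiableM.
by apply: differentiableD; apply: differentiableM.
Qed.

Lemma pdM f g p l : cdiff f p -> cdiff g p ->
  pd (fun q => f q * g q) l p = pd f l p * g p + f p * pd g l p.
Proof.
move=> [rf jf] [rg jg]; rewrite /pd ReM_fct ImM_fct.
have drf : derivable _ p (delta_mx 0 l) := diff_derivable rf.
have djf : derivable _ p (delta_mx 0 l) := diff_derivable jf.
have drg : derivable _ p (delta_mx 0 l) := diff_derivable rg.
have djg : derivable _ p (delta_mx 0 l) := diff_derivable jg.
rewrite (deriveB (derivableM drf drg) (derivableM djf djg)).
rewrite (deriveD (derivableM drf djg) (derivableM djf drg)).
rewrite (deriveM drf drg) (deriveM djf djg) (deriveM drf djg) (deriveM djf drg).
move: ('D_ _ (fun q => complex.Re (f q)) p) ('D_ _ (fun q => complex.Im (f q)) p)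
  ('D_ _ (fun q => complex.Re (g q)) p) ('D_ _ (fun q => complex.Im (g q)) p).
case: (f p) => a b; case: (g p) => c d e1 e2 e3 e4 /=.
by rewrite /GRing.scale /=; congr Complex; ring.
Qed.

Lemma pd_conj f p l : cdiff f p -> pd (fun q => conjc (f q)) l p = conjc (pd f l p).
Proof.
move=> [rf jf]; rewrite /pd /=; congr Complex.
  by congr ('D_ _ _ p); apply/funext => q; case: (f q).
rewrite -(deriveN (diff_derivable jf)).
by congr ('D_ _ _ p); apply/funext => q; rewrite /GRing.opp /=; case: (f q).
Qed.

Lemma cdiff_sum (I : Type) (r : seq I) (F : I -> 'rV[R]_n -> C) p :
  (forall i, cdiff (F i) p) -> cdiff (fun q => \sum_(i <- r) F i q) p.
Proof.
move=> dF; elim: r => [|i r IH].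
  by apply: cdiff_ext (cdiff_cst 0 p); near=> q; rewrite big_nil.
by apply: cdiff_ext (cdiffD (dF i) IH); near=> q; rewrite big_cons.
Unshelve. all: by end_near. Qed.

Lemma pd_sum (I : Type) (r : seq I) (F : I -> 'rV[R]_n -> C) p l :
  (forall i, cdiff (F i) p) ->
  pd (fun q => \sum_(i <- r) F i q) l p = \sum_(i <- r) pd (F i) l p.
Proof.
move=> dF; elim: r => [|i r IH].
  rewrite big_nil -[RHS](pd_cst 0 l p); apply: pd_ext.
  by near=> q; rewrite big_nil.
rewrite big_cons -IH -(pdD l (dF i) (cdiff_sum r dF)); apply: pd_ext.
by near=> q; rewrite big_cons.
Unshelve. all: by end_near. Qed.

Section Matrices.
Variables a b : nat.
Implicit Types F G : 'rV[R]_n -> 'M[C]_(a, b).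

Definition jdiff F p : Prop := forall i j, cdiff (fun q => F q i j) p.

(** The directional derivative, extended C-linearly to complex directions. Conjugating the function
    therefore conjugates the direction as well, as in [dmx_conj]. *)
Definition dmx F p (X : 'rV[C]_n) : 'M[C]_(a, b) :=
  \matrix_(i, j) \sum_l X 0 l * pd (fun q => F q i j) l p.

Lemma dmx_linear F p c X Y : dmx F p (c *: X + Y) = c *: dmx F p X + dmx F p Y.
Proof.
apply/matrixP => i j; rewrite !mxE mulr_sumr -big_split /=.
by apply: eq_bigr => l _; rewrite !mxE mulrDl mulrA.
Qed.

Lemma jdiff_ext F G p : (\forall q \near p, F q = G q) -> jdiff F p -> jdiff G p.
Proof.
move=> FG dF i j; apply: cdiff_ext (dF i j).
by apply: filterS FG => q ->.
Qed.

Lemma dmx_ext F G p X : (\forall q \near p, F q = G q) -> dmx F p X = dmx G p X.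
Proof.
move=> FG; apply/matrixP => i j; rewrite !mxE; apply: eq_bigr => l _.
by congr (_ * _); apply: pd_ext; apply: filterS FG => q ->.
Qed.

Lemma jdiff_cst (A : 'M[C]_(a, b)) p : jdiff (fun=> A) p.
Proof. by move=> i j; apply: cdiff_cst. Qed.

Lemma dmx_cst (A : 'M[C]_(a, b)) p X : dmx (fun=> A) p X = 0.
Proof.
by apply/matrixP => i j; rewrite !mxE big1 // => l _; rewrite pd_cst mulr0.
Qed.

Lemma dmxD F G p X : jdiff F p -> jdiff G p ->
  dmx (fun q => F q + G q) p X = dmx F p X + dmx G p X.
Proof.
move=> dF dG; apply/matrixP => i j; rewrite !mxE -big_split /=.
apply: eq_bigr => l _; rewrite -mulrDr -pdD //; congr (_ * _); apply: pd_ext.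
by near=> q; rewrite mxE.
Unshelve. all: by end_near. Qed.

Lemma smooth_near_jdiff F p : smooth_near p F -> jdiff F p.
Proof.
move=> [U [_ Up sF]] i j; have [rf jf] := sF i j.
by have [[/(_ p Up) ? _] [/(_ p Up) ? _]] := (rf 1%N, jf 1%N).
Qed.

End Matrices.

Lemma jdiff_tr a b (F : 'rV[R]_n -> 'M[C]_(a, b)) p :
  jdiff F p -> jdiff (fun q => (F q)^T) p.
Proof.
move=> dF i j; apply: cdiff_ext (dF j i).
by near=> q; rewrite mxE.
Unshelve. all: by end_near. Qed.

Lemma dmx_tr a b (F : 'rV[R]_n -> 'M[C]_(a, b)) p X :
  dmx (fun q => (F q)^T) p X = (dmx F p X)^T.
Proof.
apply/matrixP => i j; rewrite !mxE; apply: eq_bigr => l _.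
by congr (_ * _); apply: pd_ext; near=> q; rewrite mxE.
Unshelve. all: by end_near. Qed.

Lemma dmx_conj a b (F : 'rV[R]_n -> 'M[C]_(a, b)) p X : jdiff F p ->
  dmx (fun q => conj_mx (F q)) p X = conj_mx (dmx F p (conj_mx X)).
Proof.
move=> dF; apply/matrixP => i j; rewrite !mxE rmorph_sum.
apply: eq_bigr => l _; rewrite rmorphM; congr (_ * _).
  by rewrite mxE; symmetry; apply: conjcK.
rewrite -[RHS](pd_conj _ (dF i j)).
by apply: pd_ext; near=> q; rewrite mxE.
Unshelve. all: by end_near. Qed.

Lemma jdiffM a b c (F : 'rV[R]_n -> 'M[C]_(a, b))
    (G : 'rV[R]_n -> 'M[C]_(b, c)) p :
  jdiff F p -> jdiff G p -> jdiff (fun q => F q *m G q) p.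
Proof.
move=> dF dG i j.
apply: (@cdiff_ext (fun q => \sum_k F q i k * G q k j)).
  by near=> q; rewrite mxE.
by apply: cdiff_sum => k; apply: cdiffM.
Unshelve. all: by end_near. Qed.

Lemma dmxM a b c (F : 'rV[R]_n -> 'M[C]_(a, b))
    (G : 'rV[R]_n -> 'M[C]_(b, c)) p X :
  jdiff F p -> jdiff G p ->
  dmx (fun q => F q *m G q) p X = dmx F p X *m G p + F p *m dmx G p X.
Proof.
move=> dF dG; apply/matrixP => i j; rewrite !mxE -big_split /=.
under eq_bigr => l _.
  rewrite (@pd_ext _ (fun q => \sum_k F q i k * G q k j)); last first.
    by near=> q; rewrite mxE.
  rewrite pd_sum; last by move=> k; apply: cdiffM.
  rewrite mulr_sumr; under eq_bigr => k _ do rewrite pdM // mulrDr mulrA mulrCA.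
  over.
rewrite exchange_big /=; apply: eq_bigr => k _.
by rewrite big_split /= !mxE mulr_suml mulr_sumr.
Unshelve. all: by end_near. Qed.

Lemma jdiffZ a b (c : C) (F : 'rV[R]_n -> 'M[C]_(a, b)) p :
  jdiff F p -> jdiff (fun q => c *: F q) p.
Proof.
move=> dF; apply: jdiff_ext (jdiffM (jdiff_cst c%:M p) dF).
by near=> q; rewrite mul_scalar_mx.
Unshelve. all: by end_near. Qed.

Lemma dmxZ a b (c : C) (F : 'rV[R]_n -> 'M[C]_(a, b)) p X : jdiff F p ->
  dmx (fun q => c *: F q) p X = c *: dmx F p X.
Proof.
move=> dF; have := dmxM X (jdiff_cst c%:M p) dF.
rewrite dmx_cst mul0mx add0r mul_scalar_mx => <-.
by apply: dmx_ext; near=> q; rewrite mul_scalar_mx.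
Unshelve. all: by end_near. Qed.

End Jets.

(** * Complexification, conjugation and Jacobians *)

Section Complexification.
Variable R : realType.
Local Notation C := R[i].

Lemma cplxM a b c (A : 'M[R]_(a, b)) (B : 'M[R]_(b, c)) :
  cplx (A *m B) = cplx A *m cplx B.
Proof. exact: map_mxM. Qed.
Lemma cplxD a b (A B : 'M[R]_(a, b)) : cplx (A + B) = cplx A + cplx B.
Proof. exact: map_mxD. Qed.
Lemma cplxN a b (A : 'M[R]_(a, b)) : cplx (- A) = - cplx A.
Proof. exact: map_mxN. Qed.
Lemma cplxB a b (A B : 'M[R]_(a, b)) : cplx (A - B) = cplx A - cplx B.
Proof. exact: map_mxB. Qed.
Lemma cplx_tr a b (A : 'M[R]_(a, b)) : cplx A^T = (cplx A)^T.
Proof. by rewrite /cplx map_trmx. Qed.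
Lemma cplx1 a : cplx (1%:M : 'M[R]_a) = 1%:M.
Proof. exact: map_mx1. Qed.

Lemma cplx_unit a (A : 'M[R]_a) : (cplx A \in unitmx) = (A \in unitmx).
Proof. exact: map_unitmx. Qed.
Lemma cplx_inv a (A : 'M[R]_a) : cplx (invmx A) = invmx (cplx A).
Proof. exact: map_invmx. Qed.

Lemma conj_mxM a b c (A : 'M[C]_(a, b)) (B : 'M[C]_(b, c)) :
  conj_mx (A *m B) = conj_mx A *m conj_mx B.
Proof. exact: map_mxM. Qed.
Lemma conj_mxD a b (A B : 'M[C]_(a, b)) : conj_mx (A + B) = conj_mx A + conj_mx B.
Proof. exact: map_mxD. Qed.

Lemma conj_mxB a b (A B : 'M[C]_(a, b)) : conj_mx (A - B) = conj_mx A - conj_mx B.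
Proof. exact: map_mxB. Qed.
Lemma conj_mxZ a b c (A : 'M[C]_(a, b)) : conj_mx (c *: A) = conjc c *: conj_mx A.
Proof. exact: map_mxZ. Qed.
Lemma conj_mx_tr a b (A : 'M[C]_(a, b)) : conj_mx A^T = (conj_mx A)^T.
Proof. by rewrite /conj_mx map_trmx. Qed.
Lemma conj_mx1 a : conj_mx (1%:M : 'M[C]_a) = 1%:M.
Proof. exact: map_mx1. Qed.
Lemma conj_mx0 a b : conj_mx (0 : 'M[C]_(a, b)) = 0.
Proof. exact: map_mx0. Qed.
Lemma conj_mxK a b (A : 'M[C]_(a, b)) : conj_mx (conj_mx A) = A.
Proof. by apply/matrixP => i j; rewrite !mxE; apply: conjcK. Qed.
Lemma conj_cplx a b (A : 'M[R]_(a, b)) : conj_mx (cplx A) = cplx A.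
Proof. by apply/matrixP => i j; rewrite !mxE; apply: conjc_real. Qed.
Lemma conj_i : conjc ('i%C : C) = - 'i%C.
Proof. by congr Complex; rewrite /= ?oppr0. Qed.

End Complexification.

Section Jacobians.
Variables (R : realType) (n : nat).
Implicit Types (f g : 'rV[R]_n -> 'rV[R]_n) (p : 'rV[R]_n).

Lemma differentiable_rV m (f : 'rV[R]_m -> 'rV[R]_n) (p : 'rV[R]_m) :
  (forall j, differentiable (fun q => f q 0 j : R) p) -> differentiable f p.
Proof.
move=> df; rewrite (_ : f = \sum_(j < n) (fun q => f q 0 j *: delta_mx 0 j)).
  by apply: differentiable_sum => j; apply: differentiableZl.
apply/funext => q; rewrite fct_sumE; exact: row_sum_delta.
Qed.

Lemma jacobian_near_id f p : differentiable f p ->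
  (\forall q \near p, f q = q) -> jacobian f p = 1%:M.
Proof.
move=> df fid; apply/row_matrixP => i; rewrite rowE row1.
have <- := deriveEjacobian (delta_mx 0 i) df.
by rewrite (near_eq_derive (g := id)) // derive_id.
Qed.

Lemma jacobian_inv f g p : differentiable f p -> differentiable g (f p) ->
  (\forall q \near p, g (f q) = q) ->
  jacobian f p *m jacobian g (f p) = 1%:M.
Proof.
move=> df dg gf; have dgf : differentiable (g \o f) p by exact: differentiable_comp.
rewrite -(jacobian_near_id dgf gf).
have E (h : 'rV[R]_n -> 'rV[R]_n) q v : v *m jacobian h q = 'd h q v.
  exact: mul_rV_lin1.
apply/row_matrixP => i; rewrite !rowE mulmxA.
set e := delta_mx 0 i.
have Ef := E f p e; have Eg := E g (f p) ('d f p e).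
have Egf := E (g \o f) p e.
have dE : 'd (g \o f) p e = 'd g (f p) ('d f p e).
  exact: (congr1 (fun h => h e) (diff_comp df dg)).
exact: etrans (congr1 (mulmx^~ _) Ef) (etrans Eg (esym (etrans Egf dE))).
Qed.

End Jacobians.

(** * Change of frame for vectors, endomorphisms, forms and bivectors *)

Section Congruence.
Variables (C : fieldType) (n : nat) (A B : 'M[C]_n).
Hypothesis BA1 : B *m A = 1%:M.
Implicit Types (E F : 'M[C]_n).

Let BA k l (S : 'M[C]_(k, n)) (T : 'M[C]_(n, l)) : S *m B *m (A *m T) = S *m T.
Proof. by rewrite mulmxA -(mulmxA S) BA1 mulmx1. Qed.

Let BAt k l (S : 'M[C]_(k, n)) (T : 'M[C]_(n, l)) :
  S *m A^T *m (B^T *m T) = S *m T.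
Proof. by rewrite mulmxA -(mulmxA S) -trmx_mul BA1 trmx1 mulmx1. Qed.

Let A_unit : A \in unitmx. Proof. by case: (mulmx1_unit BA1). Qed.

Let B_inv : B = invmx A.
Proof. by rewrite -[LHS]mulmx1 -(mulmxV A_unit) mulmxA BA1 mul1mx. Qed.

(** In use, [A] and [B] are the Jacobians [jacf] and [jacb] at one point. Inserting [B *m A] between
    the factors shows, here and in the next lemmas, that a contraction of tensors may be computed
    from their expressions in the chart. *)
Lemma vec_mul_congr k l m (S : 'M[C]_(k, n)) (T : 'M[C]_(n, l)) (U : 'M[C]_(l, m)) :
  S *m T *m U = S *m B *m (A *m T *m U).
Proof. by rewrite -(mulmxA A) BA mulmxA. Qed.

Lemma end_mul_congr k l m r (S : 'M[C]_(k, l)) (T : 'M[C]_(l, n))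
    (U : 'M[C]_(n, m)) (V : 'M[C]_(m, r)) :
  S *m (T *m U) *m V = S *m T *m B *m (A *m U *m V).
Proof. by rewrite -(mulmxA A) BA !mulmxA. Qed.

Lemma form_congr_unit E : E \in unitmx -> A *m E *m A^T \in unitmx.
Proof. by move=> uE; rewrite !unitmx_mul unitmx_tr A_unit uE. Qed.

Lemma end_congr_unit E : E \in unitmx -> A *m E *m B \in unitmx.
Proof. by move=> uE; rewrite B_inv !unitmx_mul unitmx_inv A_unit uE. Qed.

Lemma invmx_mul (S T : 'M[C]_n) : S \in unitmx -> T \in unitmx ->
  invmx (S *m T) = invmx T *m invmx S.
Proof.
move=> uS uT; have uST : S *m T \in unitmx by rewrite unitmx_mul uS.
apply: (can_inj (mulKmx uST)); rewrite mulmxV // mulmxA.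
by rewrite -(mulmxA S) mulmxV // mulmx1 mulmxV.
Qed.

Lemma end_congr_inv E : E \in unitmx ->
  A *m invmx E *m B = invmx (A *m E *m B).
Proof.
move=> uE; have uAE : A *m E \in unitmx by rewrite unitmx_mul A_unit uE.
rewrite B_inv (invmx_mul uAE) ?unitmx_inv // (invmx_mul A_unit uE).
by rewrite invmxK mulmxA.
Qed.

Lemma form_congr_inv E : E \in unitmx ->
  B^T *m invmx E *m B = invmx (A *m E *m A^T).
Proof.
move=> uE; have uAE : A *m E \in unitmx by rewrite unitmx_mul A_unit uE.
rewrite B_inv (invmx_mul uAE) ?unitmx_tr // (invmx_mul A_unit uE).
by rewrite trmx_inv mulmxA.
Qed.

Lemma biv_end_congr E F :
  B^T *m (E^T *m F *m E) *m B = (A *m E *m B)^T *m (B^T *m F *m B) *m (A *m E *m B).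
Proof.
rewrite 2!trmx_mul [B^T *m (E^T *m A^T)]mulmxA -[B^T *m F *m B]mulmxA BAt.
by rewrite [B^T *m E^T *m (F *m B)]mulmxA -[A *m E *m B]mulmxA BA !mulmxA.
Qed.

Lemma biv_trend_congr E F : B^T *m (E^T *m F) *m B = (A *m E *m B)^T *m (B^T *m F *m B).
Proof.
by rewrite 2!trmx_mul [B^T *m (E^T *m A^T)]mulmxA -[B^T *m F *m B]mulmxA BAt !mulmxA.
Qed.

Lemma biv_mul_congr E F : B^T *m (F *m E) *m B = (B^T *m F *m B) *m (A *m E *m B).
Proof. by rewrite -(mulmxA A E) BA !mulmxA. Qed.

Lemma form_trend_congr E F : A *m (F *m E^T) *m A^T = (A *m F *m A^T) *m (A *m E *m B)^T.
Proof. by rewrite 2!trmx_mul BAt !mulmxA. Qed.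

Lemma end_adj_congr E F : F \in unitmx ->
  A *m (F *m E^T *m invmx F) *m B =
  (A *m F *m A^T) *m (A *m E *m B)^T *m invmx (A *m F *m A^T).
Proof.
move=> uF; rewrite -form_congr_inv //.
rewrite 2!trmx_mul BAt -[B^T *m invmx _ *m B]mulmxA.
by rewrite (mulmxA _ E^T) BAt !mulmxA.
Qed.

Lemma ev_congr (a v : 'rV[C]_n) : ev a v = ev (a *m A^T) (v *m B).
Proof. by rewrite /ev trmx_mul BAt. Qed.

End Congruence.

(** * Tensors in the chart around a point *)

Section Charts.
Variables (R : realType) (n : nat) (M : manifold R n).
Local Notation C := R[i].
Implicit Types (x y z : M) (p q : 'rV[R]_n).

Definition ddom x : set M := dom (chart_at x).
Definition cod x : set 'rV[R]_n := coord x @` ddom x.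

Lemma chart_atP x : atlas (chart_at x) /\ ddom x x.
Proof. by rewrite /ddom /chart_at; case: cid. Qed.

Lemma ddom_id x : ddom x x. Proof. by have [] := chart_atP x. Qed.

Lemma cod_id x : cod x (coord x x).
Proof. by exists x => //; apply: ddom_id. Qed.

Lemma pointK x y : ddom x y -> point x (coord x y) = y.
Proof. exact: cmapK. Qed.

Lemma cod_coord x y : ddom x y -> cod x (coord x y).
Proof. by exists y. Qed.

Lemma ddom_point x q : cod x q -> ddom x (point x q).
Proof. by case=> y Dy <-; rewrite pointK. Qed.

Lemma coordK x q : cod x q -> coord x (point x q) = q.
Proof. by case=> y Dy <-; rewrite pointK. Qed.

Lemma near_ddom x : \forall y \near x, ddom x y.
Proof. by apply: open_nbhs_nbhs; split; [apply: dom_open|apply: ddom_id]. Qed.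

Lemma near_cod x q : cod x q -> \forall q' \near q, cod x q'.
Proof. by move=> Cq; apply: open_nbhs_nbhs; split=> //; apply: cod_open. Qed.

Lemma near_point x q (P : M -> Prop) : cod x q ->
  (\forall y \near point x q, P y) -> \forall q' \near q, P (point x q').
Proof.
move=> Cq Px; have c : point x @ q --> point x q by exact: cinv_cont Cq.
exact: c Px.
Qed.

Lemma near_point_id x (P : M -> Prop) :
  (\forall y \near x, P y) -> \forall q \near coord x x, P (point x q).
Proof.
by move=> Px; apply: near_point; [apply: cod_id|rewrite pointK //; apply: ddom_id].
Qed.

Lemma transition_diff x z y : ddom x y -> ddom z y ->
  differentiable (coord z \o point x) (coord x y).
Proof.
move=> xy zy; apply: differentiable_rV => j.
have [ax _] := chart_atP x; have [az _] := chart_atP z.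
have [+ _] := atlas_smooth ax az j 1%N; apply.
by exists y.
Qed.

Lemma near_transitionK x z y : ddom x y -> ddom z y ->
  \forall q \near coord x y, (coord x \o point z) ((coord z \o point x) q) = q.
Proof.
move=> xy zy; near=> q.
have zq : ddom z (point x q).
  near: q; apply: near_point; first exact: cod_coord.
  by rewrite pointK //; apply: open_nbhs_nbhs; split => //; apply: dom_open.
rewrite /= pointK // coordK //; near: q; apply: near_cod; exact: cod_coord.
Unshelve. all: by end_near. Qed.

Lemma chart_jacK x z y : ddom x y -> ddom z y ->
  chart_jac x z y *m chart_jac z x y = 1%:M.
Proof.
move=> xy zy; rewrite /chart_jac -cplxM -cplx1; congr cplx.
have fE : coord z y = (coord z \o point x) (coord x y) by rewrite /= pointK.
rewrite fE; apply: jacobian_inv.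
- exact: transition_diff.
- by rewrite -fE; apply: transition_diff.
- exact: near_transitionK.
Qed.

Lemma chart_jac_id x y : ddom x y -> chart_jac x x y = 1%:M.
Proof.
move=> xy; rewrite /chart_jac -cplx1; congr cplx.
apply: jacobian_near_id; first exact: transition_diff.
near=> q; rewrite /= coordK //; near: q; apply: near_cod; exact: cod_coord.
Unshelve. all: by end_near. Qed.

Lemma conj_chart_jac x z y : conj_mx (chart_jac x z y) = chart_jac x z y.
Proof. exact: conj_cplx. Qed.

Opaque chart_jac.

(* the Jacobians of the coordinate change between the charts around x and
   around the point of coordinates q *)
Definition jacf x q : 'M[C]_n := chart_jac x (point x q) (point x q).
Definition jacb x q : 'M[C]_n := chart_jac (point x q) x (point x q).

Lemma jacfb x q : cod x q -> jacf x q *m jacb x q = 1%:M.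
Proof.
by move=> /ddom_point xq; apply: chart_jacK => //; apply: ddom_id.
Qed.

Lemma jacbf x q : cod x q -> jacb x q *m jacf x q = 1%:M.
Proof. by move=> /jacfb/mulmx1C. Qed.

Lemma jacf_id x : jacf x (coord x x) = 1%:M.
Proof. by rewrite /jacf pointK ?chart_jac_id //; apply: ddom_id. Qed.

Lemma jacb_id x : jacb x (coord x x) = 1%:M.
Proof. by rewrite /jacb pointK ?chart_jac_id //; apply: ddom_id. Qed.

Lemma loc_vec_id x X : loc_vec x X (coord x x) = X x.
Proof. by rewrite /loc_vec -/(jacb _ _) jacb_id mulmx1 pointK //; apply: ddom_id. Qed.

Lemma loc_end_id x A : loc_end x A (coord x x) = A x.
Proof.
by rewrite /loc_end -/(jacf _ _) -/(jacb _ _) jacf_id jacb_id mulmx1 mul1mx pointK //; apply: ddom_id.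
Qed.
Lemma loc_form_id x A : loc_form x A (coord x x) = A x.
Proof.
by rewrite /loc_form -/(jacf _ _) jacf_id trmx1 mulmx1 mul1mx pointK //; apply: ddom_id.
Qed.
Lemma loc_biv_id x A : loc_biv x A (coord x x) = A x.
Proof.
by rewrite /loc_biv -/(jacb _ _) jacb_id trmx1 mulmx1 mul1mx pointK //; apply: ddom_id.
Qed.

Section AtPoint.
Variables (x : M) (q : 'rV[R]_n).
Hypothesis xq : cod x q.
Implicit Types (X : M -> 'rV[C]_n) (E F : M -> 'M[C]_n).
Let y := point x q.

Lemma loc_vecM X E : loc_vec x (fun y => X y *m E y) q = loc_vec x X q *m loc_end x E q.
Proof. apply: (vec_mul_congr (jacbf xq)). Qed.

Lemma loc_cov_form X E :
  loc_cov x (fun y => X y *m E y) q = loc_vec x X q *m loc_form x E q.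
Proof. apply: (vec_mul_congr (jacbf xq)). Qed.

Lemma loc_endM E F : loc_end x (fun y => E y *m F y) q = loc_end x E q *m loc_end x F q.
Proof. apply: (end_mul_congr (jacbf xq)). Qed.

Lemma loc_end_form E F : loc_form x (fun y => E y *m F y) q = loc_end x E q *m loc_form x F q.
Proof. apply: (end_mul_congr (jacbf xq)). Qed.

Lemma loc_end1 : loc_end x (fun=> 1%:M) q = 1%:M.
Proof. by rewrite /loc_end mulmx1; apply: (jacfb xq). Qed.

Lemma loc_endD E F : loc_end x (fun y => E y + F y) q = loc_end x E q + loc_end x F q.
Proof. by rewrite /loc_end mulmxDr mulmxDl. Qed.

Lemma loc_endZ c E : loc_end x (fun y => c *: E y) q = c *: loc_end x E q.
Proof. by rewrite /loc_end -scalemxAr -scalemxAl. Qed.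

Lemma loc_formD E F : loc_form x (fun y => E y + F y) q = loc_form x E q + loc_form x F q.
Proof. by rewrite /loc_form mulmxDr mulmxDl. Qed.

Lemma loc_formZ c E : loc_form x (fun y => c *: E y) q = c *: loc_form x E q.
Proof. by rewrite /loc_form -scalemxAr -scalemxAl. Qed.

Lemma loc_form_unit E : E y \in unitmx -> loc_form x E q \in unitmx.
Proof. by move=> uE; apply: (form_congr_unit (jacbf xq)). Qed.

Lemma loc_end_unit E : E y \in unitmx -> loc_end x E q \in unitmx.
Proof. by move=> uE; apply: (end_congr_unit (jacbf xq)). Qed.

Lemma loc_end_inv E : E y \in unitmx ->
  loc_end x (fun y => invmx (E y)) q = invmx (loc_end x E q).
Proof. by move=> uE; apply: (end_congr_inv (jacbf xq)). Qed.

Lemma loc_biv_inv E : E y \in unitmx ->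
  loc_biv x (fun y => invmx (E y)) q = invmx (loc_form x E q).
Proof. by move=> uE; apply: (form_congr_inv (jacbf xq)). Qed.

Lemma loc_biv_end E F : loc_biv x (fun y => (E y)^T *m F y *m E y) q =
  (loc_end x E q)^T *m loc_biv x F q *m loc_end x E q.
Proof. apply: (biv_end_congr (jacbf xq)). Qed.

Lemma loc_biv_trend E F : loc_biv x (fun y => (E y)^T *m F y) q =
  (loc_end x E q)^T *m loc_biv x F q.
Proof. apply: (biv_trend_congr (jacbf xq)). Qed.

Lemma loc_biv_mul E F : loc_biv x (fun y => F y *m E y) q =
  loc_biv x F q *m loc_end x E q.
Proof. apply: (biv_mul_congr (jacbf xq)). Qed.

Lemma loc_form_trend E F : loc_form x (fun y => F y *m (E y)^T) q =
  loc_form x F q *m (loc_end x E q)^T.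
Proof. apply: (form_trend_congr (jacbf xq)). Qed.

Lemma loc_bivZ c E : loc_biv x (fun y => c *: E y) q = c *: loc_biv x E q.
Proof. by rewrite /loc_biv -scalemxAr -scalemxAl. Qed.

Lemma loc_end_adj E F : F y \in unitmx ->
  loc_end x (fun y => F y *m (E y)^T *m invmx (F y)) q =
  loc_form x F q *m (loc_end x E q)^T *m invmx (loc_form x F q).
Proof. by move=> uF; apply: (end_adj_congr (jacbf xq)). Qed.

Lemma ev_loc (a v : M -> 'rV[C]_n) : ev (a y) (v y) = ev (loc_cov x a q) (loc_vec x v q).
Proof. apply: (ev_congr (jacbf xq)). Qed.

End AtPoint.

Section Conjugation.
Variables (x : M) (q : 'rV[R]_n).

Lemma loc_vec_conj (X : M -> 'rV[C]_n) :
  loc_vec x (fun y => conj_mx (X y)) q = conj_mx (loc_vec x X q).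
Proof.
rewrite /loc_vec; set A := chart_jac _ _ _.
by rewrite conj_mxM (conj_chart_jac _ _ _ : conj_mx A = A).
Qed.

Lemma loc_end_conj (E : M -> 'M[C]_n) :
  loc_end x (fun y => conj_mx (E y)) q = conj_mx (loc_end x E q).
Proof.
have cA := conj_chart_jac x (point x q) (point x q).
have cB := conj_chart_jac (point x q) x (point x q).
rewrite /loc_end; move: (chart_jac _ _ _) (chart_jac _ _ _) cA cB => A B cA cB.
by rewrite 2!conj_mxM cA cB.
Qed.

Lemma loc_form_conj (W : M -> 'M[C]_n) :
  loc_form x (fun y => conj_mx (W y)) q = conj_mx (loc_form x W q).
Proof.
have cA := conj_chart_jac x (point x q) (point x q).
rewrite /loc_form; move: (chart_jac _ _ _) cA => A cA.
by rewrite 2!conj_mxM conj_mx_tr cA.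
Qed.

End Conjugation.

(** A right inverse of [loc_vec] on the domain of the chart. It supplies the test fields on which
    closure under brackets is evaluated. *)
Definition unloc_vec x (Xh : 'rV[R]_n -> 'rV[C]_n) (y : M) : 'rV[C]_n :=
  Xh (coord x y) *m chart_jac x y y.

Lemma unloc_vecK x Xh q : cod x q -> loc_vec x (unloc_vec x Xh) q = Xh q.
Proof.
move=> xq; rewrite /loc_vec /unloc_vec -/(jacf _ _) -/(jacb _ _) coordK //.
by rewrite -mulmxA (jacfb xq) mulmx1.
Qed.

Lemma near_unloc_vecK x Xh :
  \forall q \near coord x x, loc_vec x (unloc_vec x Xh) q = Xh q.
Proof.
by near=> q; apply: unloc_vecK; near: q; apply: near_cod; apply: cod_id.
Unshelve. all: by end_near. Qed.

Lemma unloc_vec_smooth x Xh : smooth_near (coord x x) Xh ->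
  smooth_vec_at x (unloc_vec x Xh).
Proof.
apply: smooth_near_ext; apply: filterS (near_unloc_vecK x Xh) => q ->; by [].
Qed.

Lemma near_codI x (P : 'rV[R]_n -> Prop) : (forall q, cod x q -> P q) ->
  \forall q \near coord x x, P q.
Proof. by move=> Pq; apply: filterS (near_cod (cod_id x)). Qed.

Lemma smooth_gen_graph x (X : M -> 'rV[C]_n) (W : M -> 'M[C]_n) :
  smooth_vec_at x X -> smooth_form W ->
  smooth_gen_at x (fun y => row_mx (X y) (X y *m W y)).
Proof.
move=> sX sW; split.
  by rewrite /vec; apply: smooth_near_ext sX; apply: near_codI => q _;
     rewrite /loc_vec row_mxKl.
apply: smooth_near_ext (smooth_nearM sX (sW x)); apply: near_codI => q xq.
by rewrite -loc_cov_form // /loc_cov /cov row_mxKr.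
Qed.

End Charts.

(** * Cyclic sums of trilinear expressions *)

Section Trilinear.
Variables (F : fieldType) (n : nat).

(* dw (a, b, c) when D is the derivative of the components of the two-form w *)
Definition cyc3 (D : 'rV[F]_n -> 'M[F]_n) (a b c : 'rV[F]_n) : 'M[F]_1 :=
  b *m D a *m c^T + c *m D b *m a^T + a *m D c *m b^T.

Lemma cyc3C D a b c : cyc3 D a b c = cyc3 D b c a.
Proof. by rewrite /cyc3 -addrA addrC. Qed.

Lemma tr11 (A : 'M[F]_1) : A^T = A.
Proof. by apply/matrixP => i j; rewrite mxE !ord1. Qed.

Lemma tr_bil (m : nat) (u : 'rV[F]_n) (A : 'M[F]_(n, m)) (v : 'rV[F]_m) :
  u *m A *m v^T = v *m A^T *m u^T.
Proof. by rewrite -[LHS]tr11 !trmx_mul trmxK mulmxA. Qed.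

Lemma row_linear_eq0 m (f : 'rV[F]_n -> 'M[F]_m) :
  (forall c u v, f (c *: u + v) = c *: f u + f v) ->
  (forall i, f (delta_mx 0 i) = 0) -> forall u, f u = 0.
Proof.
move=> lf f0 u; have f00 : f 0 = 0.
  by have := lf 1 0 0; rewrite scaler0 add0r scale1r => /esym/(canRL (addrK _)); rewrite subrr.
rewrite (row_sum_delta u); elim: (index_enum _) => [|i r IH]; first by rewrite big_nil.
by rewrite big_cons lf f0 IH scaler0 addr0.
Qed.

Lemma cyc3_linear D : (forall k u v, D (k *: u + v) = k *: D u + D v) ->
  forall k a a' b c, cyc3 D (k *: a + a') b c = k *: cyc3 D a b c + cyc3 D a' b c.
Proof.
move=> lD k a a' b c; rewrite /cyc3 lD [(k *: a + a')^T]linearP /=.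
rewrite !(mulmxDr, mulmxDl) -!(scalemxAr, scalemxAl) !scalerDr.
by rewrite [X in X + _ = _]addrACA [LHS]addrACA.
Qed.

(** Linearity in the first slot is enough: cyclic symmetry rotates each of the three arguments into
    it in turn. *)
Lemma cyc3_basis D : (forall k u v, D (k *: u + v) = k *: D u + D v) ->
  (forall i j k, cyc3 D (delta_mx 0 i) (delta_mx 0 j) (delta_mx 0 k) = 0) ->
  forall a b c, cyc3 D a b c = 0.
Proof.
move=> lD D0 a b c; have lc := cyc3_linear lD.
move: a; apply: row_linear_eq0 => [k u v|i]; first exact: lc.
rewrite cyc3C; move: b; apply: row_linear_eq0 => [k u v|j]; first exact: lc.
rewrite cyc3C; move: c; apply: row_linear_eq0 => [k u v|k]; first exact: lc.
by rewrite cyc3C.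
Qed.

Lemma scalar11D (a b c : F) : a%:M + b%:M + c%:M = (a + b + c)%:M :> 'M[F]_1.
Proof. by apply/matrixP => i j; rewrite !mxE !ord1 !mulr1n. Qed.

Lemma delta_bil (A : 'M[F]_n) i j :
  delta_mx 0 i *m A *m (delta_mx 0 j : 'rV[F]_n)^T = (A i j)%:M.
Proof.
by rewrite -rowE trmx_delta -colE; apply/matrixP => a b; rewrite !ord1 !mxE eqxx mulr1n.
Qed.

Lemma cyc3_delta D i j k :
  cyc3 D (delta_mx 0 i) (delta_mx 0 j) (delta_mx 0 k) =
  (D (delta_mx 0 i) j k + D (delta_mx 0 j) k i + D (delta_mx 0 k) i j)%:M.
Proof. by rewrite /cyc3 !delta_bil scalar11D. Qed.

End Trilinear.

(** * Lie, Schouten and Courant brackets in coordinates *)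

Section LocalFormulas.
Variables (R : realType) (n : nat) (M : manifold R n).
Local Notation C := R[i].
Implicit Types (x y : M) (X Y : M -> 'rV[C]_n) (s W : M -> 'M[C]_n).

Definition djac (F : 'rV[R]_n -> 'rV[C]_n) p : 'M[C]_n :=
  \matrix_(i, j) pd (fun q => F q 0 j) i p.

Lemma mul_djac F p v : v *m djac F p = dmx F p v.
Proof. by apply/rowP => j; rewrite !mxE; apply: eq_bigr => l _; rewrite mxE. Qed.

Lemma lieE x X Y : lie x X Y =
  dmx (loc_vec x Y) (coord x x) (X x) - dmx (loc_vec x X) (coord x x) (Y x).
Proof.
apply/rowP => j; rewrite !mxE -sumrB /=; apply: eq_bigr => l _.
by rewrite !loc_vec_id.
Qed.

Lemma lie_bivE x X s : let p := coord x x in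
  lie_biv x X s = dmx (loc_biv x s) p (X x)
    - (djac (loc_vec x X) p)^T *m s x - s x *m djac (loc_vec x X) p.
Proof.
apply/matrixP => j k; rewrite !mxE !sumrB /= loc_vec_id loc_biv_id.
by congr (_ - _ - _); apply: eq_bigr => l _; rewrite !mxE 1?mulrC.
Qed.

(** By skewness, column i of [s] is minus the contraction of the i-th basis covector with [s], so a
    component of the bracket is, up to sign, a cyclic sum of derivatives of [s] in the directions
    [a *m s]. This gives the Schouten bracket the shape of an exterior derivative, and [cyc3] serves
    for both. *)
Lemma schoutenP x s : (s x)^T = - s x ->
  (forall i j k, schouten x s i j k = 0) <->
  (forall a b c,
    cyc3 (fun a => dmx (loc_biv x s) (coord x x) (a *m s x)) a b c = 0).
Proof.
move=> skew; set D := fun a => _.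
have lD k u v : D (k *: u + v) = k *: D u + D v.
  by rewrite /D mulmxDl -scalemxAl dmx_linear.
have E i j k : cyc3 D (delta_mx 0 i) (delta_mx 0 j) (delta_mx 0 k) =
    (- schouten x s i j k)%:M.
  rewrite cyc3_delta; congr (_%:M).
  have sE a b : s x a b = - s x b a.
    by have /matrixP/(_ b a) := skew; rewrite !mxE => ->.
  have DE a b c : D (delta_mx 0 a) b c =
      - (\sum_l s x l a * pd (fun q => loc_biv x s q b c) l (coord x x)).
    rewrite /D -rowE mxE -sumrN; apply: eq_bigr => l _.
    by rewrite mxE (sE a l) mulNr.
  rewrite (DE i) (DE j) (DE k) -!opprD -!big_split; congr (- _).
  by rewrite /schouten loc_biv_id.
split=> [S0 a b c|c0 i j k].
  by apply: (cyc3_basis lD) => i j k; rewrite E S0 oppr0 raddf0.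
have := E i j k; rewrite c0 => /matrixP/(_ 0 0); rewrite !mxE mulr1n.
by move/esym/eqP; rewrite oppr_eq0 => /eqP.
Qed.

Lemma djac_altE F p (u v : 'rV[C]_n) :
  u *m (djac F p - (djac F p)^T) *m v^T = dmx F p u *m v^T - dmx F p v *m u^T.
Proof. by rewrite mulmxBr mulmxBl -!mul_djac [X in _ - X]tr_bil trmxK. Qed.

Lemma loc_form_skew x W : (forall y, (W y)^T = - W y) ->
  forall q, (loc_form x W q)^T = - loc_form x W q.
Proof.
by move=> skW q; rewrite /loc_form !trmx_mul trmxK skW mulmxA mulmxN mulNmx.
Qed.

Lemma dmx_skew (w : 'rV[R]_n -> 'M[C]_n) p u : jdiff w p ->
  (forall q, (w q)^T = - w q) -> (dmx w p u)^T = - dmx w p u.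
Proof.
move=> dw skw; rewrite -dmx_tr -scaleN1r -dmxZ //; apply: dmx_ext.
by near=> q; rewrite skw scaleN1r.
Unshelve. all: by end_near. Qed.

Lemma dfunE x (f : M -> C) (g : 'rV[R]_n -> 'M[C]_1) v :
  (\forall q \near coord x x, f (point x q) = g q 0 0) ->
  dfun x f *m v^T = dmx g (coord x x) v.
Proof.
move=> fg; apply/matrixP => i j; rewrite !ord1 !mxE; apply: eq_bigr => l _.
by rewrite !mxE mulrC; congr (_ * _); apply: pd_ext.
Qed.

Lemma dcovE x (a : M -> 'rV[C]_n) :
  dcov x a = djac (loc_cov x a) (coord x x) - (djac (loc_cov x a) (coord x x))^T.
Proof. by apply/matrixP => i j; rewrite !mxE. Qed.

Opaque dmx jdiff djac.

(** As [w] is skew, the function under the differential is twice w(Y, X), which absorbs the factor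
    1/2. All terms that differentiate X or Y then cancel against the contraction of [X, Y] with [w],
    and only derivatives of [w] survive. *)
Lemma courant_jet (X Y au av : 'rV[R]_n -> 'rV[C]_n) (w : 'rV[R]_n -> 'M[C]_n)
    (g : 'rV[R]_n -> 'M[C]_1) df p t :
  jdiff X p -> jdiff Y p -> jdiff w p -> (forall q, (w q)^T = - w q) ->
  (\forall q \near p, [/\ au q = X q *m w q, av q = Y q *m w q
     & g q = av q *m (X q)^T - au q *m (Y q)^T]) ->
  df *m t^T = dmx g p t ->
  (2^-1 *: df + X p *m (djac av p - (djac av p)^T)
   - Y p *m (djac au p - (djac au p)^T)
   - (dmx Y p (X p) - dmx X p (Y p)) *m w p) *m t^T
  = cyc3 (dmx w p) (X p) (Y p) t.
Proof.
move=> dX dY dw skw near_p dfE.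
have auE u : dmx au p u = dmx X p u *m w p + X p *m dmx w p u.
  by rewrite -(dmxM _ dX dw); apply: dmx_ext; apply: filterS near_p => q [].
have avE u : dmx av p u = dmx Y p u *m w p + Y p *m dmx w p u.
  by rewrite -(dmxM _ dY dw); apply: dmx_ext; apply: filterS near_p => q [].
have skdw u := dmx_skew u dw skw.
have E1 : Y p *m w p *m (dmx X p t)^T = - (dmx X p t *m w p *m (Y p)^T).
  by rewrite tr_bil skw mulmxN mulNmx.
have E2 : t *m dmx w p (Y p) *m (X p)^T = - (X p *m dmx w p (Y p) *m t^T).
  by rewrite tr_bil skdw mulmxN mulNmx.
have E3 : X p *m dmx w p t *m (Y p)^T = - (Y p *m dmx w p t *m (X p)^T).
  by rewrite tr_bil skdw mulmxN mulNmx.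
have dphi := jdiffM (jdiffM dY dw) (jdiff_tr dX).
have {dfE} dfE : df *m t^T = 2 *: (dmx Y p t *m w p *m (X p)^T
    + Y p *m dmx w p t *m (X p)^T - dmx X p t *m w p *m (Y p)^T).
  rewrite -E1 -mulmxDl -(dmxM _ dY dw) -dmx_tr -(dmxM _ (jdiffM dY dw) (jdiff_tr dX)).
  rewrite -dmxZ // dfE; apply: dmx_ext; apply: filterS near_p => q [-> -> ->].
  by rewrite [X q *m _ *m _]tr_bil skw mulmxN mulNmx opprK scaler_nat mulr2n.
rewrite /cyc3 !(mulmxBl, mulmxDl _ _ t^T) -scalemxAl dfE scalerA mulVf ?pnatr_eq0 //.
rewrite scale1r !djac_altE !auE !avE !mulmxDl E2 E3.
set e1 := dmx Y p t *m w p *m (X p)^T; set e2 := Y p *m dmx w p t *m (X p)^T.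
set e3 := dmx X p t *m w p *m (Y p)^T; set e4 := dmx Y p (X p) *m w p *m t^T.
set e5 := Y p *m dmx w p (X p) *m t^T; set e6 := dmx X p (Y p) *m w p *m t^T.
set e7 := X p *m dmx w p (Y p) *m t^T.
move: e1 e2 e3 e4 e5 e6 e7 => e1 e2 e3 e4 e5 e6 e7.
apply/matrixP => i j; rewrite !mxE; ring.
Qed.

End LocalFormulas.

(** * The Courant bracket on the graph of a two-form *)

Section CourantGraph.
Variables (R : realType) (n : nat) (M : manifold R n).
Local Notation C := R[i].
Implicit Types (x y : M) (X Y : M -> 'rV[C]_n) (s W : M -> 'M[C]_n).

Opaque dmx jdiff djac.
Lemma dfun_evE x (a b X Y : M -> 'rV[C]_n) t :
  dfun x (fun y => ev (b y) (X y) - ev (a y) (Y y)) *m t^T =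
  dmx (fun q => loc_cov x b q *m (loc_vec x X q)^T
              - loc_cov x a q *m (loc_vec x Y q)^T) (coord x x) t.
Proof.
apply: dfunE; apply: near_codI => q xq.
rewrite (ev_loc xq b X) (ev_loc xq a Y) /ev.
by rewrite [in RHS]mxE [X in _ = _ + X]mxE.
Qed.

Lemma near_loc_cov x (u v : M -> 'rV[C]_(n + n)) W :
  (\forall y \near x, cov u y = vec u y *m W y /\ cov v y = vec v y *m W y) ->
  \forall q \near coord x x,
    [/\ loc_cov x (cov u) q = loc_vec x (vec u) q *m loc_form x W q,
        loc_cov x (cov v) q = loc_vec x (vec v) q *m loc_form x W q
      & loc_cov x (cov v) q *m (loc_vec x (vec u) q)^T
        - loc_cov x (cov u) q *m (loc_vec x (vec v) q)^T
        = loc_cov x (cov v) q *m (loc_vec x (vec u) q)^T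
        - loc_cov x (cov u) q *m (loc_vec x (vec v) q)^T].
Proof.
move=> /near_point_id uvW; apply: filterS2 (near_cod (cod_id x)) uvW => q xq.
move=> [uW vW]; split=> //.
  by rewrite -(loc_cov_form xq) /loc_cov uW.
by rewrite -(loc_cov_form xq) /loc_cov vW.
Qed.

Opaque loc_vec loc_cov loc_form loc_biv loc_end dcov lie.

Definition closed_at x W : Prop := forall a b c,
  cyc3 (dmx (loc_form x W) (coord x x)) a b c = 0.

(** The defect of the bracket from the graph is tensorial in the vector parts. The statement
    isolates this defect because it serves twice: for the closure of the whole graph, and for
    sections over T10 of J+ or J-, where the bracket is known to stay in another bundle. *)
Lemma courant_graph x (u v : M -> 'rV[C]_(n + n)) W :
  smooth_gen_at x u -> smooth_gen_at x v -> smooth_form W ->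
  (forall y, (W y)^T = - W y) ->
  (\forall y \near x, cov u y = vec u y *m W y /\ cov v y = vec v y *m W y) ->
  let Z := lie x (vec u) (vec v) in
  exists c, courant x u v = row_mx Z c /\
    forall t, (c - Z *m W x) *m t^T =
      cyc3 (dmx (loc_form x W) (coord x x)) (vec u x) (vec v x) t.
Proof.
move=> [su _] [sv _] sW skW uvW Z; rewrite /courant -/Z.
set c := (X in row_mx _ X); exists c; split=> // t.
have near_uv := near_loc_cov uvW.
have dfE := dfun_evE x (cov u) (cov v) (vec u) (vec v) t.
have H := courant_jet (au := loc_cov x (cov u)) (av := loc_cov x (cov v))
  (smooth_near_jdiff su) (smooth_near_jdiff sv) (smooth_near_jdiff (sW x))
  (loc_form_skew x skW) near_uv dfE.
rewrite (loc_vec_id x (vec u)) (loc_vec_id x (vec v)) (loc_form_id x W) in H.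
by rewrite /c /Z (lieE x (vec u) (vec v)) (dcovE x (cov v)) (dcovE x (cov u)).
Qed.

Definition graph W y : set 'rV[C]_(n + n) :=
  [set u | exists Z : 'rV[C]_n, u = row_mx Z (Z *m W y)].

Lemma graphP W y u : graph W y u <-> rsubmx u = lsubmx u *m W y.
Proof.
split=> [[Z ->]|uW]; first by rewrite row_mxKl row_mxKr.
by exists (lsubmx u); rewrite -uW hsubmxK.
Qed.

Lemma courant_closed_graph W : smooth_form W -> (forall y, (W y)^T = - W y) ->
  (forall x, closed_at x W) <-> courant_closed (graph W).
Proof.
move=> sW skW; split=> [dW|cW] x.
  move=> u v su sv near_uv.
  have near_uv' : \forall y \near x,
      cov u y = vec u y *m W y /\ cov v y = vec v y *m W y.
    by apply: filterS near_uv => y [/graphP ? /graphP ?].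
  have [c [-> cE]] := courant_graph su sv sW skW near_uv'.
  apply/graphP; rewrite row_mxKl row_mxKr; apply/subr0_eq.
  apply/rowP => j; have := cE (delta_mx 0 j); rewrite dW => /matrixP/(_ 0 0).
  by rewrite trmx_delta -colE mxE [in RHS]mxE => ->; rewrite mxE.
move=> a b c.
(* Fields with constant components in the chart take any prescribed value at [x], which suffices
   since the defect is tensorial. *)
pose S a y := row_mx (unloc_vec x (fun=> a) y) (unloc_vec x (fun=> a) y *m W y).
have sS a' : smooth_gen_at x (S a').
  by apply: smooth_gen_graph => //; apply: unloc_vec_smooth; apply: smooth_near_cst.
have near_S : \forall y \near x, cov (S a) y = vec (S a) y *m W y /\
    cov (S b) y = vec (S b) y *m W y.
  by apply: nearW => y; rewrite /cov /vec !row_mxKl !row_mxKr.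
have [d [dE dc]] := courant_graph (sS a) (sS b) sW skW near_S.
have : graph W x (courant x (S a) (S b)).
  by apply: cW => //; apply: nearW => y; split; eexists.
rewrite dE => /graphP; rewrite row_mxKl row_mxKr => dZ.
have Sx a' : vec (S a') x = a'.
  by rewrite -[LHS]loc_vec_id /vec; under eq_fun do rewrite row_mxKl;
     rewrite unloc_vecK //; apply: cod_id.
have := dc c; rewrite dZ subrr mul0mx (Sx a) (Sx b) => <-.
Unshelve. all: by end_near. Qed.

End CourantGraph.

Section MatrixEntries.
Variables (F : fieldType) (a b : nat).
Implicit Types A B : 'M[F]_(a, b).

Lemma addmxE A B i j : (A + B) i j = A i j + B i j. Proof. by rewrite mxE. Qed.
Lemma oppmxE A i j : (- A) i j = - A i j. Proof. by rewrite mxE. Qed.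
Lemma scalemxE c A i j : (c *: A) i j = c * A i j. Proof. by rewrite mxE. Qed.
Lemma zeromxE i j : (0 : 'M[F]_(a, b)) i j = 0. Proof. by rewrite mxE. Qed.

End MatrixEntries.

(* products of matrices are atoms for [ring] *)
Ltac mxring := apply/matrixP => ? ?; rewrite !(addmxE, oppmxE, scalemxE, zeromxE); ring.

Definition linear_fun (F : fieldType) m (V : lmodType F) (D : 'rV[F]_m -> V) :=
  forall k u v, D (k *: u + v) = k *: D u + D v.

Lemma linear_funD (F : fieldType) m (V : lmodType F) (D : 'rV[F]_m -> V) :
  linear_fun D -> {morph D : u v / u + v}.
Proof. by move=> lD u v; have := lD 1 u v; rewrite !scale1r. Qed.

Lemma linear_fun0 (F : fieldType) m (V : lmodType F) (D : 'rV[F]_m -> V) :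
  linear_fun D -> D 0 = 0.
Proof.
move=> lD; have := linear_funD lD 0 0.
by rewrite addr0 => /esym/(canRL (addrK _)); rewrite subrr.
Qed.

Lemma linear_funZ (F : fieldType) m (V : lmodType F) (D : 'rV[F]_m -> V) :
  linear_fun D -> forall k u, D (k *: u) = k *: D u.
Proof. by move=> lD k u; rewrite -[k *: u]addr0 lD linear_fun0 // addr0. Qed.

Lemma row_linear_eq0' (F : fieldType) m a b (f : 'rV[F]_m -> 'M[F]_(a, b)) :
  linear_fun f -> (forall i, f (delta_mx 0 i) = 0) -> forall u, f u = 0.
Proof.
move=> lf f0 u; rewrite (row_sum_delta u).
elim: (index_enum _) => [|i r IH]; first by rewrite big_nil linear_fun0.
by rewrite big_cons lf f0 IH scaler0 addr0.
Qed.

Lemma bil_eq0 (F : fieldType) m (N : 'M[F]_m) :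
  (forall a b : 'rV[F]_m, a *m N *m b^T = 0) -> N = 0.
Proof.
move=> N0; apply/matrixP => i j; have := N0 (delta_mx 0 i) (delta_mx 0 j).
by rewrite delta_bil => /matrixP/(_ 0 0); rewrite !mxE mulr1n.
Qed.

(** * A torsion-free connection for which J is parallel at a point *)

Section TorsionFree.
Variables (F : fieldType) (n : nat) (J : 'M[F]_n) (A : 'rV[F]_n -> 'M[F]_n).
Hypothesis two : (2 : F) != 0.
Hypothesis JJ : J *m J = - 1%:M.
Hypothesis linA : linear_fun A.
Hypothesis AJ : forall X, A X *m J = - (J *m A X).
(** The Nijenhuis tensor of J on the constant fields [v] and [w], followed by J. *)
Hypothesis nijenhuis : forall v w,
  w *m A v - v *m A w + (w *m A (v *m J) - v *m A (w *m J)) *m J = 0.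

(* A is the derivative of J at a point; the G X are the connection matrices of a
   torsion-free connection for which J is parallel at this point. *)
Lemma torsion_free_connection : exists G : 'rV[F]_n -> 'M[F]_n,
  [/\ linear_fun G, forall X Y, Y *m G X = X *m G Y
    & forall X, A X = G X *m J - J *m G X].
Proof.
pose B X : 'M[F]_n := \matrix_i (X *m A (delta_mx 0 i)).
have BE X Y : Y *m B X = X *m A Y.
  apply/subr0_eq; move: Y; apply: row_linear_eq0' => [k u v|i].
    rewrite linA mulmxDl mulmxDr -scalemxAl -scalemxAr; mxring.
  by rewrite -rowE rowK subrr.
have linB : linear_fun B.
  move=> k u v; apply/row_matrixP => i.
  by rewrite rowE BE linearP /= !rowE !BE mulmxDl -scalemxAl.
(* The classical almost complex connection built from the flat one. The first term makes J parallel;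
   the terms in [B], which is [A] with its two vector arguments exchanged, combine to a matrix
   commuting with J and reduce the torsion to a multiple of the Nijenhuis tensor. *)
pose G X := - (2^-1 *: (A X *m J)) - 4^-1 *: (B X *m J + J *m B X).
have four : (4 : F) != 0 by rewrite (_ : 4 = 2 * 2) ?mulf_neq0 // -natrM.
exists G; split.
- move=> k u v; rewrite /G linA linB !mulmxDl !mulmxDr -!scalemxAl -!scalemxAr.
  by mxring.
- move=> X Y; apply/eqP; rewrite -subr_eq0; apply/eqP.
  have := nijenhuis X Y => /(congr1 (fun Z => 4^-1 *: (Z *m J))).
  rewrite mul0mx scaler0 => N.
  rewrite -[RHS]oppr0 -[in RHS]N /G.
  rewrite !(mulmxDr, mulmxDl, mulmxBl, mulmxN, mulNmx, scalerDr) -!scalemxAr.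
  rewrite !(mulmxDr, mulmxN, mulNmx, mulmxA, BE).
  rewrite -!(mulmxA _ J J) JJ !(mulmxN, mulmx1).
  apply/matrixP => i j; rewrite !(addmxE, oppmxE, scalemxE, zeromxE).
  by field; rewrite two four.
- move=> X; have JAJ : J *m A X *m J = A X.
    by rewrite -mulmxA AJ mulmxN mulmxA JJ mulNmx mul1mx opprK.
  have SJJ (S : 'M[F]_n) : S *m J *m J = - S by rewrite -mulmxA JJ mulmxN mulmx1.
  rewrite /G !(mulmxBl, mulmxBr, mulmxN, mulNmx) -!scalemxAr -!scalemxAl.
  rewrite !(mulmxDr, mulmxDl, mulmxA) !SJJ JJ JAJ mulNmx mul1mx.
  apply/matrixP => i j; rewrite !(addmxE, oppmxE, scalemxE, zeromxE).
  by field; rewrite two four.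
Qed.

End TorsionFree.

(** * Covariant derivatives of forms and bivectors at a point *)

Section Parallel.
Variables (F : fieldType) (n : nat).
Variables (G : 'rV[F]_n -> 'M[F]_n) (r : 'M[F]_n) (dr : 'rV[F]_n -> 'M[F]_n).
Hypothesis symG : forall X Y, Y *m G X = X *m G Y.
Hypothesis rr : r *m r = r.
Hypothesis drE : forall X, dr X = G X *m r - r *m G X.

Let r' : 'M[F]_n := 1%:M - r.

Let r0r : r' *m r = 0. Proof. by rewrite mulmxBl mul1mx rr subrr. Qed.

Let drT X : (dr X)^T = r^T *m (G X)^T - (G X)^T *m r^T.
Proof. by rewrite drE linearB /= !trmx_mul. Qed.

(** Skewness of [w] and symmetry of [G] make the six terms cancel in pairs. Hence dw may be computed
    with covariant derivatives in place of partial ones; [cyc3_connection_biv] does the same for the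
    Schouten bracket. *)
Lemma cyc3_connection (w : 'M[F]_n) : w^T = - w -> forall X Y Z,
  cyc3 (fun X => G X *m w + w *m (G X)^T) X Y Z = 0.
Proof.
move=> skw X Y Z; have E (u v t : 'rV[F]_n) : v *m (w *m (G u)^T) *m t^T = - (t *m G u *m w *m v^T).
  by rewrite tr_bil trmx_mul trmxK skw mulmxA mulmxN mulNmx.
rewrite /cyc3 !mulmxDr !mulmxDl !E !mulmxA.
rewrite (symG X Y) (symG X Z) (symG Y Z); mxring.
Qed.

Lemma cyc3_connection_biv (s : 'M[F]_n) : s^T = - s -> forall a b c,
  cyc3 (fun a => (G (a *m s))^T *m s + s *m G (a *m s)) a b c = 0.
Proof.
move=> sks a b c.
have E (u v t : 'rV[F]_n) : v *m ((G u)^T *m s) *m t^T = - (t *m s *m G u *m v^T).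
  by rewrite tr_bil trmx_mul trmxK sks mulmxA mulmxN !mulNmx.
rewrite /cyc3 !mulmxDr !mulmxDl !E !mulmxA.
rewrite (symG (a *m s) (b *m s)) (symG (a *m s) (c *m s)) (symG (b *m s) (c *m s)).
mxring.
Qed.

(* DX is the derivative of a section of the kernel of r with value X *)
Lemma kernel_section_deriv (X : 'rV[F]_n) (DX : 'M[F]_n) :
  X *m r = 0 -> (forall v, v *m DX *m r + X *m dr v = 0) ->
  DX *m r = - (G X *m r).
Proof.
move=> Xr DXr; apply/row_matrixP => i; rewrite !rowE mulmxA mulmxN mulmxA.
move/eqP: (DXr (delta_mx 0 i)); rewrite addr_eq0 => /eqP ->.
by rewrite drE mulmxBr !mulmxA Xr mul0mx subr0 symG.
Qed.

Section Kernel.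
Variables (s T : 'M[F]_n) (ds : 'rV[F]_n -> 'M[F]_n).
Variables (X : 'rV[F]_n) (DX : 'M[F]_n).
Hypothesis Xr : X *m r = 0.
Hypothesis DXr : forall v, v *m DX *m r + X *m dr v = 0.
Hypothesis dsE : ds X = T - (G X)^T *m s - s *m G X.

(** The kernel of [r] is parallel at the point, so the covariant derivative of a section of it is
    killed by [r]. What remains of the Lie derivative of [s] after projection is the covariant
    derivative [T] of [s], which sees only the value [X] and not the derivative [DX]. *)
Lemma lie_kernel_section :
  r^T *m (ds X - DX^T *m s - s *m DX) *m r = r^T *m T *m r.
Proof.
have E := kernel_section_deriv Xr DXr.
have E' : r^T *m DX^T = - (r^T *m (G X)^T) by rewrite -trmx_mul E linearN /= trmx_mul.
rewrite dsE !(mulmxBr, mulmxBl) !mulmxA E' -!(mulmxA _ DX r) E.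
by rewrite !(mulmxN, mulNmx, mulmxA); mxring.
Qed.

End Kernel.

Section ClosedForm.
Variables (w P : 'M[F]_n) (W : 'rV[F]_n -> 'M[F]_n) (k : F).
Hypothesis linG : linear_fun G.
Hypothesis linW : linear_fun W.
Hypothesis wP : w *m P = 1%:M.
Hypothesis Pw : P *m w = 1%:M.
Hypothesis skw : w^T = - w.
Hypothesis skW : forall X, (W X)^T = - W X.
Hypothesis closedW : forall X Y Z, cyc3 W X Y Z = 0.

(** The covariant derivative of the two-form [w] along [X]. *)
Let E X := W X - (G X *m w + w *m (G X)^T).

Let skP : P^T = - P.
Proof.
have : P^T *m w^T = 1%:M by rewrite -trmx_mul wP trmx1.
rewrite skw mulmxN => /(canRL (@opprK _)) PTw.
by rewrite -[P^T]mulmx1 -wP mulmxA PTw mulNmx mul1mx.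
Qed.

Let skE X : (E X)^T = - E X.
Proof. rewrite /E !linearB /= linearD /= !trmx_mul trmxK skW skw; rewrite mulmxN mulNmx; mxring. Qed.

Let linE : linear_fun E.
Proof.
move=> c u v; rewrite /E linW linG linearP /= !(mulmxDl, mulmxDr) -!scalemxAl -!scalemxAr.
by mxring.
Qed.

Let closedE X Y Z : cyc3 E X Y Z = 0.
Proof.
have := closedW X Y Z; have := cyc3_connection skw X Y Z.
rewrite /cyc3 /E !(mulmxBl, mulmxBr) => H1 H2.
rewrite -[RHS](subrr 0) -{1}H2 -H1; mxring.
Qed.

(* the involutivity of the image by P of the range of r^T, expressed on the
   sections a r^T P *)
Hypothesis involutive : forall a b, let X := a *m r^T *m P in let Y := b *m r^T *m P in
  (b *m ((dr X)^T *m P - r^T *m (P *m W X *m P))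
   - a *m ((dr Y)^T *m P - r^T *m (P *m W Y *m P))) *m w *m r'^T = 0.

(** The vectors X = [a *m r^T *m P] and Y = [b *m r^T *m P] are w-orthogonal to the kernel of [r].
    Involutivity says that their bracket is so too, which covariantly reads (D_X w)(Y, V) = (D_Y
    w)(X, V) for V in that kernel; the cyclic identity dw = 0 then leaves (D_V w)(X, Y) = 0. *)
Lemma kernel_form_eq0 V : V *m r = 0 -> r^T *m P *m E V *m P *m r = 0.
Proof.
move=> Vr.
have rr0t : r^T *m r'^T = 0 by rewrite -trmx_mul r0r trmx0.
have H (a b : 'rV[F]_n) : a *m r^T *m P *m E V *m (b *m r^T *m P)^T = 0.
  set X := a *m r^T *m P; set Y := b *m r^T *m P.
  have Xw : X *m w = a *m r^T by rewrite -mulmxA Pw mulmx1.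
  have Yw : Y *m w = b *m r^T by rewrite -mulmxA Pw mulmx1.
  have I : (Y *m E X - X *m E Y) *m r'^T = 0.
    have := involutive a b; rewrite -/X -/Y /= !drT => I0.
    rewrite -[RHS]oppr0 -I0.
    rewrite !(mulmxBl, mulmxBr) !mulmxA -/X -/Y -!(mulmxA _ P w) Pw !mulmx1.
    rewrite -!(mulmxA _ r^T r'^T) rr0t !mulmx0.
    rewrite -Xw -Yw /E !(mulmxBl, mulmxBr, mulmxDl, mulmxDr) !mulmxA.
    by rewrite (symG X Y); mxring.
  have IV : Y *m E X *m V^T - X *m E Y *m V^T = 0.
    rewrite -mulmxBl.
    have -> : V = V *m r' by rewrite mulmxBr mulmx1 Vr subr0.
    by rewrite trmx_mul mulmxA I mul0mx.
  have := closedE X Y V; rewrite /cyc3 [V *m E Y *m _]tr_bil skE.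
  by rewrite mulmxN mulNmx IV add0r.
apply: bil_eq0 => a b; rewrite -[RHS]oppr0 -(H a b).
by rewrite !trmx_mul trmxK skP !(mulmxN, mulNmx) opprK !mulmxA.
Qed.

Let s := k *: (r^T *m P *m r).
Let ds X := k *: ((dr X)^T *m P *m r - r^T *m (P *m W X *m P) *m r + r^T *m P *m dr X).

(** Since [r] is parallel, only the inverse [P] of [w] contributes to the covariant derivative of
    the bivector, and differentiating an inverse gives [- (P *m E X *m P)]. *)
Lemma cov_deriv_biv X :
  ds X = - (k *: (r^T *m P *m E X *m P *m r)) - (G X)^T *m s - s *m G X.
Proof.
rewrite /ds /s /E drT drE.
rewrite -!scalemxAl -!scalemxAr !(mulmxBl, mulmxBr, mulmxDl, mulmxDr, mulmxN, mulNmx) !mulmxA.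
rewrite -!(mulmxA _ P w) Pw !mulmx1 -!(mulmxA _ w P) wP !mulmx1.
mxring.
Qed.

Lemma lie_biv_eq0 X DX : X *m r = 0 -> (forall v, v *m DX *m r + X *m dr v = 0) ->
  r^T *m (ds X - DX^T *m s - s *m DX) *m r = 0.
Proof.
move=> Xr DXr; rewrite (lie_kernel_section Xr DXr (cov_deriv_biv X)).
by rewrite (kernel_form_eq0 Xr) scaler0 oppr0 mulmx0 mul0mx.
Qed.

(** Contracting a covector a with [s] gives k times the T10 part of X a = a r^T P. By
    [kernel_form_eq0] the T01 part of X a contributes nothing to the covariant derivative of [s], so
    X a itself may be used as direction, and the bracket becomes k^2 times dw on X a, X b, X c. *)
Lemma schouten_eq0 a b c : cyc3 (fun a => ds (a *m s)) a b c = 0.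
Proof.
have sks : s^T = - s.
  by rewrite /s linearZ /= !trmx_mul trmxK skP mulNmx mulmxN scalerN mulmxA.
pose X (a : 'rV[F]_n) := a *m r^T *m P.
have aE (u v t : 'rV[F]_n) : v *m ds (u *m s) *m t^T =
    k ^+ 2 *: (X v *m E (X u) *m (X t)^T)
    - v *m ((G (u *m s))^T *m s + s *m G (u *m s)) *m t^T.
  rewrite cov_deriv_biv.
  have usE : u *m s = k *: (X u - X u *m r').
    by rewrite /s -scalemxAr /X mulmxBr mulmx1 opprB addrC subrK !mulmxA.
  have K : r^T *m P *m E (X u *m r') *m P *m r = 0.
    by apply: kernel_form_eq0; rewrite -mulmxA r0r mulmx0.
  have KE : r^T *m P *m E (u *m s) *m P *m r = k *: (r^T *m P *m E (X u) *m P *m r).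
    have Xu : E (X u - X u *m r') = E (X u) - E (X u *m r').
      by apply: (canRL (addrK _)); rewrite -(linear_funD linE) subrK.
    rewrite usE (linear_funZ linE) Xu -!(scalemxAr, scalemxAl).
    by rewrite mulmxBr !mulmxBl K subr0.
  rewrite KE -addrA -opprD mulmxBr mulmxBl mulmxN mulNmx; congr (_ - _).
  rewrite !trmx_mul trmxK skP scalerA -expr2 /X.
  by rewrite -!(scalemxAr, scalemxAl) !(mulmxN, mulNmx) !mulmxA scalerN.
have := closedE (X a) (X b) (X c); have := cyc3_connection_biv sks a b c.
rewrite /cyc3 !aE => H1 H2.
have {}H2 := congr1 (fun Z => k ^+ 2 *: Z) H2; rewrite scaler0 /= in H2.
rewrite -[RHS](subrr 0) -{1}H2 -H1; mxring.
Qed.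

End ClosedForm.

Section Nondegenerate.
Variables (f Pi : 'M[F]_n) (B : 'rV[F]_n -> 'M[F]_n) (k : F).
Hypothesis k0 : k != 0.
Hypothesis linG : linear_fun G.
Hypothesis linB : linear_fun B.
Hypothesis fPi : f *m Pi = 1%:M.
Hypothesis Pif : Pi *m f = 1%:M.
Hypothesis skf : f^T = - f.
Hypothesis rf : r *m f = f *m r^T.
Hypothesis drf : forall X,
  dr X *m f + r *m B X = B X *m r^T + f *m (dr X)^T.

Let s := k *: (Pi *m r).
Let ds X := k *: (Pi *m dr X - Pi *m B X *m Pi *m r).

Hypothesis holomorphic : forall X, X *m r = 0 -> exists DX,
  (forall v, v *m DX *m r + X *m dr v = 0) /\
  r^T *m (ds X - DX^T *m s - s *m DX) *m r = 0.
Hypothesis schouten0 : forall a b c, cyc3 (fun a => ds (a *m s)) a b c = 0.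

Let E X := B X - (G X *m f + f *m (G X)^T).

Let skPi : Pi^T = - Pi.
Proof.
have : Pi^T *m f^T = 1%:M by rewrite -trmx_mul fPi trmx1.
rewrite skf mulmxN => /(canRL (@opprK _)) PTf.
by rewrite -[Pi^T]mulmx1 -fPi mulmxA PTf mulNmx mul1mx.
Qed.

Let linE : linear_fun E.
Proof.
move=> c u v; rewrite /E linB linG linearP /= !(mulmxDl, mulmxDr) -!scalemxAl -!scalemxAr.
by mxring.
Qed.

Let Pir : Pi *m r = r^T *m Pi.
Proof. by rewrite -[Pi *m r]mulmx1 -fPi mulmxA -(mulmxA Pi) rf !mulmxA Pif mul1mx. Qed.

(** The compatibility of [r] with [f] is differentiated; as [r] is parallel, the covariant
    derivative of [f] inherits it. *)
Let rE X : r *m E X = E X *m r^T.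
Proof.
have := drf X; rewrite drT drE /E.
rewrite !(mulmxBl, mulmxBr, mulmxDl, mulmxDr, mulmxN, mulNmx) !mulmxA rf.
rewrite -!(mulmxA _ r f) rf !mulmxA => /eqP; rewrite -subr_eq0 => /eqP H.
by apply/eqP; rewrite -subr_eq0; apply/eqP; rewrite -[RHS]H; mxring.
Qed.

Let dsE X : ds X = - (k *: (Pi *m E X *m Pi *m r)) - (G X)^T *m s - s *m G X.
Proof.
rewrite /ds /s /E drE.
rewrite -!scalemxAl -!scalemxAr !(mulmxBl, mulmxBr, mulmxDl, mulmxDr, mulmxN, mulNmx) !mulmxA.
rewrite -!(mulmxA _ f Pi) fPi !mulmx1 Pif mul1mx.
by mxring.
Qed.

(** By [rE], the projected Lie derivative of [s] is, up to invertible factors, the restriction of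
    D_X f to T10. Holomorphy of [s] thus makes this restriction vanish for X in T01. *)
Let E0 X : X *m r = 0 -> E X *m r^T = 0.
Proof.
move=> Xr; have [DX [DXr]] := holomorphic Xr.
rewrite (lie_kernel_section Xr DXr (dsE X)) mulmxN mulNmx -scalemxAr -scalemxAl.
move=> /eqP; rewrite oppr_eq0 scaler_eq0 (negPf k0) /= => /eqP H.
have {}H : Pi *m E X *m r^T *m Pi = 0.
  rewrite !mulmxA -Pir -(mulmxA Pi r) rE -!mulmxA rr Pir (mulmxA r^T) in H.
  by rewrite -trmx_mul rr in H; rewrite -!mulmxA.
have -> : E X *m r^T = f *m (Pi *m E X *m r^T *m Pi) *m f.
  by rewrite !mulmxA fPi mul1mx -!mulmxA Pif mulmx1.
by rewrite H mulmx0 mul0mx.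
Qed.

(** The covariant derivative of [f *m r^T] is [E X *m r^T], and by [E0] it depends only on the T10
    part of X. In the Schouten bracket the direction [u *m s] may therefore be replaced by k times
    [u *m Pi]. Evaluated on the covectors [a *m f], which [Pi] sends back to arbitrary vectors a,
    the bracket is k^2 times the cyclic sum wanted. *)
Lemma closed_of_holomorphic_Poisson X Y Z :
  cyc3 (fun X => B X *m r^T + f *m (dr X)^T) X Y Z = 0.
Proof.
have sks : s^T = - s.
  by rewrite /s linearZ /= trmx_mul skPi mulmxN scalerN Pir.
have aE (u v t : 'rV[F]_n) : v *m ds (u *m s) *m t^T =
    k ^+ 2 *: (v *m Pi *m (E (u *m Pi) *m r^T) *m (t *m Pi)^T)
    - v *m ((G (u *m s))^T *m s + s *m G (u *m s)) *m t^T.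
  have KE : E (u *m s) *m r^T = k *: (E (u *m Pi) *m r^T).
    have usE : u *m s = k *: (u *m Pi - u *m Pi *m r').
      by rewrite /s -scalemxAr mulmxBr mulmx1 opprB addrC subrK !mulmxA.
    have Xu : E (u *m Pi - u *m Pi *m r') = E (u *m Pi) - E (u *m Pi *m r').
      by apply: (canRL (addrK _)); rewrite -(linear_funD linE) subrK.
    have K : E (u *m Pi *m r') *m r^T = 0 by apply: E0; rewrite -mulmxA r0r mulmx0.
    by rewrite usE (linear_funZ linE) Xu -scalemxAl mulmxBl K subr0.
  rewrite dsE -addrA -opprD mulmxBr mulmxBl mulmxN mulNmx; congr (_ - _).
  rewrite -(mulmxA _ Pi r) Pir -(mulmxA Pi) (mulmxA (E _)) KE.
  rewrite trmx_mul skPi -!(scalemxAr, scalemxAl) scalerA -expr2.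
  by rewrite !(mulmxN, mulNmx) scalerN !mulmxA.
have closedE a b c : cyc3 (fun X => E X *m r^T) a b c = 0.
  have fK u : u = u *m f *m Pi by rewrite -mulmxA fPi mulmx1.
  have := schouten0 (a *m f) (b *m f) (c *m f).
  have := cyc3_connection_biv sks (a *m f) (b *m f) (c *m f).
  rewrite /cyc3 !aE -!fK => H1 H2.
  have k2 : k ^+ 2 != 0 by rewrite expf_neq0.
  apply: (scalerI k2); rewrite scaler0 -[RHS](addr0 0) -{1}H2 -H1 !scalerDr; mxring.
have skrf : (f *m r^T)^T = - (f *m r^T) by rewrite trmx_mul trmxK skf mulmxN rf.
have H1 := closedE X Y Z; have H2 := cyc3_connection skrf X Y Z.
rewrite -[RHS](addr0 0) -{1}H1 -H2.
have -> : (fun X => B X *m r^T + f *m (dr X)^T) =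
    (fun X => E X *m r^T + (G X *m (f *m r^T) + f *m r^T *m (G X)^T)).
  apply/funext => U; rewrite drT /E !(mulmxBl, mulmxBr, mulmxDl, mulmxDr, mulmxN, mulNmx) !mulmxA.
  by mxring.
by rewrite /cyc3 !(mulmxDl, mulmxDr); mxring.
Qed.

End Nondegenerate.
End Parallel.

Lemma half_compl (F : fieldType) a b (A B : 'M[F]_(a, b)) : (2 : F) != 0 ->
  2^-1 *: (A + B) = A - 2^-1 *: (A - B).
Proof.
move=> two; apply/matrixP => i j; rewrite !(addmxE, oppmxE, scalemxE).
by field; rewrite two.
Qed.

(** * Projections onto the eigenspaces of a complex structure *)

Section TypeDecomposition.
Variables (R : realType) (n : nat).
Local Notation C := R[i].

Lemma two_neq0 : (2 : C) != 0. Proof. by rewrite pnatr_eq0. Qed.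
Lemma im_sqr : ('i%C : C) * 'i%C = -1.
Proof. by rewrite -expr2; apply: sqr_i. Qed.
Lemma im_neq0 : ('i%C : C) != 0.
Proof. by apply/eqP => i0; have := im_sqr; rewrite i0 mul0r => /eqP; rewrite eq_sym oppr_eq0 oner_eq0. Qed.

Lemma half_double a b (A : 'M[C]_(a, b)) : 2^-1 *: (A + A) = A.
Proof.
have -> : A + A = 2 *: A by rewrite scaler_nat.
by rewrite scalerA mulVf ?two_neq0 // scale1r.
Qed.

(** A function of a complex matrix, so that the same algebra applies to J at a point of M and to its
    expression in a chart. *)
Definition rhoc (J : 'M[C]_n) : 'M[C]_n := 2^-1 *: (1%:M - 'i%C *: J).

Variable J : 'M[C]_n.
Hypothesis JJ : J *m J = - 1%:M.

Lemma rhoc_J : rhoc J *m J = 'i%C *: rhoc J.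
Proof.
rewrite /rhoc -!(scalemxAl, scalemxAr) mulmxBl mul1mx -scalemxAl JJ scalerA mulrC.
rewrite -[RHS]scalerA; congr (_ *: _); rewrite scalerBr scalerA im_sqr.
by rewrite scaleN1r scalerN !opprK addrC.
Qed.

Lemma J_rhoc : J *m rhoc J = rhoc J *m J.
Proof.
by rewrite /rhoc -scalemxAl -scalemxAr mulmxBr mulmxBl mulmx1 mul1mx -scalemxAl -scalemxAr.
Qed.

Lemma rhoc_idem : rhoc J *m rhoc J = rhoc J.
Proof.
rewrite {2}/rhoc -scalemxAr mulmxBr mulmx1 -scalemxAr rhoc_J scalerA im_sqr.
by rewrite scaleN1r opprK half_double.
Qed.

Lemma rhoc_fix k (X : 'M[C]_(k, n)) : X *m J = 'i%C *: X <-> X *m rhoc J = X.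
Proof.
split=> [XJ|<-]; last by rewrite -mulmxA rhoc_J scalemxAr.
rewrite /rhoc -scalemxAr mulmxBr mulmx1 -scalemxAr XJ scalerA im_sqr.
by rewrite scaleN1r opprK half_double.
Qed.

Lemma rhoc_ker k (X : 'M[C]_(k, n)) : X *m J = - ('i%C *: X) <-> X *m rhoc J = 0.
Proof.
rewrite /rhoc -scalemxAr mulmxBr mulmx1 -scalemxAr; split=> [->|].
  by rewrite scalerN scalerA im_sqr scaleN1r opprK subrr scaler0.
move=> /eqP; rewrite scaler_eq0 invr_eq0 (negPf two_neq0) /= subr_eq0 => /eqP E.
by rewrite {2}E scalerA im_sqr scaleN1r opprK.
Qed.

End TypeDecomposition.

(** * Types of vectors and covectors, at a point and in a chart *)

Section AlmostComplex.
Opaque chart_jac loc_vec loc_cov loc_end loc_form loc_biv dmx jdiff djac.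
Variables (R : realType) (n : nat) (M : manifold R n).
Local Notation C := R[i].
Implicit Types (x y : M) (J : M -> 'M[R]_n).

Lemma rhoE J x : rho J x = rhoc (cplx (J x)). Proof. by []. Qed.

Lemma cplx_sqrN1 J x : J x *m J x = - 1%:M -> cplx (J x) *m cplx (J x) = - 1%:M.
Proof. by move=> JJ; rewrite -cplxM JJ cplxN cplx1. Qed.

Section AtPoint.
Variables (J : M -> 'M[R]_n) (x : M).
Hypothesis JJ : J x *m J x = - 1%:M.
Let JJc := cplx_sqrN1 JJ.

Lemma rho_idem : rho J x *m rho J x = rho J x.
Proof. exact: rhoc_idem. Qed.

Lemma conj_rho : conj_mx (rho J x) = 1%:M - rho J x.
Proof.
rewrite rhoE /rhoc conj_mxZ conj_mxB conj_mxZ conj_cplx conj_mx1 conj_i.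
have -> : conjc (2^-1 : C) = 2^-1 by rewrite conjc_inv conjc_nat.
by rewrite scaleNr opprK half_compl ?two_neq0.
Qed.

(** An equation in the idempotent [rho] is preferred to the eigenvalue equation: it can be
    differentiated, and its solutions are an explicit image. *)
Lemma T10P X : T10 J x X <-> X *m rho J x = X.
Proof. exact: rhoc_fix. Qed.

Lemma T01P X : T01 J x X <-> X *m rho J x = 0.
Proof.
split=> [[Y /T10P YJ <-]|XJ].
  by rewrite -YJ conj_mxM conj_rho -mulmxA mulmxBl mul1mx rho_idem subrr mulmx0.
exists (conj_mx X); last by rewrite conj_mxK.
apply/T10P; rewrite -[rho J x](conj_mxK) -conj_mxM conj_rho mulmxBr mulmx1 XJ.
by rewrite subr0.
Qed.

Lemma T01J X : T01 J x X <-> X *m cplx (J x) = - ('i%C *: X).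
Proof. by rewrite T01P rhoE; symmetry; apply: rhoc_ker. Qed.

Lemma T10dualP a : T10dual J x a <-> a *m (rho J x)^T = a.
Proof.
split=> [aT|ar Y /T01P Yr].
  apply/subr0_eq/rowP => j; rewrite [RHS]mxE.
  have := aT (delta_mx 0 j *m (1%:M - rho J x)) => H.
  have {}H : ev a (delta_mx 0 j *m (1%:M - rho J x)) = 0.
    by apply: H; apply/T01P; rewrite -mulmxA mulmxBl mul1mx rho_idem subrr mulmx0.
  move: H; rewrite /ev trmx_mul mulmxA trmx_delta -colE mxE linearB /= trmx1.
  by rewrite mulmxBr mulmx1 => H; rewrite -[RHS]oppr0 -H !mxE opprB.
by rewrite /ev -ar -mulmxA -trmx_mul Yr trmx0 mulmx0 mxE.
Qed.

End AtPoint.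

Section Local.
Variables (J : M -> 'M[R]_n) (x : M).
Hypothesis aJ : almost_complex J.
Let p := coord x x.
Let Jh := loc_end x (fun y => cplx (J y)).
Let rh := loc_end x (rho J).

Lemma loc_rho q : cod x q -> rh q = rhoc (Jh q).
Proof.
move=> xq; rewrite /rh /rho /rhoc.
rewrite (_ : (fun x0 : M => _) = (fun y => 2^-1 *: (1%:M + (- 'i%C) *: cplx (J y)))).
  by rewrite loc_endZ loc_endD loc_endZ loc_end1 // scaleNr.
by apply/funext => y; rewrite scaleNr.
Qed.

Lemma loc_JJ q : cod x q -> Jh q *m Jh q = - 1%:M.
Proof.
move=> xq; rewrite /Jh -loc_endM //.
rewrite (_ : (fun y => _) = (fun y => (-1) *: 1%:M)).
  by rewrite loc_endZ loc_end1 // scaleN1r.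
by apply/funext => y; rewrite -cplxM aJ.2 cplxN cplx1 scaleN1r.
Qed.

Lemma smooth_J : smooth_near p Jh. Proof. exact: aJ.1. Qed.

Lemma smooth_rho : smooth_near p rh.
Proof.
have H : smooth_near p (fun q => 2^-1 *: (1%:M - 'i%C *: Jh q)).
  apply: smooth_nearZ; apply: smooth_nearD; first exact: smooth_near_cst.
  by apply: smooth_nearN; apply: smooth_nearZ; apply: smooth_J.
by apply: smooth_near_ext H; apply: near_codI => q xq; rewrite loc_rho.
Qed.

Lemma conj_loc_J q : conj_mx (Jh q) = Jh q.
Proof.
rewrite /Jh -loc_end_conj; congr (loc_end x _ q).
by apply/funext => y; apply: conj_cplx.
Qed.

Let A := dmx Jh p.

Lemma dmx_rho X : dmx rh p X = (- (2^-1 * 'i%C)) *: A X.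
Proof.
have dJ : jdiff Jh p by apply: smooth_near_jdiff; apply: smooth_J.
rewrite -dmxZ // -[RHS]add0r -(dmx_cst (2^-1 *: 1%:M) p X) -dmxD; last 2 first.
- exact: jdiff_cst.
- exact: jdiffZ.
apply: dmx_ext; apply: near_codI => q xq; rewrite loc_rho // /rhoc.
by rewrite scalerBr scalerA scaleNr.
Qed.

Lemma dJ_anticomm X : A X *m cplx (J x) = - (cplx (J x) *m A X).
Proof.
have dJ : jdiff Jh p by apply: smooth_near_jdiff; apply: smooth_J.
have := dmxM X dJ dJ; rewrite -/A /Jh loc_end_id -/Jh => H.
apply/eqP; rewrite -addr_eq0 -H; apply/eqP.
rewrite -(dmx_cst (- 1%:M : 'M[C]_n) p X); apply: dmx_ext.
by apply: near_codI => q xq; rewrite loc_JJ.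
Qed.

Lemma conj_dJ X : conj_mx (A X) = A (conj_mx X).
Proof.
have dJ : jdiff Jh p by apply: smooth_near_jdiff; apply: smooth_J.
have := dmx_conj (conj_mx X) dJ; rewrite conj_mxK => <-.
by apply: dmx_ext; near=> q; rewrite conj_loc_J.
Unshelve. all: by end_near. Qed.

End Local.
End AlmostComplex.

(** The two eigenvalue equations are subtracted. In use, P - iQ comes from a bracket of T10 fields
    and P + iQ from its conjugate, and the conclusion is the vanishing of the Nijenhuis tensor. *)
Lemma type_split (F : fieldType) m (i : F) (P Q : 'rV[F]_m) (J : 'M[F]_m) :
  i * i = -1 -> (2 : F) != 0 -> i != 0 ->
  (P - i *: Q) *m J = i *: (P - i *: Q) ->
  (P + i *: Q) *m J = - i *: (P + i *: Q) -> P + Q *m J = 0.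
Proof.
move=> ii two i0; rewrite mulmxBl mulmxDl -!scalemxAl scalerBr scalerDr !scalerA.
rewrite mulNr ii opprK scaleN1r scale1r opprK scaleNr => E1 E2.
have : (2 * i) *: (P + Q *m J) = 0.
  have {}E1 : P *m J - i *: (Q *m J) - (i *: P + Q) = 0 by rewrite E1 subrr.
  have {}E2 : P *m J + i *: (Q *m J) - (- (i *: P) + Q) = 0 by rewrite E2 subrr.
  by rewrite -[RHS](subrr 0) -{1}E2 -E1; mxring.
by move/eqP; rewrite scaler_eq0 mulf_eq0 (negPf two) (negPf i0) => /eqP.
Qed.

Lemma rho_commutator (F : fieldType) m (c i : F) (G J : 'M[F]_m) :
  (- (c * i)) *: (G *m J - J *m G) =
  G *m (c *: (1%:M - i *: J)) - (c *: (1%:M - i *: J)) *m G.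
Proof.
rewrite -!scalemxAl -!scalemxAr mulmxBl mulmxBr mulmx1 mul1mx -scalemxAl -scalemxAr.
by mxring.
Qed.

Lemma sub_scale_ring (F : fieldType) a b (i : F) (p q u v : 'M[F]_(a, b)) :
  p - i *: q - (u - i *: v) = p - u - i *: (q - v).
Proof. by mxring. Qed.

Lemma scaled_eigenvector (F : fieldType) m (c i : F) (u : 'rV[F]_m) (J : 'M[F]_m) :
  c != 0 -> (c *: u) *m J = i *: (c *: u) -> u *m J = i *: u.
Proof.
by move=> c0; rewrite -scalemxAl scalerA mulrC -scalerA => /(scalerI c0).
Qed.

(** * Integrability, the Nijenhuis tensor and the parallel connection *)

Section Integrability.
Variables (R : realType) (n : nat) (M : manifold R n).
Local Notation C := R[i].
Implicit Types (x y : M) (J : M -> 'M[R]_n).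
Opaque chart_jac.

(** The field with components [v *m loc_end x E q] is easily differentiated in the chart, yet lies
    in the image of [E] at every point of the domain. With [E] a projection this produces sections
    of T10 or T01. *)
Lemma unloc_end x (v : 'rV[C]_n) (E : M -> 'M[C]_n) y : ddom x y ->
  exists u, unloc_vec x (fun q => v *m loc_end x E q) y = u *m E y.
Proof.
move=> xy; exists (v *m chart_jac x y y).
rewrite /unloc_vec /loc_end (pointK xy).
have := jacbf (cod_coord xy); rewrite /jacb /jacf (pointK xy).
move: (chart_jac x y y) (chart_jac y x y) => A B BA.
by rewrite !mulmxA -(mulmxA _ B A) BA mulmx1.
Qed.

Lemma unloc_biv x (a : 'rV[C]_n) (S : M -> 'M[C]_n) y : ddom x y ->
  exists u, unloc_vec x (fun q => a *m loc_biv x S q) y = u *m S y.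
Proof.
move=> xy; exists (a *m (chart_jac y x y)^T).
rewrite /unloc_vec /loc_biv (pointK xy).
have := jacbf (cod_coord xy); rewrite /jacb /jacf (pointK xy).
move: (chart_jac x y y) (chart_jac y x y) => A B BA.
by rewrite !mulmxA -(mulmxA _ B A) BA mulmx1.
Qed.

Opaque loc_vec loc_cov loc_end loc_form loc_biv dmx jdiff djac lie.

Lemma lie_unloc x (Xh Yh : 'rV[R]_n -> 'rV[C]_n) :
  lie x (unloc_vec x Xh) (unloc_vec x Yh) =
  dmx Yh (coord x x) (Xh (coord x x)) - dmx Xh (coord x x) (Yh (coord x x)).
Proof.
rewrite lieE -(loc_vec_id x (unloc_vec x Xh)) -(loc_vec_id x (unloc_vec x Yh)).
rewrite (unloc_vecK Xh (cod_id x)) (unloc_vecK Yh (cod_id x)).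
by rewrite (dmx_ext _ (near_unloc_vecK x Xh)) (dmx_ext _ (near_unloc_vecK x Yh)).
Qed.

Lemma dmx_cstM a b c (B : 'M[C]_(a, b)) (F : 'rV[R]_n -> 'M[C]_(b, c)) p X :
  jdiff F p -> dmx (fun q => B *m F q) p X = B *m dmx F p X.
Proof.
by move=> dF; rewrite (dmxM X (jdiff_cst B p) dF) dmx_cst mul0mx add0r.
Qed.

Lemma lie_conj x (X Y : M -> 'rV[C]_n) : smooth_vec_at x X -> smooth_vec_at x Y ->
  lie x (fun y => conj_mx (X y)) (fun y => conj_mx (Y y)) = conj_mx (lie x X Y).
Proof.
move=> /smooth_near_jdiff dX /smooth_near_jdiff dY.
have E (Z : M -> 'rV[C]_n) : loc_vec x (fun y => conj_mx (Z y)) =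
    (fun q => conj_mx (loc_vec x Z q)) by apply/funext => q; apply: loc_vec_conj.
by rewrite !lieE !E !dmx_conj // !conj_mxK conj_mxB.
Qed.

Lemma smooth_vec_conj x (X : M -> 'rV[C]_n) : smooth_vec_at x X ->
  smooth_vec_at x (fun y => conj_mx (X y)).
Proof.
move=> sX; apply: smooth_near_ext (smooth_near_conj sX).
by apply: near_codI => q _; rewrite loc_vec_conj.
Qed.

Section Fixed.
Variables (J : M -> 'M[R]_n) (x : M).
Hypothesis aJ : almost_complex J.
Hypothesis intJ : integrable_J J.

Lemma T01_conj y X : T01 J y X <-> T10 J y (conj_mx X).
Proof.
split=> [[Y YT <-]|XT]; first by rewrite conj_mxK.
by exists (conj_mx X) => //; rewrite conj_mxK.
Qed.

Lemma integrable_T01 (X Y : M -> 'rV[C]_n) : smooth_vec_at x X -> smooth_vec_at x Y ->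
  (\forall y \near x, T01 J y (X y) /\ T01 J y (Y y)) -> T01 J x (lie x X Y).
Proof.
move=> sX sY XY; apply/T01_conj; rewrite -lie_conj //.
apply: intJ; [exact: smooth_vec_conj|exact: smooth_vec_conj|].
by apply: filterS XY => y [/T01_conj ? /T01_conj ?].
Qed.

Let p := coord x x.
Let Jc := cplx (J x).
Let A := dmx (loc_end x (fun y => cplx (J y))) p.
Let rh := loc_end x (rho J).

(** Integrability is applied to the projections by [rho] of two fields constant in the chart. The
    derivative of [rho] is a nonzero multiple of that of J, and an eigenvalue equation ignores the
    factor. *)
Lemma nijenhuis_T10 v w :
  (w *m A (v *m rho J x) - v *m A (w *m rho J x)) *m Jc =
  'i%C *: (w *m A (v *m rho J x) - v *m A (w *m rho J x)).
Proof.
have srh : smooth_near p rh by apply: smooth_rho.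
have drh := smooth_near_jdiff srh.
pose S u := unloc_vec x (fun q => u *m rh q).
have sS u : smooth_vec_at x (S u).
  by apply: unloc_vec_smooth; apply: smooth_nearM => //; apply: smooth_near_cst.
have TS u y : ddom x y -> T10 J y (S u y).
  move=> xy; have [u' E] := unloc_end u (rho J) xy; rewrite (E : S u y = _).
  by apply/(T10P (aJ.2 y)); rewrite -mulmxA (rho_idem (aJ.2 y)).
have : T10 J x (lie x (S v) (S w)).
  apply: intJ (sS v) (sS w) _.
  by apply: filterS (near_ddom x) => y xy; split; apply: TS.
have rp : rh p = rho J x := loc_end_id x (rho J).
have -> : lie x (S v) (S w) = w *m dmx rh p (v *m rho J x) - v *m dmx rh p (w *m rho J x).
  apply: etrans (lie_unloc x (fun q => v *m rh q) (fun q => w *m rh q)) _.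
  by rewrite (dmx_cstM w _ drh) (dmx_cstM v _ drh) -/p rp.
rewrite (dmx_rho x aJ (v *m rho J x)) (dmx_rho x aJ (w *m rho J x)) -/p -/A.
rewrite -!scalemxAr -scalerBr; apply: scaled_eigenvector.
by rewrite oppr_eq0 mulf_neq0 // ?invr_eq0 ?two_neq0 // im_neq0.
Qed.

(** Expanding [rho] in [nijenhuis_T10] gives the equation for P - iQ. As J is real, conjugating this
    equation at the conjugate vectors gives the companion equation for P + iQ that [type_split] asks
    for. *)
Lemma nijenhuis_eq0 v w :
  w *m A v - v *m A w + (w *m A (v *m Jc) - v *m A (w *m Jc)) *m Jc = 0.
Proof.
have linA : linear_fun A by move=> k u t; apply: dmx_linear.
pose P v w := w *m A v - v *m A w.
pose Q v w := w *m A (v *m Jc) - v *m A (w *m Jc).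
have rhoA u : A (u *m rho J x) = 2^-1 *: (A u - 'i%C *: A (u *m Jc)).
  rewrite rhoE /rhoc -scalemxAr (linear_funZ linA) mulmxBr mulmx1 -scalemxAr.
  by rewrite -scaleNr (linear_funD linA) (linear_funZ linA) scaleNr.
have E1 a b : (P a b - 'i%C *: Q a b) *m Jc = 'i%C *: (P a b - 'i%C *: Q a b).
  have H : b *m A (a *m rho J x) - a *m A (b *m rho J x) =
      2^-1 *: (P a b - 'i%C *: Q a b).
    rewrite !rhoA -!scalemxAr -scalerBr !mulmxBr -!scalemxAr; congr (_ *: _).
    exact: sub_scale_ring.
  have := nijenhuis_T10 a b; rewrite H; apply: scaled_eigenvector.
  by rewrite invr_eq0 two_neq0.
have cA u t : conj_mx (u *m A t) = conj_mx u *m A (conj_mx t).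
  by rewrite conj_mxM conj_dJ.
have cJ : conj_mx Jc = Jc by apply: conj_cplx.
have E2 : (P v w + 'i%C *: Q v w) *m Jc = - 'i%C *: (P v w + 'i%C *: Q v w).
  have := congr1 (@conj_mx R _ _) (E1 (conj_mx v) (conj_mx w)).
  have cP : conj_mx (P (conj_mx v) (conj_mx w)) = P v w.
    by rewrite /P conj_mxB !cA !conj_mxK.
  have cQ : conj_mx (Q (conj_mx v) (conj_mx w)) = Q v w.
    by rewrite /Q conj_mxB !cA !conj_mxM !cJ !conj_mxK.
  by rewrite conj_mxM conj_mxZ cJ conj_mxB conj_mxZ cP cQ conj_i !scaleNr opprK.
rewrite -/(P v w) -/(Q v w).
exact: type_split (im_sqr R) (two_neq0 R) (im_neq0 R) (E1 v w) E2.
Qed.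

Lemma parallel_connection : exists G : 'rV[C]_n -> 'M[C]_n,
  [/\ linear_fun G, forall X Y, Y *m G X = X *m G Y
    & forall X, dmx rh p X = G X *m rho J x - rho J x *m G X].
Proof.
have linA : linear_fun A by move=> k u t; apply: dmx_linear.
have [G [lG sG AG]] := torsion_free_connection (@two_neq0 R)
  (cplx_sqrN1 (aJ.2 x)) linA (dJ_anticomm x aJ) nijenhuis_eq0.
exists G; split; [exact: lG|exact: sG|move=> X].
apply: etrans (dmx_rho x aJ X) _; rewrite -/p -/A AG rhoE.
exact: rho_commutator.
Qed.

End Fixed.
End Integrability.

Lemma sandwich_idem (F : fieldType) m (k : F) (r P : 'M[F]_m) : r *m r = r ->
  r^T *m (k *: (r^T *m P *m r)) *m r = k *: (r^T *m P *m r).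
Proof.
move=> rr; rewrite -scalemxAr -scalemxAl !mulmxA -trmx_mul rr.
by rewrite -!mulmxA rr.
Qed.

Lemma complement_tr (F : fieldType) m (c i : F) (J : 'M[F]_m) :
  (1%:M - c *: (1%:M - i *: J))^T = 1%:M - c *: (1%:M - i *: J^T).
Proof.
apply/matrixP => a b; rewrite mxE !(addmxE, oppmxE, scalemxE).
by rewrite [J^T a b]mxE ![_%:M _ _]mxE eq_sym.
Qed.

Lemma complement_tr_eq0 (F : fieldType) m (i : F) (Z : 'rV[F]_m) (J : 'M[F]_m) :
  i * i = -1 -> (2 : F) != 0 -> Z *m J^T = i *: Z ->
  Z *m (1%:M - 2^-1 *: (1%:M - i *: J))^T = 0.
Proof.
move=> ii two ZJ.
rewrite complement_tr mulmxBr mulmx1 -scalemxAr.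
rewrite mulmxBr mulmx1 -scalemxAr ZJ scalerA ii scaleN1r opprK.
have -> : Z + Z = 2 *: Z by rewrite scaler_nat.
by rewrite scalerA mulVf // scale1r subrr.
Qed.

(** * From a closed eps to holomorphic Poisson bivectors *)

Section BivectorJets.
Variables (R : realType) (n : nat).
Local Notation C := R[i].
Opaque dmx jdiff.

Lemma dmx_inv m (F : 'rV[R]_n -> 'M[C]_m) p X :
  (\forall q \near p, F q \in unitmx) -> jdiff F p -> jdiff (fun q => invmx (F q)) p ->
  dmx (fun q => invmx (F q)) p X = - (invmx (F p) *m dmx F p X *m invmx (F p)).
Proof.
move=> uF dF dV; have uFp := nbhs_singleton uF.
have : dmx (fun q => F q *m invmx (F q)) p X = 0.
  rewrite -(dmx_cst (1%:M : 'M[C]_m) p X); apply: dmx_ext.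
  by apply: filterS uF => q uq; rewrite mulmxV.
rewrite (dmxM X dF dV) => /(congr1 (mulmx (invmx (F p)))).
rewrite mulmx0 mulmxDr mulmxA (mulmxA (invmx _) (F p)) mulVmx // mul1mx.
by move/eqP; rewrite addrC addr_eq0 => /eqP.
Qed.

Lemma dmx_biv m (r P : 'rV[R]_n -> 'M[C]_m) (k : C) p X : jdiff r p -> jdiff P p ->
  dmx (fun q => k *: ((r q)^T *m P q *m r q)) p X =
  k *: ((dmx r p X)^T *m P p *m r p + (r p)^T *m dmx P p X *m r p
        + (r p)^T *m P p *m dmx r p X).
Proof.
move=> dr dP; have dT := jdiff_tr dr; have dTP := jdiffM dT dP.
rewrite (dmxZ k X (jdiffM dTP dr)) (dmxM X dTP dr) (dmxM X dT dP) dmx_tr.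
by rewrite mulmxDl.
Qed.

Lemma near_kernel_deriv (X : 'rV[R]_n -> 'rV[C]_n) (r : 'rV[R]_n -> 'M[C]_n) p :
  jdiff X p -> jdiff r p -> (\forall q \near p, X q *m r q = 0) ->
  forall v, v *m djac X p *m r p + X p *m dmx r p v = 0.
Proof.
move=> dX dr Xr v; rewrite mul_djac -(dmxM v dX dr).
by rewrite -(dmx_cst (0 : 'rV[C]_n) p v); apply: dmx_ext.
Qed.

End BivectorJets.

Lemma linear_pair_congr (F : fieldType) m (a b : 'rV[F]_m) (f g : 'rV[F]_m -> 'M[F]_m)
    (S U V : 'M[F]_m) : (forall u, f u = g u) -> S = U *m V ->
  b *m f (a *m S) - a *m f (b *m S) = b *m g (a *m U *m V) - a *m g (b *m U *m V).
Proof. by move=> fg ->; rewrite !fg !mulmxA. Qed.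

Section HolomorphicPoisson.
Variables (R : realType) (n : nat) (M : manifold R n).
Local Notation C := R[i].
Opaque chart_jac loc_vec loc_cov loc_end loc_form loc_biv dmx jdiff djac lie lie_biv.
Implicit Types (x y : M).

Lemma lie_unloc_lin x (a b : 'rV[C]_n) (S : 'rV[R]_n -> 'M[C]_n) :
  let p := coord x x in jdiff S p ->
  lie x (unloc_vec x (fun q => a *m S q)) (unloc_vec x (fun q => b *m S q)) =
  b *m dmx S p (a *m S p) - a *m dmx S p (b *m S p).
Proof. by move=> p dS; rewrite lie_unloc !dmx_cstM. Qed.

Lemma T01_section_deriv (J : M -> 'M[R]_n) x (X : M -> 'rV[C]_n) :
  almost_complex J -> smooth_vec_at x X -> (\forall y \near x, T01 J y (X y)) ->
  forall v, v *m djac (loc_vec x X) (coord x x) *m rho J x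
    + X x *m dmx (loc_end x (rho J)) (coord x x) v = 0.
Proof.
move=> aJ sX TX; have sr := smooth_rho x aJ.
have nXr : \forall q \near coord x x, loc_vec x X q *m loc_end x (rho J) q = 0.
  have := near_point_id TX; apply: filterS2 (near_cod (cod_id x)) => q xq Tq.
  rewrite -(loc_vecM xq) -[RHS](mul0mx _ (jacb x q)).
  exact: (congr1 (mulmx^~ (jacb x q)) ((T01P (aJ.2 (point x q)) _).1 Tq)).
have := near_kernel_deriv (smooth_near_jdiff sX) (smooth_near_jdiff sr) nXr.
by rewrite (loc_end_id x (rho J)) (loc_vec_id x X).
Qed.

Section Closed.
Variables (eps J : M -> 'M[R]_n).
Hypothesis skeps : forall x, (eps x)^T = - eps x.
Hypothesis ueps : forall x, eps x \in unitmx.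
Hypothesis seps : smooth_form (fun x => cplx (eps x)).
Hypothesis aJ : almost_complex J.

Let w x := cplx (eps x).
Let J' := Jminus eps J.

(** The factor - i appears because the inverse of i eps is - i eps^-1; the projection on both sides
    takes the (2,0) part. *)
Definition biv10 x : 'M[C]_n :=
  (- 'i%C) *: ((rho J x)^T *m invmx (cplx (eps x)) *m rho J x).

Lemma skew_w x : (w x)^T = - w x.
Proof. by rewrite /w -cplx_tr skeps cplxN. Qed.

Lemma unit_w x : w x \in unitmx.
Proof. by rewrite /w cplx_unit. Qed.

Lemma skew_inv (F : fieldType) m (A : 'M[F]_m) : A \in unitmx ->
  A^T = - A -> (invmx A)^T = - invmx A.
Proof.
move=> uA skA; have : (invmx A)^T *m A^T = 1%:M by rewrite -trmx_mul mulmxV ?trmx1.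
rewrite skA mulmxN => /(canRL (@opprK _)) AT.
by rewrite -[LHS]mulmx1 -(mulmxV uA) mulmxA AT mulNmx mul1mx.
Qed.

Lemma cplx_Jminus x : cplx (J' x) = - (w x *m (cplx (J x))^T *m invmx (w x)).
Proof. by rewrite /J' /Jminus cplxN !cplxM cplx_tr cplx_inv. Qed.

Lemma Jminus_sqr x : J' x *m J' x = - 1%:M.
Proof.
rewrite /J' /Jminus mulmxN mulNmx opprK -!mulmxA mulKmx // (mulmxA _^T) -trmx_mul.
by rewrite aJ.2 linearN /= trmx1 mulNmx mul1mx mulmxN mulmxV.
Qed.

(** Through eps, J- acts as minus the transpose of J on covectors, and [u *m (rho J x)^T] is an
    i-eigenvector of that transpose. *)
Lemma T01_Jminus x (u : 'rV[C]_n) :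
  T01 J' x (u *m ((rho J x)^T *m invmx (w x))).
Proof.
apply/(T01J (Jminus_sqr x)); rewrite cplx_Jminus mulmxN ; congr (- _).
rewrite !mulmxA -(mulmxA _ (invmx _)) mulVmx ?unit_w // mulmx1.
rewrite -(mulmxA u _ (cplx (J x))^T) -trmx_mul rhoE J_rhoc rhoc_J ?cplx_sqrN1 ?aJ.2 //.
by rewrite linearZ /= -scalemxAr -!scalemxAl.
Qed.

Section AtPoint.
Variable x : M.
Let p := coord x x.
Let rh := loc_end x (rho J).
Let wh := loc_form x w.

Lemma near_unit_w : \forall q \near p, wh q \in unitmx.
Proof. by apply: near_codI => q xq; apply: loc_form_unit => //; apply: unit_w. Qed.

Lemma smooth_inv_w : smooth_near p (fun q => invmx (wh q)).
Proof. by apply: smooth_near_inv near_unit_w _; apply: seps. Qed.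

Lemma near_loc_biv10 : \forall q \near p,
  (- 'i%C) *: ((rh q)^T *m invmx (wh q) *m rh q) = loc_biv x biv10 q.
Proof.
apply: near_codI => q xq.
apply: etrans _ (esym (loc_bivZ x q (- 'i%C)
  (fun y => (rho J y)^T *m invmx (cplx (eps y)) *m rho J y))).
congr (_ *: _); symmetry; apply: etrans (loc_biv_end xq _ _) _.
by congr (_ *m _ *m _); apply: loc_biv_inv => //; apply: unit_w.
Qed.

Lemma smooth_biv10 : smooth_near p (loc_biv x biv10).
Proof.
apply: smooth_near_ext near_loc_biv10 _; apply: smooth_nearZ.
have sr : smooth_near p rh by apply: smooth_rho.
apply: smooth_nearM => //; apply: smooth_nearM; first exact: smooth_near_tr.
exact: smooth_inv_w.
Qed.

Let r := rho J x.
Let P := invmx (w x).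
Let dr := dmx rh p.
Let W := dmx wh p.

Lemma dmx_inv_w X : dmx (fun q => invmx (wh q)) p X = - (P *m W X *m P).
Proof.
have sw : smooth_near p wh by apply: seps.
apply: etrans (dmx_inv X near_unit_w (smooth_near_jdiff sw)
  (smooth_near_jdiff smooth_inv_w)) _.
by rewrite (loc_form_id x w : wh p = w x).
Qed.

Lemma dmx_biv10 X : dmx (loc_biv x biv10) p X =
  (- 'i%C) *: ((dr X)^T *m P *m r - r^T *m (P *m W X *m P) *m r + r^T *m P *m dr X).
Proof.
rewrite -(dmx_ext X near_loc_biv10).
have sr : smooth_near p rh by apply: smooth_rho.
apply: etrans (dmx_biv _ X (smooth_near_jdiff sr) (smooth_near_jdiff smooth_inv_w)) _.
rewrite dmx_inv_w (loc_end_id x (rho J) : rh p = r) (loc_form_id x w : wh p = w x).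
by rewrite mulmxN mulNmx.
Qed.

Lemma biv10_skew : (biv10 x)^T = - biv10 x.
Proof.
rewrite /biv10 linearZ /= !trmx_mul trmxK -scalerN (skew_inv (unit_w x) (skew_w x)).
by rewrite mulNmx mulmxN mulmxA.
Qed.

Lemma biv10_type : (rho J x)^T *m biv10 x *m rho J x = biv10 x.
Proof.
exact: sandwich_idem (rho_idem (aJ.2 x)).
Qed.

Lemma T01_JminusP (Z : 'rV[C]_n) : T01 J' x Z -> Z *m w x *m (1%:M - r)^T = 0.
Proof.
move=> /(T01J (Jminus_sqr x)); rewrite cplx_Jminus mulmxN => /oppr_inj.
move=> /(congr1 (fun T => T *m w x)); rewrite !mulmxA mulmxKV ?unit_w // -scalemxAl.
exact: complement_tr_eq0 (im_sqr R) (two_neq0 R).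
Qed.

Hypothesis intJ : integrable_J J.
Hypothesis intJ' : integrable_J J'.

(** The abstract involutivity hypothesis is met here: the sections [c *m (rho J y)^T *m invmx (w y)]
    span T01 of J-, their bracket stays there by integrability, and [T01_JminusP] turns this into a
    linear equation. *)
Lemma Jminus_involutive (a b : 'rV[C]_n) :
  let X := a *m r^T *m P in let Y := b *m r^T *m P in
  (b *m ((dr X)^T *m P - r^T *m (P *m W X *m P))
   - a *m ((dr Y)^T *m P - r^T *m (P *m W Y *m P))) *m w x *m (1%:M - r)^T = 0.
Proof.
move=> X Y; pose S y := (rho J y)^T *m invmx (w y).
have near_S : \forall q \near p, (rh q)^T *m invmx (wh q) = loc_biv x S q.
  apply: near_codI => q xq; symmetry; apply: etrans (loc_biv_trend xq _ _) _.
  by congr (_ *m _); apply: loc_biv_inv => //; apply: unit_w.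
have sr : smooth_near p rh by apply: smooth_rho.
have srt : smooth_near p (fun q => (rh q)^T) by apply: smooth_near_tr.
have sS : smooth_near p (loc_biv x S).
  by apply: smooth_near_ext near_S (smooth_nearM srt smooth_inv_w).
pose U c := unloc_vec x (fun q => c *m loc_biv x S q).
have sU c : smooth_vec_at x (U c).
  by apply: unloc_vec_smooth; apply: smooth_nearM sS; apply: smooth_near_cst.
have TU c y : ddom x y -> T01 J' y (U c y).
  move=> xy; have [u E] := unloc_biv c S xy; rewrite (E : U c y = _).
  exact: T01_Jminus.
have TZ : T01 J' x (lie x (U a) (U b)).
  apply: (integrable_T01 intJ' (sU a) (sU b)).
  by apply: filterS (near_ddom x) => y xy; split; apply: TU.
have dS T : dmx (loc_biv x S) p T = (dr T)^T *m P - r^T *m (P *m W T *m P).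
  rewrite -(dmx_ext T near_S).
  rewrite (dmxM T (smooth_near_jdiff srt) (smooth_near_jdiff smooth_inv_w)) dmx_tr.
  rewrite dmx_inv_w (loc_end_id x (rho J) : rh p = r) (loc_form_id x w : wh p = w x).
  by rewrite mulmxN.
have Sp : loc_biv x S p = r^T *m P by exact: loc_biv_id.
have E := lie_unloc_lin a b (smooth_near_jdiff sS).
have E2 := etrans E (linear_pair_congr a b dS Sp).
exact: etrans (congr1 (fun Z => Z *m w x *m (1%:M - r)^T) (esym E2)) (T01_JminusP TZ).
Qed.

End AtPoint.

Lemma holomorphic_Poisson_biv10 : (forall x, closed_at x w) ->
  integrable_J J -> integrable_J J' -> holomorphic_Poisson_biv J biv10.
Proof.
move=> cw intJ intJ'.
have skeW x X : (dmx (loc_form x w) (coord x x) X)^T = - dmx (loc_form x w) (coord x x) X.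
  apply: dmx_skew; first exact: smooth_near_jdiff (seps x).
  exact: loc_form_skew skew_w.
split.
- split; first exact: smooth_biv10.
  by move=> x; split; [apply: biv10_skew|apply: biv10_type].
- move=> x X sX TX; have [G [lG sG rG]] := parallel_connection x aJ intJ.
  have DXr := T01_section_deriv aJ sX TX.
  have Xr : X x *m rho J x = 0.
    by apply/(T01P (aJ.2 x)); apply: (nbhs_singleton TX).
  rewrite lie_bivE dmx_biv10.
  have := lie_biv_eq0 sG (rho_idem (aJ.2 x)) rG (- 'i%C)
    (mulmxV (unit_w x)) (mulVmx (unit_w x)) (skew_w x) (skeW x) (cw x)
    (@Jminus_involutive x intJ') Xr DXr.
  by [].
- move=> x; apply/(schoutenP (biv10_skew x)) => a b c.
  have [G [lG sG rG]] := parallel_connection x aJ intJ.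
  have linW : linear_fun (dmx (loc_form x w) (coord x x)).
    by move=> k u v; apply: dmx_linear.
  have := schouten_eq0 sG (rho_idem (aJ.2 x)) rG (- 'i%C) lG linW
    (mulmxV (unit_w x)) (mulVmx (unit_w x)) (skew_w x) (skeW x) (cw x)
    (@Jminus_involutive x intJ') a b c.
  congr (cyc3 _ a b c = 0); apply/funext => u.
  by symmetry; apply: dmx_biv10.
Qed.

End Closed.
End HolomorphicPoisson.

(** * From nondegenerate holomorphic Poisson bivectors to closed forms *)

Section NondegeneratePoisson.
Variables (R : realType) (n : nat) (M : manifold R n).
Local Notation C := R[i].
Opaque chart_jac loc_vec loc_cov loc_end loc_form loc_biv dmx jdiff djac lie lie_biv.
Implicit Types (x y : M).

Variables (J : M -> 'M[R]_n) (f s : M -> 'M[C]_n) (k : C).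
Hypothesis aJ : almost_complex J.
Hypothesis sf : smooth_form f.
Hypothesis skf : forall x, (f x)^T = - f x.
Hypothesis uf : forall x, f x \in unitmx.
Hypothesis rf : forall x, rho J x *m f x = f x *m (rho J x)^T.
Hypothesis k0 : k != 0.
Hypothesis sE : s = fun x => k *: (invmx (f x) *m rho J x).
Hypothesis intJ : integrable_J J.
Hypothesis hPs : holomorphic_Poisson_biv J s.

(** Holomorphy speaks of fields, the pointwise argument of vectors. The extension of [X] constant in
    the chart is projected to T01 by [1%:M - rho J y]. *)
Lemma T01_extension x (X : 'rV[C]_n) : X *m rho J x = 0 ->
  exists S : M -> 'rV[C]_n, [/\ smooth_vec_at x S, S x = X
    & \forall y \near x, T01 J y (S y)].
Proof.
move=> Xr; pose E y := 1%:M - rho J y.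
exists (unloc_vec x (fun q => X *m loc_end x E q)).
have sr := smooth_rho x aJ.
split.
- apply: unloc_vec_smooth; apply: smooth_nearM; first exact: smooth_near_cst.
  apply: smooth_near_ext (smooth_nearD (smooth_near_cst _ 1%:M) (smooth_nearN sr)).
  apply: near_codI => q xq; symmetry; apply: etrans (loc_endD x q _ _) _.
  congr (_ + _); first exact: loc_end1.
  by rewrite -scaleN1r -loc_endZ; congr (loc_end x _ q); apply/funext => y; rewrite scaleN1r.
- rewrite -(loc_vec_id x (unloc_vec x _)) (unloc_vecK _ (cod_id x)) (loc_end_id x E).
  by rewrite mulmxBr mulmx1 Xr subr0.
- apply: filterS (near_ddom x) => y xy; have [u ->] := unloc_end X E xy.
  by apply/(T01P (aJ.2 y)); rewrite -mulmxA mulmxBl mul1mx (rho_idem (aJ.2 y)) subrr mulmx0.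
Qed.

Section AtPoint.
Variable x : M.
Let p := coord x x.
Let rh := loc_end x (rho J).
Let fh := loc_form x f.

Let sr : smooth_near p rh. Proof. exact: smooth_rho. Qed.
Let sfh : smooth_near p fh. Proof. exact: sf. Qed.
Let ufh : \forall q \near p, fh q \in unitmx.
Proof. by apply: near_codI => q xq; apply: loc_form_unit => //; apply: uf. Qed.
Let sV : smooth_near p (fun q => invmx (fh q)). Proof. exact: smooth_near_inv. Qed.

Lemma dmx_nondegenerate X : dmx (loc_biv x s) p X =
  k *: (invmx (f x) *m dmx rh p X - invmx (f x) *m dmx fh p X *m invmx (f x) *m rho J x).
Proof.
have near_s : \forall q \near p, k *: (invmx (fh q) *m rh q) = loc_biv x s q.
  apply: near_codI => q xq; rewrite sE; symmetry.
  apply: etrans (loc_bivZ x q k (fun y => invmx (f y) *m rho J y)) _; congr (_ *: _).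
  apply: etrans (loc_biv_mul xq _ _) _; congr (_ *m _).
  by apply: loc_biv_inv => //; apply: uf.
rewrite -(dmx_ext X near_s).
have dV := smooth_near_jdiff sV; have dr := smooth_near_jdiff sr.
rewrite (dmxZ k X (jdiffM dV dr)) (dmxM X dV dr).
rewrite (dmx_inv X ufh (smooth_near_jdiff sfh) dV).
rewrite (loc_end_id x (rho J) : rh p = rho J x) (loc_form_id x f : fh p = f x).
by rewrite mulNmx addrC.
Qed.

Lemma dmx_rho_form X : dmx rh p X *m f x + rho J x *m dmx fh p X =
  dmx fh p X *m (rho J x)^T + f x *m (dmx rh p X)^T.
Proof.
have dr := smooth_near_jdiff sr; have df := smooth_near_jdiff sfh.
have dt := jdiff_tr dr.
have E : \forall q \near p, rh q *m fh q = fh q *m (rh q)^T.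
  apply: near_codI => q xq.
  apply: etrans (esym (loc_end_form xq (rho J) f)) _.
  apply: etrans _ (loc_form_trend xq (rho J) f).
  by congr (loc_form x _ q); apply/funext => y; apply: rf.
have := dmx_ext X E; rewrite (dmxM X dr df) (dmxM X df dt) dmx_tr.
by rewrite (loc_end_id x (rho J) : rh p = rho J x) (loc_form_id x f : fh p = f x).
Qed.

Lemma closed_rho_form : closed_at x (fun y => f y *m (rho J y)^T).
Proof.
have [[_ tys] hols schs] := hPs; have sx := congr1 (fun g => g x) sE.
have [G [lG sG rG]] := parallel_connection x aJ intJ.
have linB : linear_fun (dmx fh p) by move=> c u v; apply: dmx_linear.
have H1 : forall X, X *m rho J x = 0 -> exists DX,
    (forall v, v *m DX *m rho J x + X *m dmx rh p v = 0) /\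
    (rho J x)^T *m (k *: (invmx (f x) *m dmx rh p X
        - invmx (f x) *m dmx fh p X *m invmx (f x) *m rho J x)
      - DX^T *m (k *: (invmx (f x) *m rho J x))
      - (k *: (invmx (f x) *m rho J x)) *m DX) *m rho J x = 0.
  move=> X Xr; have [S [sS Sx TS]] := T01_extension Xr.
  exists (djac (loc_vec x S) p); split.
    by have := T01_section_deriv aJ sS TS; rewrite Sx.
  have := hols x S sS TS; rewrite lie_bivE Sx dmx_nondegenerate sx.
  by [].
have H2 := (schoutenP (tys x).1).1 (schs x).
have H3 : forall a b c, cyc3 (fun a => k *: (invmx (f x) *m dmx rh p (a *m (k *: (invmx (f x) *m rho J x)))
        - invmx (f x) *m dmx fh p (a *m (k *: (invmx (f x) *m rho J x))) *m invmx (f x) *m rho J x)) a b c = 0.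
  move=> a b c; have := H2 a b c; congr (cyc3 _ a b c = 0); apply/funext => u.
  by rewrite -sx; apply: dmx_nondegenerate.
have H := closed_of_holomorphic_Poisson sG (rho_idem (aJ.2 x)) rG k0 lG linB
  (mulmxV (uf x)) (mulVmx (uf x)) (skf x) (rf x) dmx_rho_form H1 H3.
move=> a b c; have := H a b c; congr (cyc3 _ a b c = 0); apply/funext => X.
have E : \forall q \near p, fh q *m (rh q)^T = loc_form x (fun y => f y *m (rho J y)^T) q.
  by apply: near_codI => q xq; symmetry; apply: loc_form_trend.
have dr := smooth_near_jdiff sr; have df := smooth_near_jdiff sfh.
have := dmx_ext X E; rewrite (dmxM X df (jdiff_tr dr)) dmx_tr.
by rewrite (loc_end_id x (rho J) : rh p = rho J x) (loc_form_id x f : fh p = f x).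
Qed.

End AtPoint.
End NondegeneratePoisson.

Lemma biv_pair_form_aux (F : fieldType) m (i : F) (P A B r rt : 'M[F]_m) :
  i * i = -1 -> A *m r = i *: r -> rt *m P = 2^-1 *: (P *m (1%:M + i *: B)) ->
  (- i) *: (rt *m P *m r) = (- 2^-1) *: (P *m (A - B) *m r).
Proof.
move=> ii Ar ->; rewrite -scalemxAl -!mulmxA mulmxBl Ar mulmxDl mul1mx -scalemxAl.
rewrite mulmxDr mulmxBr -!scalemxAr scalerDr scalerDr scalerBr !scalerA.
have -> : - i * 2^-1 * i = 2^-1 by rewrite mulrAC mulNr ii opprK mul1r.
by mxring.
Qed.

(** * Linear algebra of a pair of complex structures with invertible difference *)

Section ComplexPair.
Variables (F : fieldType) (n : nat) (i : F) (A B : 'M[F]_n).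
Hypothesis ii : i * i = -1.
Hypothesis AA : A *m A = - 1%:M.
Hypothesis BB : B *m B = - 1%:M.
Hypothesis uD : A - B \in unitmx.
Let D := A - B.
Let V := invmx D.

Let DV : D *m V = 1%:M. Proof. exact: mulmxV. Qed.
Let VD : V *m D = 1%:M. Proof. exact: mulVmx. Qed.

(** Since both squares are -1, the difference D intertwines [A] with [- B], and so does its
    inverse. *)
Lemma inv_sub_complexl : V *m A = - (B *m V).
Proof.
have H : A *m D = - (D *m B) by rewrite mulmxBr mulmxBl AA BB; mxring.
by rewrite -[V *m A]mulmx1 -DV mulmxA -(mulmxA V) H mulmxN mulmxA VD mul1mx mulNmx.
Qed.

Lemma inv_sub_complexr : V *m B = - (A *m V).
Proof.
have H : B *m D = - (D *m A) by rewrite mulmxBr mulmxBl AA BB; mxring.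
by rewrite -[V *m B]mulmx1 -DV mulmxA -(mulmxA V) H mulmxN mulmxA VD mul1mx mulNmx.
Qed.

(** If Z = X + Y with X A = iX and Y B = iY, then Z (i - B) = X (A - B); solving for X gives this
    formula, and [split_right] arises likewise from Z (A - i). Thus every vector is uniquely a sum
    of i-eigenvectors of [A] and of [B]. *)
Definition split_left (Z : 'rV[F]_n) := Z *m (i *: 1%:M - B) *m V.
Definition split_right (Z : 'rV[F]_n) := Z *m (A - i *: 1%:M) *m V.

Lemma split_sum Z : split_left Z + split_right Z = Z.
Proof.
rewrite /split_left /split_right -mulmxDl -mulmxDr.
have -> : i *: 1%:M - B + (A - i *: 1%:M) = D by rewrite /D; mxring.
by rewrite -mulmxA mulmxV ?mulmx1.
Qed.

Lemma split_leftE Z : split_left Z *m A = i *: split_left Z.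
Proof.
have H : (i *: 1%:M - B) *m B = - (i *: (i *: 1%:M - B)).
  by rewrite mulmxBl BB -scalemxAl mul1mx scalerBr scalerA ii scaleN1r; mxring.
rewrite /split_left -mulmxA inv_sub_complexl mulmxN mulmxA -(mulmxA Z _ B) H.
by rewrite mulmxN mulNmx opprK -scalemxAr -scalemxAl.
Qed.

Lemma split_rightE Z : split_right Z *m B = i *: split_right Z.
Proof.
have H : (A - i *: 1%:M) *m A = - (i *: (A - i *: 1%:M)).
  by rewrite mulmxBl AA -scalemxAl mul1mx scalerBr scalerA ii scaleN1r; mxring.
rewrite /split_right -mulmxA inv_sub_complexr mulmxN mulmxA -(mulmxA Z _ A) H.
by rewrite mulmxN mulNmx opprK -scalemxAr -scalemxAl.
Qed.

Lemma split_unique X Y : X *m A = i *: X -> Y *m B = i *: Y ->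
  X = split_left (X + Y) /\ Y = split_right (X + Y).
Proof.
move=> XA YB; split.
  rewrite /split_left mulmxDl !mulmxBr -!scalemxAr !mulmx1 YB subrr addr0 -XA -mulmxBr.
  by rewrite -mulmxA mulmxV ?mulmx1.
rewrite /split_right mulmxDl !mulmxBr -!scalemxAr !mulmx1 XA subrr add0r -YB -mulmxBr.
by rewrite -mulmxA mulmxV ?mulmx1.
Qed.

Section Form.
Variables (w : 'M[F]_n).
Hypothesis skw : w^T = - w.
Hypothesis uw : w \in unitmx.
Hypothesis BE : B = - (w *m A^T *m invmx w).

(** For J+ and J- in the tamed case 2g = (J+ + J-) eps, so the inverse of this form is a constant
    multiple of g^-1 [J+, J-], the Poisson bivector of bi-Hermitian geometry. *)
Definition pair_form := V *m w.

Lemma adj_left : w *m A^T = - (B *m w).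
Proof. by rewrite BE mulNmx opprK mulmxKV. Qed.

Lemma adj_right : w *m B^T = - (A *m w).
Proof.
have := congr1 trmx adj_left; rewrite linearN /= !trmx_mul trmxK skw mulmxN mulNmx opprK.
by move=> <-.
Qed.

Lemma adj_D : w *m D^T = D *m w.
Proof. by rewrite linearB /= mulmxBr adj_left adj_right opprK mulmxBl addrC. Qed.

Lemma pair_form_D : pair_form *m D^T = w.
Proof. by rewrite /pair_form -mulmxA adj_D mulmxA VD mul1mx. Qed.

Lemma pair_form_skew : pair_form^T = - pair_form.
Proof.
rewrite /pair_form trmx_mul skw mulNmx; congr (- _).
have VDt : D^T *m V^T = 1%:M by rewrite -trmx_mul VD trmx1.
by rewrite -[LHS]mul1mx -VD -mulmxA (mulmxA D) -adj_D -(mulmxA w) VDt mulmx1.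
Qed.

Lemma pair_form_left : A *m pair_form = pair_form *m A^T.
Proof.
rewrite /pair_form -[RHS]mulmxA adj_left mulmxN (mulmxA V) inv_sub_complexr.
by rewrite mulNmx opprK -mulmxA.
Qed.

Lemma pair_form_right : B *m pair_form = pair_form *m B^T.
Proof.
rewrite /pair_form -[RHS]mulmxA adj_right mulmxN (mulmxA V) inv_sub_complexl.
by rewrite mulNmx opprK -mulmxA.
Qed.

Lemma pair_form_unit : pair_form \in unitmx.
Proof. by rewrite /pair_form unitmx_mul unitmx_inv uD. Qed.

Lemma invmx_pair_form : invmx pair_form = invmx w *m D.
Proof. by rewrite /pair_form invmx_mul ?unitmx_inv // invmxK. Qed.

Hypothesis two : (2 : F) != 0.
Let r := 2^-1 *: (1%:M - i *: A).
Let r' := 2^-1 *: (1%:M - i *: B).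

(** Moving [r^T] across [invmx w] turns it into (1 + iB)/2, and next to [r] the identity equals -
    iA. So the factor - i (1 + iB)/2 becomes - (A - B)/2. *)
Lemma biv_pair_form :
  (- i) *: (r^T *m invmx w *m r) = (- 2^-1) *: (invmx pair_form *m r).
Proof.
have rA : A *m r = i *: r.
  rewrite /r -scalemxAr mulmxBr mulmx1 -scalemxAr AA scalerA mulrC -scalerA.
  by congr (_ *: _); rewrite scalerBr scalerA ii; mxring.
have AP : A^T *m invmx w = - (invmx w *m B).
  by rewrite BE mulmxN opprK -mulmxA mulKmx.
have rP : r^T *m invmx w = 2^-1 *: (invmx w *m (1%:M + i *: B)).
  rewrite /r linearZ /= linearB /= trmx1 linearZ /= -scalemxAl mulmxBl mul1mx -scalemxAl.
  by rewrite AP mulmxDr mulmx1 -scalemxAr scalerN opprK.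
rewrite invmx_pair_form; exact: biv_pair_form_aux ii rA rP.
Qed.

Lemma pair_form_sub : pair_form *m r^T - pair_form *m r'^T = (- (2^-1 * i)) *: w.
Proof.
rewrite -mulmxBr -linearB /=.
have -> : r - r' = (- (2^-1 * i)) *: D by rewrite /r /r' /D; mxring.
by rewrite linearZ /= -scalemxAr pair_form_D.
Qed.

(** Over a sum Z = X + Y of vectors of the two T10, L1 carries the covector i (X - Y) w. Written as
    a two-form applied to Z, it exhibits L1 as a graph. *)
Lemma split_form (Z : 'rV[F]_n) : i *: ((split_left Z - split_right Z) *m w) =
  Z *m ((-2) *: (pair_form + (2^-1 * i) *: ((A + B) *m pair_form))).
Proof.
rewrite /split_left /split_right -mulmxBl -mulmxBr -mulmxA -/pair_form.
rewrite -mulmxA scalemxAr; congr (_ *m _).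
have -> : i *: 1%:M - B - (A - i *: 1%:M) = (2 * i) *: 1%:M - (A + B) by mxring.
rewrite -mulmxA -/pair_form mulmxBl -scalemxAl mul1mx scalerBr scalerA mulrCA ii.
move: ((A + B) *m pair_form) => X; move: pair_form => Y.
by apply/matrixP => a b; rewrite !(addmxE, oppmxE, scalemxE); field.
Qed.

End Form.
End ComplexPair.

Lemma cyc3_comb (F : fieldType) m (c1 c2 : F) (D1 D2 : 'rV[F]_m -> 'M[F]_m) a b c :
  cyc3 (fun a => c1 *: D1 a + c2 *: D2 a) a b c =
  c1 *: cyc3 D1 a b c + c2 *: cyc3 D2 a b c.
Proof.
rewrite /cyc3 !mulmxDr !mulmxDl -!scalemxAr -!scalemxAl.
by mxring.
Qed.

Lemma comb_eq0 (F : fieldType) a b (c1 c2 : F) (A B : 'M[F]_(a, b)) :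
  A = 0 -> B = 0 -> c1 *: A + c2 *: B = 0.
Proof. by move=> -> ->; rewrite !scaler0 addr0. Qed.

Lemma row_dual_eq0 (F : fieldType) m (Z : 'rV[F]_m) :
  (forall t : 'rV[F]_m, (Z *m t^T) 0 0 = 0) -> Z = 0.
Proof.
move=> Z0; apply/rowP => j; have := Z0 (delta_mx 0 j).
by rewrite trmx_delta -colE mxE => ->; rewrite mxE.
Qed.

Lemma cyc3_conj (R : realType) m (D : 'rV[R[i]]_m -> 'M[R[i]]_m) a b c :
  cyc3 (fun a => conj_mx (D (conj_mx a))) a b c =
  conj_mx (cyc3 D (conj_mx a) (conj_mx b) (conj_mx c)).
Proof.
rewrite /cyc3 !conj_mxD; congr (_ + _ + _);
  by rewrite 2!conj_mxM !conj_mx_tr !conj_mxK.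
Qed.

Lemma sum_row_mx (F : fieldType) n r (W : 'M[F]_n) (A : 'M[F]_(r, n)) (a : 'I_r -> F) :
  \sum_i a i *: row_mx (delta_mx 0 i *m A) (delta_mx 0 i *m A *m W) =
  row_mx ((\row_i a i) *m A) ((\row_i a i) *m A *m W).
Proof.
have E (B : 'M[F]_(r, n)) : \sum_i a i *: (delta_mx 0 i *m B) = (\row_i a i) *m B.
  rewrite [X in _ = X *m B](row_sum_delta (\row_i a i)) mulmx_suml.
  by apply: eq_bigr => i _; rewrite mxE scalemxAl.
have S (f g : 'I_r -> 'rV[F]_n) : \sum_i row_mx (f i) (g i) = row_mx (\sum_i f i) (\sum_i g i).
  elim: (index_enum _) => [|i s IH]; first by rewrite !big_nil row_mx0.
  by rewrite !big_cons IH add_row_mx.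
under eq_bigr do rewrite scale_row_mx -(mulmxA _ A W).
by rewrite S !E mulmxA.
Qed.

Lemma graph_frame (F : fieldType) n (A B W : 'M[F]_n) : B *m A = 1%:M ->
  let e i := row_mx (delta_mx 0 i *m A) (delta_mx 0 i *m A *m W) in
  (forall u : 'rV[F]_(n + n), (exists Z : 'rV[F]_n, u = row_mx Z (Z *m W)) <->
    exists a : 'I_n -> F, u = \sum_i a i *: e i) /\
  (forall a : 'I_n -> F, \sum_i a i *: e i = 0 -> forall i, a i = 0).
Proof.
move=> BA e; split=> [u|a].
  split=> [[Z ->]|[a ->]]; last by rewrite sum_row_mx; eexists.
  exists (fun i => (Z *m B) 0 i); rewrite sum_row_mx.
  have -> : \row_i (Z *m B) 0 i = Z *m B by apply/rowP => i; rewrite mxE.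
  by rewrite -(mulmxA Z) BA mulmx1.
rewrite sum_row_mx => /eqP; rewrite -row_mx0 => /eqP/eq_row_mx[aA _] i.
have := congr1 (fun Z => Z *m B) aA.
by rewrite mul0mx -mulmxA (mulmx1C BA) mulmx1 => /rowP/(_ i); rewrite !mxE.
Qed.

(** * Graphs of two-forms as generalized almost complex structures *)

Section Forms.
Variables (R : realType) (n : nat) (M : manifold R n).
Local Notation C := R[i].
Implicit Types (x y : M) (W : M -> 'M[C]_n).
Opaque chart_jac loc_vec loc_cov loc_end loc_form loc_biv dmx jdiff djac lie lie_biv.

Lemma loc_form_comb x (c1 c2 : C) W1 W2 q :
  loc_form x (fun y => c1 *: W1 y + c2 *: W2 y) q =
  c1 *: loc_form x W1 q + c2 *: loc_form x W2 q.
Proof.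
rewrite (loc_formD x q (fun y => c1 *: W1 y) (fun y => c2 *: W2 y)).
by rewrite (loc_formZ x q c1) (loc_formZ x q c2).
Qed.

Lemma smooth_form_comb (c1 c2 : C) W1 W2 : smooth_form W1 -> smooth_form W2 ->
  smooth_form (fun y => c1 *: W1 y + c2 *: W2 y).
Proof.
move=> s1 s2 x.
apply: smooth_near_ext (smooth_nearD (smooth_nearZ c1 (s1 x)) (smooth_nearZ c2 (s2 x))).
by apply: near_codI => q _; rewrite loc_form_comb.
Qed.

Lemma smooth_form_conj W : smooth_form W -> smooth_form (fun y => conj_mx (W y)).
Proof.
move=> sW x; apply: smooth_near_ext (smooth_near_conj (sW x)).
by apply: near_codI => q _; rewrite loc_form_conj.
Qed.

Lemma closed_at_comb x (c1 c2 : C) W1 W2 : smooth_form W1 -> smooth_form W2 ->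
  closed_at x W1 -> closed_at x W2 -> closed_at x (fun y => c1 *: W1 y + c2 *: W2 y).
Proof.
move=> s1 s2 cl1 cl2 a b c.
have d1 := smooth_near_jdiff (s1 x); have d2 := smooth_near_jdiff (s2 x).
have E : dmx (loc_form x (fun y => c1 *: W1 y + c2 *: W2 y)) (coord x x) =
    (fun X => c1 *: dmx (loc_form x W1) (coord x x) X + c2 *: dmx (loc_form x W2) (coord x x) X).
  apply/funext => X; rewrite -(dmxZ c1 X d1) -(dmxZ c2 X d2).
  rewrite -(dmxD X (jdiffZ c1 d1) (jdiffZ c2 d2)).
  by apply: dmx_ext; apply: near_codI => q _; apply: loc_form_comb.
apply: etrans (congr1 (fun D => cyc3 D a b c) E) _.
apply: etrans (cyc3_comb c1 c2 _ _ a b c) _.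
exact: comb_eq0 (cl1 a b c) (cl2 a b c).
Qed.

Lemma closed_at_conj x W : smooth_form W -> closed_at x W ->
  closed_at x (fun y => conj_mx (W y)).
Proof.
move=> sW cl a b c; have dW := smooth_near_jdiff (sW x).
have E : dmx (loc_form x (fun y => conj_mx (W y))) (coord x x) =
    (fun X => conj_mx (dmx (loc_form x W) (coord x x) (conj_mx X))).
  apply/funext => X; rewrite -(dmx_conj X dW).
  by apply: dmx_ext; apply: near_codI => q _; apply: loc_form_conj.
apply: etrans (congr1 (fun D => cyc3 D a b c) E) _.
apply: etrans (cyc3_conj _ a b c) _.
exact: etrans (congr1 (@conj_mx R _ _) (cl (conj_mx a) (conj_mx b) (conj_mx c))) (conj_mx0 _ _ _).
Qed.

Lemma closed_at_ext x W1 W2 : W1 =1 W2 -> closed_at x W1 -> closed_at x W2.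
Proof. by move=> /funext ->. Qed.

(** For maximality, the pairing of X + a with all the elements t + W(t) of the graph gives (a -
    W(X))(t) = 0 for every t. *)
Lemma maximal_isotropic_graph W x : (W x)^T = - W x -> maximal_isotropic (graph W x).
Proof.
move=> skW; split.
- split; first by exists 0; rewrite mul0mx row_mx0.
  move=> a _ _ [Z ->] [T ->]; exists (a *: Z + T).
  by rewrite scale_row_mx add_row_mx mulmxDl scalemxAl.
- move=> _ _ [Z ->] [T ->]; rewrite /pairing !row_mxKl !row_mxKr /ev.
  by rewrite [Z *m _ *m _]tr_bil skW mulmxN mulNmx mxE addNr mulr0.
- move=> L' _ iL' LL' u L'u; apply/graphP/subr0_eq/row_dual_eq0 => t.
  have := iL' u (row_mx t (t *m W x)) L'u (LL' _ (ex_intro _ t erefl)).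
  rewrite /pairing !row_mxKl !row_mxKr /ev => /eqP.
  rewrite mulf_eq0 invr_eq0 (negPf (two_neq0 _)) /= => /eqP <-.
  by rewrite [t *m _ *m _]tr_bil skW mulmxN mulNmx mulmxBl addmxE.
Qed.

Lemma graph_cap_conj W x : W x - conj_mx (W x) \in unitmx ->
  graph W x `&` (@conj_mx R _ _ @` graph W x) = [set 0].
Proof.
move=> uW; apply/seteqP; split=> [u [/graphP uE [_ [T ->] Tu]]|_ ->]; last first.
  split; first by exists 0; rewrite mul0mx row_mx0.
  by exists 0; [exists 0; rewrite mul0mx row_mx0|rewrite conj_mx0].
have cu : u = row_mx (conj_mx T) (conj_mx T *m conj_mx (W x)).
  by rewrite -Tu /conj_mx map_row_mx -map_mxM.
move: uE; rewrite cu row_mxKl row_mxKr => /eqP; rewrite eq_sym -subr_eq0 -mulmxBr.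
move=> /eqP/(congr1 (fun Z => Z *m invmx (W x - conj_mx (W x)))).
by rewrite mulmxK // mul0mx => ->; rewrite mul0mx row_mx0.
Qed.

Lemma subbundle_graph W : smooth_form W -> subbundle (graph W).
Proof.
move=> sW; exists n => x.
pose U i := unloc_vec x (fun=> delta_mx 0 i).
exists (fun i y => row_mx (U i y) (U i y *m W y)); split=> [i|].
  by apply: smooth_gen_graph => //; apply: unloc_vec_smooth; apply: smooth_near_cst.
apply: filterS (near_ddom x) => y xy.
have := jacbf (cod_coord xy); rewrite /jacb /jacf (pointK xy) => BA.
exact: graph_frame (W y) BA.
Qed.

Lemma generalized_almost_complex_graph W : smooth_form W ->
  (forall x, (W x)^T = - W x) -> (forall x, W x - conj_mx (W x) \in unitmx) ->
  generalized_almost_complex (graph W).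
Proof.
move=> sW skW uW; split; first exact: subbundle_graph.
  by move=> x; apply: maximal_isotropic_graph.
by move=> x; apply: graph_cap_conj.
Qed.

End Forms.

(** * Pointwise algebra of the generalized structures and positivity *)

Section PointwiseAlgebra.
Variables (F : fieldType) (n : nat).

Lemma unitmx_inj (A : 'M[F]_n) : (forall v : 'rV[F]_n, v *m A = 0 -> v = 0) -> A \in unitmx.
Proof. by move=> A0; rewrite -row_free_unit; apply: inj_row_free. Qed.

Lemma half_sum (A B : 'M[F]_n) : (2 : F) != 0 ->
  2^-1 *: (A - B) + 2^-1 *: (A + B) = A.
Proof.
move=> two; apply/matrixP => i j; rewrite !(addmxE, oppmxE, scalemxE).
by field; rewrite two.
Qed.

Lemma half_diff (A B : 'M[F]_n) : (2 : F) != 0 ->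
  2^-1 *: (A - B) - 2^-1 *: (A + B) = - B.
Proof.
move=> two; apply/matrixP => i j; rewrite !(addmxE, oppmxE, scalemxE).
by field; rewrite two.
Qed.

Section Block.
Variables (E G J K : 'M[F]_n).
Let Q : 'M[F]_(n + n) := block_mx 1%:M E 1%:M G.
Let D : 'M[F]_(n + n) := block_mx J 0 0 K.
Hypothesis uQ : Q \in unitmx.

Lemma row_block (X Y : 'rV[F]_n) : row_mx X Y *m Q = row_mx (X + Y) (X *m E + Y *m G).
Proof. by rewrite /Q mul_row_block !mulmx1. Qed.

(** [Q] sends (X, Y) to the element of the graph of [E] over X plus the element of the graph of [G]
    over Y. Conjugating diag(J, K) by it gives an endomorphism whose eigenspace is a sum of graphs
    over eigenspaces, the shape of L1 and L2. *)
Lemma eigen_block i (u : 'rV[F]_(n + n)) :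
  u *m (invmx Q *m D *m Q) = i *: u <->
  exists X Y : 'rV[F]_n, [/\ X *m J = i *: X, Y *m K = i *: Y
    & u = row_mx (X + Y) (X *m E + Y *m G)].
Proof.
split=> [uE|[X [Y [XJ YK ->]]]].
  pose z := u *m invmx Q; have zE : z *m D = i *: z.
    have := congr1 (fun t => t *m invmx Q) uE.
    by rewrite !mulmxA mulmxK // -scalemxAl.
  exists (lsubmx z), (rsubmx z).
  move: zE; rewrite -{1 2}[z]hsubmxK /D mul_row_block !mulmx0 add0r addr0 scale_row_mx.
  move=> /eq_row_mx[zl zr]; split=> //.
  by rewrite -row_block hsubmxK /z mulmxKV.
rewrite -row_block !mulmxA mulmxK // /D mul_row_block !mulmx0 add0r addr0 XJ YK.
by rewrite -scale_row_mx -scalemxAl.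
Qed.

Lemma conj_block_mul (D1 D2 : 'M[F]_(n + n)) :
  (invmx Q *m D1 *m Q) *m (invmx Q *m D2 *m Q) = invmx Q *m (D1 *m D2) *m Q.
Proof. by rewrite !mulmxA mulmxK. Qed.

End Block.

(* the graph of the (2,0)-form dual to the (2,0)-bivector k (r^T w^-1 r) *)
Lemma push_graph (i : F) (w r : 'M[F]_n) (X a : 'rV[F]_n) : i * i = -1 ->
  w \in unitmx -> a *m r^T = a -> a *m r^T = X *m (i *: w) ->
  X *m r = a *m ((- i) *: (r^T *m invmx w *m r)).
Proof.
move=> ii uw ar aX; rewrite -scalemxAr !mulmxA aX -scalemxAr -!scalemxAl mulmxK //.
by rewrite scalerA mulNr ii opprK scale1r.
Qed.

Lemma graph_push (i : F) (w r : 'M[F]_n) (a : 'rV[F]_n) : i * i = -1 ->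
  w \in unitmx -> a *m r^T = a ->
  let X := (- i) *: (a *m invmx w) in
  a *m r^T = X *m (i *: w) /\ X *m r = a *m ((- i) *: (r^T *m invmx w *m r)).
Proof.
move=> ii uw ar X; have E : a *m r^T = X *m (i *: w).
  rewrite ar /X -scalemxAr -scalemxAl mulmxKV // scalerA mulrN ii opprK.
  by rewrite scale1r.
by split=> //; apply: push_graph.
Qed.

End PointwiseAlgebra.

Section Positive.
Variables (R : realType) (n : nat) (E : 'M[R]_n).
Hypothesis pos : forall X : 'rV[R]_n, X != 0 -> 0 < ev (X *m E) X.

Lemma ev_tr (X : 'rV[R]_n) : ev (X *m E^T) X = ev (X *m E) X.
Proof. by rewrite /ev [X *m E^T *m _]tr_bil trmxK. Qed.

Lemma pos_ge0 (X : 'rV[R]_n) : 0 <= ev (X *m E) X.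
Proof.
have [->|/pos/ltW//] := eqVneq X 0.
by rewrite /ev !mul0mx mxE.
Qed.

Lemma pos_eq0 (X : 'rV[R]_n) : ev (X *m E) X = 0 -> X = 0.
Proof.
by move=> X0; apply/eqP/negP => /negP/pos; rewrite X0 ltxx.
Qed.

Let Q : 'M[R]_(n + n) := block_mx 1%:M E 1%:M (- E^T).

(** A kernel vector has the form (X, - X) with X (E + E^T) = 0, and the quadratic form of [E] is
    definite. *)
Lemma tame_block_unit : Q \in unitmx.
Proof.
apply: unitmx_inj => v; rewrite -[v]hsubmxK row_block -[0]row_mx0.
move: (lsubmx v) (rsubmx v) => X Y /eq_row_mx[/eqP XY].
have -> : Y = - X by apply/eqP; rewrite -addr_eq0 addrC.
rewrite mulmxN mulNmx opprK => H.
suff -> : X = 0 by rewrite oppr0.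
apply: pos_eq0; have := congr1 (fun Z => ev Z X) H.
have evD (A B : 'rV[R]_n) : ev (A + B) X = ev A X + ev B X by rewrite /ev mulmxDl mxE.
rewrite evD ev_tr => /eqP; rewrite -mulr2n.
have -> : ev (0 : 'rV[R]_n) X = 0 by rewrite /ev mul0mx mxE.
by rewrite mulrn_eq0 /= => /eqP.
Qed.

(** The graphs of [E] and [- E^T] are orthogonal for the pairing, which restricts to the quadratic
    form of [E] on the first and to its opposite on the second. *)
Lemma pairing_block (X Y : 'rV[R]_n) :
  pairing (row_mx (- X) Y *m Q) (row_mx X Y *m Q) = - (ev (X *m E) X + ev (Y *m E) Y).
Proof.
rewrite !row_block /pairing !row_mxKl !row_mxKr -(ev_tr Y) /ev.
have trN : (- X)^T = - X^T by rewrite linearN.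
rewrite !linearD /= trN !(mulmxDr, mulmxDl, mulmxN, mulNmx).
rewrite [Y *m E^T *m X^T]tr_bil trmxK.
rewrite !(addmxE, oppmxE).
move: ((X *m E *m X^T) 0 0) ((X *m E *m Y^T) 0 0) ((Y *m E^T *m Y^T) 0 0) => a b c.
by field.
Qed.

End Positive.

Lemma twice_unit_eq0 (F : fieldType) m (X : 'rV[F]_m) (A : 'M[F]_m) :
  A \in unitmx -> (2 : F) != 0 -> - (X *m A) = X *m A -> X = 0.
Proof.
move=> uA two XA; have : 2 *: (X *m A) = 0.
  by rewrite scaler_nat mulr2n -{1}XA addNr.
move/eqP; rewrite scaler_eq0 (negPf two) /= => /eqP/(congr1 (mulmx^~ (invmx A))).
by rewrite mulmxK // mul0mx.
Qed.

Lemma conj_Ni (R : realType) : conjc (- 'i%C : R[i]) = 'i%C.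
Proof. by congr Complex; rewrite /= ?oppr0 ?opprK. Qed.

Lemma conj_row_mx (R : realType) a b c (A : 'M[R[i]]_(a, b)) (B : 'M[R[i]]_(a, c)) :
  conj_mx (row_mx A B) = row_mx (conj_mx A) (conj_mx B).
Proof. exact: map_row_mx. Qed.

Lemma conj_opp1 (F : fieldType) m (Q : 'M[F]_(m + m)) : Q \in unitmx ->
  invmx Q *m block_mx (- 1%:M) 0 0 (- 1%:M) *m Q = - 1%:M.
Proof.
move=> uQ; have -> : block_mx (- 1%:M) 0 0 (- 1%:M) = - 1%:M :> 'M[F]_(m + m).
  by rewrite scalar_mx_block opp_block_mx !oppr0.
by rewrite mulmxN mulmx1 mulNmx mulVmx.
Qed.

Lemma cplx_block1 (R : realType) m (E G : 'M[R]_m) :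
  cplx (block_mx 1%:M E 1%:M G) = block_mx 1%:M (cplx E) 1%:M (cplx G).
Proof. by rewrite /cplx map_block_mx map_mx1. Qed.

Lemma cplx_conj_block (R : realType) m (E G J K : 'M[R]_m) :
  cplx (invmx (block_mx 1%:M E 1%:M G) *m block_mx J 0 0 K *m block_mx 1%:M E 1%:M G) =
  invmx (block_mx 1%:M (cplx E) 1%:M (cplx G)) *m block_mx (cplx J) 0 0 (cplx K)
    *m block_mx 1%:M (cplx E) 1%:M (cplx G).
Proof.
have cD : cplx (block_mx J 0 0 K) = block_mx (cplx J) 0 0 (cplx K).
  by rewrite /cplx map_block_mx !map_mx0.
by rewrite 2!cplxM cplx_inv cD cplx_block1.
Qed.

(** * The bundles L1 and L2 of a tamed almost symplectic manifold *)

Section Tamed.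
Variables (R : realType) (n : nat) (M : manifold R n).
Local Notation C := R[i].
Opaque chart_jac loc_vec loc_cov loc_end loc_form loc_biv dmx jdiff djac lie lie_biv.
Implicit Types (x y : M).
Variables (eps J : M -> 'M[R]_n).
Hypothesis tame : tamed_almost_symplectic eps J.

Let J' := Jminus eps J.
Let w y := cplx (eps y).
Let E y := J y *m eps y.

Lemma tamed_smooth : smooth_form (fun x => cplx (eps x)).
Proof. by case: tame. Qed.
Lemma tamed_skew x : (eps x)^T = - eps x. Proof. by case: tame. Qed.
Lemma tamed_unit x : eps x \in unitmx. Proof. by case: tame. Qed.
Lemma tamed_complex : almost_complex J. Proof. by case: tame. Qed.
Lemma tamed_pos x (X : 'rV[R]_n) : X != 0 -> 0 < ev (X *m E x) X.
Proof. by case: tame => _ _ _ _ pos X0; rewrite mulmxA; apply: pos. Qed.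

Let JJ x : J x *m J x = - 1%:M. Proof. exact: tamed_complex.2. Qed.
Let JJ' x : J' x *m J' x = - 1%:M.
Proof. exact: (Jminus_sqr tamed_unit tamed_complex). Qed.
Let JJc x := cplx_sqrN1 (JJ x).
Let JJc' x := cplx_sqrN1 (JJ' x).
Let uw x : w x \in unitmx. Proof. exact: unit_w tamed_unit x. Qed.

(** This is the symmetry between J+ and J-: b + g is J+ eps and b - g is - J- eps, and [Jminus]
    becomes an involution. *)
Lemma Jminus_eps x : J' x *m eps x = (E x)^T.
Proof.
rewrite /J' /Jminus /E mulNmx mulmxKV ?tamed_unit //.
by rewrite trmx_mul tamed_skew mulNmx.
Qed.

Lemma Jminus_Jminus : Jminus eps J' = J.
Proof.
apply/funext => x; rewrite /Jminus.
have e0 : J' x *m eps x = - (eps x *m (J x)^T).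
  by rewrite Jminus_eps trmx_mul tamed_skew mulNmx.
have := congr1 trmx e0.
rewrite linearN /= !trmx_mul trmxK tamed_skew mulmxN mulNmx opprK => e1.
have -> : eps x *m (J' x)^T = - (J x *m eps x) by rewrite -e1 opprK.
by rewrite mulNmx opprK mulmxK // tamed_unit.
Qed.

Lemma b_plus_g x : tamed_b eps J x + tamed_g eps J x = E x.
Proof. by apply: half_sum; rewrite pnatr_eq0. Qed.

Lemma b_minus_g x : tamed_b eps J x - tamed_g eps J x = - (E x)^T.
Proof. by apply: half_diff; rewrite pnatr_eq0. Qed.

(** For v in the kernel, the value of the quadratic form eps(Jv, v) equals its own opposite, which
    taming forbids unless v = 0. *)
Lemma J_plus_Jminus_unit x : J x + J' x \in unitmx.
Proof.
apply: unitmx_inj => v; rewrite mulmxDr => /eqP; rewrite addr_eq0 => /eqP vJ.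
apply: (pos_eq0 (@tamed_pos x)).
have : ev (v *m E x) v = - ev (v *m (E x)^T) v.
  by rewrite /ev -Jminus_eps !mulmxA vJ !mulNmx mxE.
rewrite ev_tr => /eqP; rewrite -subr_eq0 opprK -mulr2n mulrn_eq0 /=.
by move/eqP.
Qed.

(** On T10 of J+ the factor J of b + g = J eps acts as i. In [LminusP] the same argument gives - i
    eps. *)
Lemma LplusP y u : Lplus (tamed_g eps J) (tamed_b eps J) J y u <->
  exists2 X, T10 J y X & u = row_mx X (X *m ('i%C *: w y)).
Proof.
have H X : T10 J y X -> X *m cplx (tamed_b eps J y + tamed_g eps J y) = X *m ('i%C *: w y).
  by move=> XJ; rewrite b_plus_g /E cplxM mulmxA XJ -scalemxAl -scalemxAr.
by split=> -[X XJ ->]; exists X; [exact: XJ|rewrite (H X XJ)|exact: XJ|rewrite (H X XJ)].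
Qed.

Lemma LminusP y u : Lminus (tamed_g eps J) (tamed_b eps J) J' y u <->
  exists2 Y, T10 J' y Y & u = row_mx Y (Y *m ((- 'i%C) *: w y)).
Proof.
have H X : T10 J' y X -> X *m cplx (tamed_b eps J y - tamed_g eps J y) = X *m ((- 'i%C) *: w y).
  move=> XJ; rewrite b_minus_g -Jminus_eps cplxN cplxM mulmxN mulmxA XJ.
  by rewrite -scalemxAl scaleNr mulmxN -scalemxAr.
by split=> -[X XJ ->]; exists X; [exact: XJ|rewrite (H X XJ)|exact: XJ|rewrite (H X XJ)].
Qed.

(** A component Y of the vector in T10 of J- would carry both i eps(Y) and - i eps(Y), so it
    vanishes. *)
Lemma tamed_L1_T10 y Z : tamed_L1 eps J y (row_mx Z (Z *m ('i%C *: w y))) <-> T10 J y Z.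
Proof.
split=> [[_ [_ [/LplusP[X XJ ->] /LminusP[Y YJ ->]]]]|ZJ]; last first.
  exists (row_mx Z (Z *m ('i%C *: w y))), 0; split; last by rewrite addr0.
    by apply/LplusP; exists Z.
  apply/LminusP; exists 0; last by rewrite mul0mx row_mx0.
  by rewrite /T10 /= mul0mx scaler0.
rewrite add_row_mx => /eq_row_mx[ZE]; rewrite ZE mulmxDl => /addrI.
rewrite scaleNr mulmxN => YE; have Y0 : Y = 0.
  apply: (twice_unit_eq0 _ (two_neq0 R) (esym YE)).
  by rewrite unitmxZ ?uw // unitfE im_neq0.
by rewrite Y0 addr0.
Qed.

Lemma tamed_L1_T10minus y Z :
  tamed_L1 eps J y (row_mx Z (Z *m ((- 'i%C) *: w y))) <-> T10 J' y Z.
Proof.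
split=> [[_ [_ [/LplusP[X XJ ->] /LminusP[Y YJ ->]]]]|ZJ]; last first.
  exists 0, (row_mx Z (Z *m ((- 'i%C) *: w y))); split; last by rewrite add0r.
    apply/LplusP; exists 0; last by rewrite mul0mx row_mx0.
    by rewrite /T10 /= mul0mx scaler0.
  by apply/LminusP; exists Z.
rewrite add_row_mx => /eq_row_mx[ZE]; rewrite ZE mulmxDl => /addIr.
rewrite scaleNr mulmxN => XE; have X0 : X = 0.
  apply: (twice_unit_eq0 _ (two_neq0 R) XE).
  by rewrite unitmxZ ?uw // unitfE im_neq0.
by rewrite X0 add0r.
Qed.

Let cw y : conj_mx (w y) = w y. Proof. exact: conj_cplx. Qed.

Lemma tamed_L2E : tamed_L2 eps J = graph (fun y => 'i%C *: w y).
Proof.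
apply/funext => y; apply/seteqP; split=> [u [_ [_ [/LplusP[X XJ ->] /LminusP[Y YJ ->] ->]]]|u [Z ->]].
  exists (X + conj_mx Y); rewrite conj_row_mx.
  rewrite conj_mxM conj_mxZ cw conj_Ni.
  by rewrite add_row_mx mulmxDl.
(* The conjugate of L- lies over T01 of J-, the i-eigenspace of - J-. The splitting is thus that of
   the pair (J+, - J-), whose difference J+ + J- is invertible by taming. *)
have BB : - cplx (J' y) *m - cplx (J' y) = - 1%:M by rewrite mulmxN mulNmx opprK.
have uS : cplx (J y) - - cplx (J' y) \in unitmx.
  by rewrite opprK -cplxD cplx_unit J_plus_Jminus_unit.
have XJ := split_leftE (im_sqr R) (JJc y) BB uS Z.
have YJ := split_rightE (im_sqr R) (JJc y) BB uS Z.
have ZE := split_sum 'i%C uS Z.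
move: (split_left _ _ _ _) (split_right _ _ _ _) XJ YJ ZE => X Y XJ YJ ZE.
exists (row_mx X (X *m ('i%C *: w y))), (row_mx (conj_mx Y) (conj_mx Y *m ((- 'i%C) *: w y))).
split; first by apply/LplusP; exists X.
  apply/LminusP; exists (conj_mx Y) => //; apply/T01_conj.
  apply/(T01J (JJ' y)); rewrite -YJ mulmxN opprK; by [].
rewrite conj_row_mx conj_mxM conj_mxK conj_mxZ cw.
by rewrite conj_Ni add_row_mx -mulmxDl ZE.
Qed.

Lemma rho_push_graph (J0 : M -> 'M[R]_n) x : J0 x *m J0 x = - 1%:M ->
  rho_push J0 (graph (fun y => 'i%C *: w y)) x = graph10 J0 (biv10 eps J0) x.
Proof.
move=> JJ0; apply/seteqP; split=> [u [X [a [/(T10dualP JJ0) ar [Z ZE] ->]]]|u [a /(T10dualP JJ0) ar ->]].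
  have [XZ aZ] := eq_row_mx ZE.
  exists a; first exact/(T10dualP JJ0).
  by rewrite /biv10 -(push_graph (im_sqr R) (uw x) ar (etrans aZ (congr1 (mulmx^~ _) (esym XZ)))).
have [aX Xa] := graph_push (im_sqr R) (uw x) ar.
exists ((- 'i%C) *: (a *m invmx (w x))), a; split; first exact/(T10dualP JJ0).
  by eexists; rewrite aX.
by rewrite Xa.
Qed.

(* complex structures of the generalized almost Kaehler structure, acting by
   (J, J') and (J, -J') on the graphs of b + g and b - g *)
Let Q x : 'M[R]_(n + n) := block_mx 1%:M (E x) 1%:M (- (E x)^T).
Definition gak_endo (K : 'M[R]_n) x : 'M[R]_(n + n) :=
  invmx (Q x) *m block_mx (J x) 0 0 K *m Q x.

Let uQ x : Q x \in unitmx. Proof. exact: tame_block_unit (@tamed_pos x). Qed.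

Lemma gak_endo_eigen K x u : u *m cplx (gak_endo K x) = 'i%C *: u <->
  exists X Y : 'rV[C]_n, [/\ X *m cplx (J x) = 'i%C *: X, Y *m cplx K = 'i%C *: Y
    & u = row_mx (X + Y) (X *m cplx (E x) + Y *m cplx (- (E x)^T))].
Proof.
have uc := uQ x; rewrite -cplx_unit cplx_block1 in uc.
have cA := cplx_conj_block (E x) (- (E x)^T) (J x) K.
apply: iff_trans _ (eigen_block _ _ uc _ _).
by rewrite -cA.
Qed.

Lemma tamed_L1_endo x : endo_of (tamed_L1 eps J x) (gak_endo (J' x) x).
Proof.
split.
  rewrite /gak_endo (conj_block_mul (uQ x)) mulmx_block !mulmx0 !mul0mx !addr0 !add0r.
  by rewrite JJ JJ'; apply: conj_opp1 (uQ x).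
apply/seteqP; split=> u.
  move=> [_ [_ [[X XJ ->] [Y YJ ->] ->]]]; apply/gak_endo_eigen; exists X, Y; split=> //.
  by rewrite add_row_mx b_plus_g b_minus_g.
move=> /gak_endo_eigen[X [Y [XJ YJ ->]]].
exists (row_mx X (X *m cplx (E x))), (row_mx Y (Y *m cplx (- (E x)^T))); split.
- by exists X => //; rewrite b_plus_g.
- by exists Y => //; rewrite b_minus_g.
- by rewrite add_row_mx.
Qed.

Lemma tamed_L2_endo x : endo_of (tamed_L2 eps J x) (gak_endo (- J' x) x).
Proof.
split.
  rewrite /gak_endo (conj_block_mul (uQ x)) mulmx_block !mulmx0 !mul0mx !addr0 !add0r.
  by rewrite (mulmxN (- J' x) (J' x)) (mulNmx (J' x) (J' x)) opprK JJ JJ'; apply: conj_opp1 (uQ x).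
apply/seteqP; split=> u.
  move=> [_ [_ [[X XJ ->] [Y YJ ->] ->]]]; apply/gak_endo_eigen.
  exists X, (conj_mx Y); split=> //.
    have /T01_conj/(T01J (JJ' x)) : T10 J' x (conj_mx (conj_mx Y)) by rewrite conj_mxK.
    by rewrite cplxN mulmxN => ->; rewrite opprK.
  by rewrite conj_row_mx conj_mxM conj_cplx add_row_mx b_plus_g b_minus_g.
move=> /gak_endo_eigen[X [Y [XJ YJ ->]]].
exists (row_mx X (X *m cplx (E x))), (row_mx (conj_mx Y) (conj_mx Y *m cplx (- (E x)^T))); split.
- by exists X => //; rewrite b_plus_g.
- exists (conj_mx Y); last by rewrite b_minus_g.
  by apply/T01_conj/(T01J (JJ' x)); rewrite -YJ cplxN mulmxN opprK.
- by rewrite conj_row_mx conj_mxM conj_mxK conj_cplx add_row_mx.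
Qed.

Lemma gak_endo_compatible x : exists A1 A2 : 'M[R]_(n + n),
  [/\ endo_of (tamed_L1 eps J x) A1, endo_of (tamed_L2 eps J x) A2, A1 *m A2 = A2 *m A1 &
      forall v : 'rV[R]_(n + n), v != 0 -> pairing (v *m A2 *m A1) v < 0].
Proof.
exists (gak_endo (J' x) x), (gak_endo (- J' x) x); split.
- exact: tamed_L1_endo.
- exact: tamed_L2_endo.
- rewrite /gak_endo !(conj_block_mul (uQ x)) !mulmx_block !mulmx0 !mul0mx !addr0 !add0r.
  by rewrite (mulmxN (J' x) (J' x)) (mulNmx (J' x) (J' x)).
(* The product is conjugate to diag(-1, 1), since J and J' both square to -1 and one of the two J'
   carries a sign. By [pairing_block] the form is then minus a sum of two values of the metric. *)
move=> v v0; rewrite -mulmxA /gak_endo (conj_block_mul (uQ x)) mulmx_block.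
rewrite !mulmx0 !mul0mx !addr0 !add0r (mulNmx (J' x) (J' x)) JJ JJ' opprK.
pose X := lsubmx (v *m invmx (Q x)); pose Y := rsubmx (v *m invmx (Q x)).
have vE : v = row_mx X Y *m Q x by rewrite hsubmxK mulmxKV.
have -> : v *m (invmx (Q x) *m block_mx (- 1%:M) 0 0 1%:M *m Q x) = row_mx (- X) Y *m Q x.
  rewrite !mulmxA -[v *m invmx _]hsubmxK mul_row_block !mulmx0 addr0 add0r.
  by rewrite mulmxN !mulmx1.
rewrite {1}vE pairing_block oppr_lt0.
have [X0|X0] := eqVneq X 0; last first.
  by apply: ltr_wpDr; [apply: pos_ge0 (@tamed_pos x) _|apply: tamed_pos].
apply: ltr_wpDl; first exact: pos_ge0 (@tamed_pos x) _.
apply: tamed_pos; apply: contra v0 => /eqP Y0.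
by rewrite vE X0 Y0 row_mx0 mul0mx.
Qed.

End Tamed.

(** * Consequences of the generalized Kähler condition *)

Section GraphIntegrability.
Variables (R : realType) (n : nat) (M : manifold R n).
Local Notation C := R[i].
Opaque chart_jac loc_vec loc_cov loc_end loc_form loc_biv dmx jdiff djac lie lie_biv.
Implicit Types (x y : M).

Lemma closed_at_scale x (c : C) (W : M -> 'M[C]_n) : smooth_form W -> closed_at x W ->
  closed_at x (fun y => c *: W y).
Proof.
move=> sW cl; apply: closed_at_ext (closed_at_comb c 0 sW sW cl cl) => y.
by rewrite scale0r addr0.
Qed.

Lemma smooth_form_scale (c : C) (W : M -> 'M[C]_n) : smooth_form W ->
  smooth_form (fun y => c *: W y).
Proof.
move=> sW; have := smooth_form_comb c 0 sW sW.
by congr (smooth_form _); apply/funext => y; rewrite scale0r addr0.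
Qed.

(** As [W] is closed, the bracket of two sections of its graph over T10 lies again on the graph,
    over their Lie bracket; as it also lies in [L], the Lie bracket is in T10. *)
Lemma integrable_of_closed (J0 : M -> 'M[R]_n) (W : M -> 'M[C]_n) L :
  smooth_form W -> (forall y, (W y)^T = - W y) -> (forall x, closed_at x W) ->
  (forall y Z, L y (row_mx Z (Z *m W y)) <-> T10 J0 y Z) ->
  courant_closed L -> integrable_J J0.
Proof.
move=> sW skW cW LT cL x X Y sX sY XY.
pose S (Z : M -> 'rV[C]_n) y := row_mx (Z y) (Z y *m W y).
have vS Z : vec (S Z) = Z by apply/funext => y; apply: row_mxKl.
have sS Z : smooth_vec_at x Z -> smooth_gen_at x (S Z) by move=> sZ; apply: smooth_gen_graph.
have near_S : \forall y \near x,
    cov (S X) y = vec (S X) y *m W y /\ cov (S Y) y = vec (S Y) y *m W y.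
  by apply: nearW => y; rewrite /cov /vec !row_mxKl !row_mxKr.
have [c [E cE]] := courant_graph (sS X sX) (sS Y sY) sW skW near_S.
have : L x (courant x (S X) (S Y)).
  apply: cL (sS X sX) (sS Y sY) _.
  by apply: filterS XY => y [XT YT]; split; apply/LT.
rewrite E !vS => H; apply/LT; rewrite -[X in row_mx _ X](_ : c = _) //.
apply/subr0_eq/row_dual_eq0 => t; have := cE t; rewrite !vS => ->.
by have -> := cW x (X x) (Y x) t; rewrite mxE.
Qed.

End GraphIntegrability.

Section TamedKahler.
Variables (R : realType) (n : nat) (M : manifold R n).
Local Notation C := R[i].
Opaque chart_jac loc_vec loc_cov loc_end loc_form loc_biv dmx jdiff djac lie lie_biv.
Implicit Types (x y : M).
Variables (eps J : M -> 'M[R]_n).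
Hypothesis tame : tamed_almost_symplectic eps J.

Let J' := Jminus eps J.
Let w y := cplx (eps y).
Let sw : smooth_form w. Proof. exact: tamed_smooth tame. Qed.
Let skw x : (w x)^T = - w x. Proof. exact: skew_w (tamed_skew tame) x. Qed.
Let uw x : w x \in unitmx. Proof. exact: unit_w (tamed_unit tame) x. Qed.
Let aJ := tamed_complex tame.

Lemma skew_scale (c : C) x : (c *: w x)^T = - (c *: w x).
Proof. by rewrite linearZ /= skw scalerN. Qed.

Lemma Jminus_complex : almost_complex J'.
Proof.
split; last by move=> x; apply: (Jminus_sqr (tamed_unit tame) aJ).
move=> x; pose Jh := loc_end x (fun y => cplx (J y)); pose wh := loc_form x w.
have uwh : \forall q \near coord x x, wh q \in unitmx by apply: near_unit_w (tamed_unit tame) x.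
have H : smooth_near (coord x x) (fun q => (-1) *: (wh q *m (Jh q)^T *m invmx (wh q))).
  apply: smooth_nearZ; apply: smooth_nearM; last exact: smooth_near_inv uwh (sw x).
  by apply: smooth_nearM; [exact: sw|apply: smooth_near_tr; apply: aJ.1].
apply: smooth_near_ext H; apply: near_codI => q xq.
apply: etrans (congr1 ( *:%R (-1)) (esym (loc_end_adj xq (fun y => cplx (J y)) (uw _)))) _.
apply: etrans (esym (loc_endZ x q (-1) _)) _.
congr (loc_end x _ q); apply/funext => y; rewrite scaleN1r; symmetry.
exact: cplx_Jminus.
Qed.

Section Forward.
Hypothesis GK : generalized_Kahler (tamed_L1 eps J) (tamed_L2 eps J).

Lemma tamed_closed x : closed_at x w.
Proof.
have [_ _ [_ cL2]] := GK; rewrite (tamed_L2E tame) in cL2.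
have siw := smooth_form_scale 'i%C sw.
have cl := (courant_closed_graph siw (skew_scale 'i%C)).2 cL2 x.
apply: closed_at_ext (closed_at_scale (- 'i%C) siw cl) => y.
by rewrite scalerA mulNr im_sqr opprK scale1r.
Qed.

Lemma tamed_integrable : integrable_J J /\ integrable_J J'.
Proof.
have [_ [_ cL1] _] := GK; split.
  apply: (integrable_of_closed (smooth_form_scale 'i%C sw) (skew_scale 'i%C) _ _ cL1).
    by move=> x; apply: closed_at_scale sw (tamed_closed x).
  by move=> y Z; apply: tamed_L1_T10.
apply: (integrable_of_closed (smooth_form_scale (- 'i%C) sw) (skew_scale (- 'i%C)) _ _ cL1).
  by move=> x; apply: closed_at_scale sw (tamed_closed x).
by move=> y Z; apply: tamed_L1_T10minus.
Qed.

Lemma tamed_holomorphic_Poisson :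
  holomorphic_Poisson_biv J (biv10 eps J) /\ holomorphic_Poisson_biv J' (biv10 eps J').
Proof.
have [iJ iJ'] := tamed_integrable; split.
  exact: (holomorphic_Poisson_biv10 (tamed_skew tame) (tamed_unit tame) sw aJ tamed_closed).
apply: (holomorphic_Poisson_biv10 (tamed_skew tame) (tamed_unit tame) sw Jminus_complex tamed_closed) => //.
by rewrite /J' (Jminus_Jminus tame).
Qed.

End Forward.

Lemma rho_push_tamed (J0 : M -> 'M[R]_n) : (forall x, J0 x *m J0 x = - 1%:M) ->
  forall x, rho_push J0 (tamed_L2 eps J) x = graph10 J0 (biv10 eps J0) x.
Proof. by move=> JJ0 x; rewrite (tamed_L2E tame); apply: (rho_push_graph tame). Qed.

(** A bivector of type (2,0) is determined by its graph over the (1,0)-covectors, so the one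
    provided by the hypothesis is the explicit [biv10]. *)
Lemma holomorphic_Poisson_unique (J0 : M -> 'M[R]_n) : (forall x, J0 x *m J0 x = - 1%:M) ->
  holomorphic_Poisson J0 (rho_push J0 (tamed_L2 eps J)) ->
  holomorphic_Poisson_biv J0 (biv10 eps J0).
Proof.
move=> JJ0 [s [hP gs]]; suff -> : biv10 eps J0 = s by [].
apply/funext => x; have [[_ /(_ x)[_ ts]] _ _] := hP.
apply/row_matrixP => i; rewrite !rowE; set a := delta_mx 0 i.
have rr := rho_idem (JJ0 x).
have tb : (rho J0 x)^T *m biv10 eps J0 x = biv10 eps J0 x.
  by rewrite /biv10 -scalemxAr !mulmxA -trmx_mul rr.
have tss : (rho J0 x)^T *m s x = s x by rewrite -ts !mulmxA -trmx_mul rr.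
have aT : T10dual J0 x (a *m (rho J0 x)^T).
  by apply/(T10dualP (JJ0 x)); rewrite -mulmxA -trmx_mul rr.
have : graph10 J0 s x (row_mx (a *m (rho J0 x)^T *m s x) (a *m (rho J0 x)^T)).
  by exists (a *m (rho J0 x)^T).
rewrite -gs (rho_push_tamed JJ0) => -[a' _ /eq_row_mx[E1 E2]].
by rewrite -tb -tss !mulmxA E1 -E2.
Qed.

End TamedKahler.

Lemma conj_N2 (R : realType) : conjc (-2 : R[i]) = -2.
Proof. by apply: etrans (rmorphN (@conjc R) _) _; congr (- _); apply: conjc_nat. Qed.

Lemma conj_half_i (R : realType) : conjc (2^-1 * 'i%C : R[i]) = - (2^-1 * 'i%C).
Proof.
apply: etrans (rmorphM (@conjc R) _ _) _; rewrite -mulrN; congr (_ * _).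
  by rewrite -[RHS](congr1 GRing.inv (conjc_nat R 2)); apply: conjc_inv.
exact: conj_i.
Qed.

Section Auxiliary.
Variables (F : fieldType) (n : nat).
Implicit Types A B f r : 'M[F]_n.

Lemma scaled_commute (c i : F) A f : A *m f = f *m A^T ->
  (c *: (1%:M - i *: A)) *m f = f *m (c *: (1%:M - i *: A))^T.
Proof.
move=> Af.
have -> : (c *: (1%:M - i *: A))^T = c *: (1%:M - i *: A^T).
  by rewrite linearZ /= linearB /= trmx1 linearZ.
by rewrite -scalemxAl -scalemxAr mulmxBl mulmxBr mul1mx mulmx1 -scalemxAl -scalemxAr Af.
Qed.

Lemma scaled_inverse_eq0 (k : F) f r (a : 'rV[F]_n) : f \in unitmx ->
  r *m f = f *m r^T -> a *m r^T = a -> k != 0 ->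
  a *m (k *: (invmx f *m r)) = 0 -> a = 0.
Proof.
move=> uf rf ar k0; rewrite -scalemxAr => /eqP; rewrite scaler_eq0 (negPf k0) /= => /eqP.
have -> : invmx f *m r = r^T *m invmx f.
  by rewrite -[LHS](mulmxK uf) -(mulmxA _ r) rf mulKmx.
rewrite mulmxA ar => /(congr1 (mulmx^~ f)).
by rewrite mulmxKV // mul0mx.
Qed.

Lemma pair_form_opp A B w : A - B \in unitmx -> pair_form B A w = - pair_form A B w.
Proof.
move=> uD; rewrite /pair_form -[B - A]opprB -mulNmx; congr (_ *m w).
have uN : - (A - B) \in unitmx by rewrite -scaleN1r unitmxZ // unitrN1.
apply: (can_inj (mulKmx uN)).
by rewrite mulmxV // mulNmx mulmxN opprK mulmxV.
Qed.

Lemma L1_form_aux (i : F) A B f : (2 : F) != 0 -> A *m f = f *m A^T -> B *m f = f *m B^T ->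
  f + (2^-1 * i) *: ((A + B) *m f) =
  f *m (1%:M - 2^-1 *: (1%:M - i *: A))^T + f *m (1%:M - 2^-1 *: (1%:M - i *: B))^T.
Proof.
move=> two Af Bf.
rewrite !complement_tr !mulmxBr !mulmx1 -!scalemxAr !mulmxBr !mulmx1 -!scalemxAr -Af -Bf mulmxDl.
apply/matrixP => a b; rewrite !(addmxE, oppmxE, scalemxE).
by field; rewrite two.
Qed.

Lemma L1_form_skew_aux (c d : F) A B f : A *m f = f *m A^T -> B *m f = f *m B^T ->
  f^T = - f -> (c *: (f + d *: ((A + B) *m f)))^T = - (c *: (f + d *: ((A + B) *m f))).
Proof.
move=> Af Bf fs; rewrite linearZ /= -scalerN; congr (_ *: _).
rewrite linearD /= linearZ /= trmx_mul linearD /= fs mulNmx mulmxDr -Af -Bf -mulmxDl.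
by mxring.
Qed.

Lemma L1_form_sub_aux (i : F) f X : (2 : F) != 0 ->
  (-2) *: (f + (2^-1 * i) *: X) - (-2) *: (f + (- (2^-1 * i)) *: X) = (-2 * i) *: X.
Proof.
move=> two; apply/matrixP => a b; rewrite !(addmxE, oppmxE, scalemxE).
by field; rewrite two.
Qed.

End Auxiliary.

(** * The two-form f of a pair of complex structures on M *)

Section NondegeneratePair.
Variables (R : realType) (n : nat) (M : manifold R n).
Local Notation C := R[i].
Opaque chart_jac loc_vec loc_cov loc_end loc_form loc_biv dmx jdiff djac lie lie_biv.
Implicit Types (x y : M).
Variables (eps K K' : M -> 'M[R]_n).
Let w y := cplx (eps y).
Hypothesis sw : smooth_form w.
Hypothesis skeps : forall x, (eps x)^T = - eps x.
Hypothesis ueps : forall x, eps x \in unitmx.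
Hypothesis aK : almost_complex K.
Hypothesis aK' : almost_complex K'.
Hypothesis KK' : K' = Jminus eps K.
Hypothesis uD : forall x, K x - K' x \in unitmx.

Let skw x : (w x)^T = - w x. Proof. exact: skew_w skeps x. Qed.
Let uw x : w x \in unitmx. Proof. exact: unit_w ueps x. Qed.
Let AA x := cplx_sqrN1 (aK.2 x).
Let BB x := cplx_sqrN1 (aK'.2 x).
Let uDc x : cplx (K x) - cplx (K' x) \in unitmx.
Proof. by rewrite -cplxB cplx_unit. Qed.
Let BE x : cplx (K' x) = - (w x *m (cplx (K x))^T *m invmx (w x)).
Proof. by rewrite KK'; apply: cplx_Jminus. Qed.

(** The pair is kept abstract so that the results apply to (J+, J-) and, [Jminus] being an
    involution, also to (J-, J+). *)
Definition dual_form x : 'M[C]_n := pair_form (cplx (K x)) (cplx (K' x)) (w x).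

Lemma dual_form_skew x : (dual_form x)^T = - dual_form x.
Proof. exact: (pair_form_skew (uDc x) (skw x) (uw x) (BE x)). Qed.

Lemma dual_form_unit x : dual_form x \in unitmx.
Proof. exact: (pair_form_unit (uDc x) (uw x)). Qed.

Lemma dual_form_rho x : rho K x *m dual_form x = dual_form x *m (rho K x)^T.
Proof.
exact: scaled_commute (pair_form_left (AA x) (BB x) (uDc x) (uw x) (BE x)).
Qed.

Lemma biv10_dual_form :
  biv10 eps K = fun x => (- 2^-1) *: (invmx (dual_form x) *m rho K x).
Proof.
apply/funext => x.
exact: (biv_pair_form (im_sqr R) (AA x) (uDc x) (uw x) (BE x)).
Qed.

Lemma dual_form_smooth : smooth_form dual_form.
Proof.
move=> x; pose Kh := loc_end x (fun y => cplx (K y)); pose K'h := loc_end x (fun y => cplx (K' y)).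
pose D y := cplx (K y) + (-1) *: cplx (K' y).
have DE y : D y = cplx (K y) - cplx (K' y) by rewrite /D scaleN1r.
have DhE q : loc_end x D q = Kh q + (-1) *: K'h q.
  apply: etrans (loc_endD x q _ _) _; congr (_ + _); exact: loc_endZ.
have sD : smooth_near (coord x x) (loc_end x D).
  apply: smooth_near_ext (smooth_nearD (aK.1 x) (smooth_nearZ (-1) (aK'.1 x))).
  by apply: near_codI => q _; rewrite DhE.
have uDh : \forall q \near coord x x, loc_end x D q \in unitmx.
  by apply: near_codI => q xq; apply: loc_end_unit => //; rewrite DE.
apply: smooth_near_ext (smooth_nearM (smooth_near_inv uDh sD) (sw x)).
apply: near_codI => q xq.
have uDq : D (point x q) \in unitmx by rewrite DE.
rewrite -(loc_end_inv xq uDq); apply: etrans (esym (loc_end_form xq _ _)) _.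
by congr (loc_form x _ q); apply/funext => y; rewrite DE.
Qed.

Lemma dual_form_closed : integrable_J K -> holomorphic_Poisson_biv K (biv10 eps K) ->
  forall x, closed_at x (fun y => dual_form y *m (rho K y)^T).
Proof.
move=> iK hP; apply: closed_rho_form aK dual_form_smooth dual_form_skew
  dual_form_unit dual_form_rho _ biv10_dual_form iK hP.
by rewrite oppr_eq0 invr_eq0 two_neq0.
Qed.

(** The bivector is a nonzero multiple of [(rho K x)^T *m invmx (dual_form x)], and (1,0)-covectors
    are fixed by [(rho K x)^T]. *)
Lemma biv10_nondegenerate x (a : 'rV[C]_n) : T10dual K x a -> a *m biv10 eps K x = 0 -> a = 0.
Proof.
move=> /(T10dualP (aK.2 x)) ar; rewrite biv10_dual_form.
have k0 : (- 2^-1 : C) != 0 by rewrite oppr_eq0 invr_eq0 two_neq0.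
exact: scaled_inverse_eq0 (dual_form_unit x) (dual_form_rho x) ar k0.
Qed.

Lemma dual_form_rho_smooth : smooth_form (fun y => dual_form y *m (rho K y)^T).
Proof.
move=> x; have sr := smooth_rho x aK.
apply: smooth_near_ext (smooth_nearM (dual_form_smooth x) (smooth_near_tr sr)).
by apply: near_codI => q xq; symmetry; apply: loc_form_trend.
Qed.

End NondegeneratePair.

(** * The converse when J+ - J- is invertible *)

Section Converse.
Variables (R : realType) (n : nat) (M : manifold R n).
Local Notation C := R[i].
Opaque chart_jac loc_vec loc_cov loc_end loc_form loc_biv dmx jdiff djac lie lie_biv.
Implicit Types (x y : M).
Variables (eps J : M -> 'M[R]_n).
Hypothesis tame : tamed_almost_symplectic eps J.
Let J' := Jminus eps J.
Hypothesis uD : forall x, J x - J' x \in unitmx.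

Let w y := cplx (eps y).
Let sw : smooth_form w. Proof. exact: tamed_smooth tame. Qed.
Let skw x : (w x)^T = - w x. Proof. exact: skew_w (tamed_skew tame) x. Qed.
Let uw x : w x \in unitmx. Proof. exact: unit_w (tamed_unit tame) x. Qed.
Let aJ := tamed_complex tame.
Let aJ' := Jminus_complex tame.
Let skeps := tamed_skew tame.
Let ueps := tamed_unit tame.
Let JJ' : J = Jminus eps J'. Proof. by rewrite (Jminus_Jminus tame). Qed.
Let uD' x : J' x - J x \in unitmx.
Proof. by rewrite -opprB -scaleN1r unitmxZ ?uD // unitrN1. Qed.
Let AA x := cplx_sqrN1 (aJ.2 x).
Let BB x := cplx_sqrN1 (aJ'.2 x).
Let uDc x : cplx (J x) - cplx (J' x) \in unitmx.
Proof. by rewrite -cplxB cplx_unit. Qed.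
Let BE x : cplx (J' x) = - (w x *m (cplx (J x))^T *m invmx (w x)).
Proof. exact: cplx_Jminus. Qed.

Let f := dual_form eps J J'.

(** Exchanging J+ and J- changes the sign of their difference; the signs in the combinations of [W]
    and [W'] come from here. *)
Lemma dual_form_opp y : dual_form eps J' J y = - f y.
Proof. exact: (pair_form_opp (w y) (uDc y)). Qed.

Lemma conj_dual_form y : conj_mx (f y) = f y.
Proof.
rewrite /f /dual_form /pair_form conj_mxM conj_cplx; congr (_ *m _).
by rewrite -cplxB -cplx_inv conj_cplx.
Qed.

Definition L1_form y : 'M[C]_n :=
  (-2) *: (f y + (2^-1 * 'i%C) *: ((cplx (J y) + cplx (J' y)) *m f y)).

Lemma tamed_L1E : tamed_L1 eps J = graph L1_form.
Proof.
apply/funext => y; have sf := split_form (cplx (J y)) (cplx (J' y)) (im_sqr R) (w y) (two_neq0 R).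
apply/seteqP; split=> [u [_ [_ [/LplusP[X XJ ->] /(LminusP tame)[Y YJ ->] ->]]]|u [Z ->]].
  have [XE YE] := split_unique (uDc y) XJ YJ.
  exists (X + Y); rewrite add_row_mx; congr row_mx.
  apply: etrans _ (sf (X + Y)).
  by rewrite -XE -YE scaleNr mulmxN -!scalemxAr -scalerBr -mulmxBl.
have XJ := split_leftE (im_sqr R) (AA y) (BB y) (uDc y) Z.
have YJ := split_rightE (im_sqr R) (AA y) (BB y) (uDc y) Z.
have ZE := split_sum 'i%C (uDc y) Z.
have := sf Z.
move: (split_left _ _ _ _) (split_right _ _ _ _) XJ YJ ZE => X Y XJ YJ ZE H.
exists (row_mx X (X *m ('i%C *: w y))), (row_mx Y (Y *m ((- 'i%C) *: w y))); split.
- by apply/LplusP; exists X.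
- by apply/(LminusP tame); exists Y.
rewrite add_row_mx ZE; congr row_mx; apply: etrans (esym H) _.
by rewrite scaleNr mulmxN -!scalemxAr -scalerBr -mulmxBl.
Qed.

Let W y := dual_form eps J J' y *m (rho J y)^T.
Let W' y := dual_form eps J' J y *m (rho J' y)^T.

(** By the change of sign, [W + W'] is f contracted with the difference of the two projections,
    which is - i/2 times D. As [f *m D^T] is eps, the factor 2i undoes this constant. *)
Lemma eps_dual_forms y : w y = (2 * 'i%C) *: W y + (2 * 'i%C) *: W' y.
Proof.
have H : W y + W' y = (- (2^-1 * 'i%C)) *: w y.
  rewrite /W' dual_form_opp mulNmx.
  exact: (pair_form_sub 'i%C (uDc y) (skw y) (uw y) (BE y)).
rewrite -scalerDr H scalerA.
have -> : 2 * 'i%C * - (2^-1 * 'i%C) = 1 :> C; last by rewrite scale1r.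
by rewrite mulrN mulrACA mulfV ?two_neq0 // im_sqr mul1r opprK.
Qed.

(** Since f is real, conjugation replaces each projection by 1 - rho = (1 + iJ)/2, and the two add
    up to 1 + (i/2)(J+ + J-), as in [L1_form]. *)
Lemma L1_form_dual_forms y : L1_form y = conj_mx ((-2) *: W y + 2 *: W' y).
Proof.
rewrite /W' dual_form_opp mulNmx scalerN -scaleNr -scalerDr conj_mxZ conj_N2.
have fl := pair_form_left (AA y) (BB y) (uDc y) (uw y) (BE y).
have fr := pair_form_right (AA y) (BB y) (uDc y) (skw y) (uw y) (BE y).
apply: etrans (congr1 ( *:%R (-2)) (L1_form_aux 'i%C (two_neq0 R) fl fr)) _.
apply: congr1; symmetry; apply: etrans (conj_mxD _ _) _.
have cf (r : 'M[C]_n) : conj_mx (f y *m r^T) = f y *m (conj_mx r)^T.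
  apply: etrans (conj_mxM _ _) _.
  by apply: f_equal2; [exact: conj_dual_form|exact: conj_mx_tr].
apply: f_equal2; apply: etrans (cf _) _; apply: (congr1 (fun r => f y *m r^T)).
  exact: (conj_rho J y).
exact: (conj_rho J' y).
Qed.

Lemma L1_form_skew y : (L1_form y)^T = - L1_form y.
Proof.
have fl := pair_form_left (AA y) (BB y) (uDc y) (uw y) (BE y).
have fr := pair_form_right (AA y) (BB y) (uDc y) (skw y) (uw y) (BE y).
have fs := pair_form_skew (uDc y) (skw y) (uw y) (BE y).
exact: L1_form_skew_aux fl fr fs.
Qed.

(** The difference is a multiple of (J+ + J-) f, whose first factor is invertible by taming and
    whose second is nondegenerate. *)
Lemma L1_form_imaginary_unit y : L1_form y - conj_mx (L1_form y) \in unitmx.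
Proof.
have -> : L1_form y - conj_mx (L1_form y) =
    (-2 * 'i%C) *: ((cplx (J y) + cplx (J' y)) *m f y).
  rewrite /L1_form conj_mxZ conj_mxD conj_mxZ conj_mxM conj_dual_form conj_mxD !conj_cplx.
  rewrite conj_N2.
  rewrite conj_half_i.
  exact: L1_form_sub_aux (two_neq0 R).
rewrite unitmxZ; last by rewrite unitfE mulf_neq0 ?oppr_eq0 ?two_neq0 ?im_neq0.
rewrite unitmx_mul -cplxD cplx_unit (J_plus_Jminus_unit tame).
by apply: (dual_form_unit ueps uD).
Qed.

Let sW : smooth_form W.
Proof. exact: (dual_form_rho_smooth sw aJ aJ' uD). Qed.
Let sW' : smooth_form W'.
Proof. exact: (dual_form_rho_smooth sw aJ' aJ uD'). Qed.

Lemma L1_form_smooth : smooth_form L1_form.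
Proof.
have := smooth_form_conj (smooth_form_comb (-2) 2 sW sW').
by congr (smooth_form _); apply/funext => y; rewrite -L1_form_dual_forms.
Qed.

Lemma generalized_Kahler_converse :
  integrable_J J -> integrable_J J' ->
  holomorphic_Poisson_biv J (biv10 eps J) -> holomorphic_Poisson_biv J' (biv10 eps J') ->
  generalized_Kahler (tamed_L1 eps J) (tamed_L2 eps J).
Proof.
move=> iJ iJ' hP hP'.
have cW x : closed_at x W.
  exact: (dual_form_closed sw skeps ueps aJ aJ' erefl uD iJ hP).
have cW' x : closed_at x W'.
  exact: (dual_form_closed sw skeps ueps aJ' aJ JJ' uD' iJ' hP').
have cw x : closed_at x w.
  apply: closed_at_ext (closed_at_comb (2 * 'i%C) (2 * 'i%C) sW sW' (cW x) (cW' x)) => y.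
  by rewrite -eps_dual_forms.
have cL1 x : closed_at x L1_form.
  apply: closed_at_ext (closed_at_conj (smooth_form_comb (-2) 2 sW sW')
    (closed_at_comb (-2) 2 sW sW' (cW x) (cW' x))) => y.
  by rewrite -L1_form_dual_forms.
have siw := smooth_form_scale 'i%C sw.
have gac1 : generalized_almost_complex (tamed_L1 eps J).
  rewrite tamed_L1E; apply: generalized_almost_complex_graph L1_form_smooth _ _.
    exact: L1_form_skew.
  exact: L1_form_imaginary_unit.
have gac2 : generalized_almost_complex (tamed_L2 eps J).
  rewrite (tamed_L2E tame); apply: generalized_almost_complex_graph siw _ _.
    exact: (skew_scale tame).
  move=> x; rewrite conj_mxZ conj_cplx conj_i scaleNr opprK -scalerDl.
  by rewrite unitmxZ ?uw // unitfE -mulr2n -mulr_natl mulf_neq0 ?two_neq0 ?im_neq0.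
split.
- by split=> // x; apply: (gak_endo_compatible tame).
- split=> //; rewrite tamed_L1E.
  by apply/(courant_closed_graph L1_form_smooth L1_form_skew).
- split=> //; rewrite (tamed_L2E tame).
  apply/(courant_closed_graph siw (skew_scale tame 'i%C)) => x.
  exact: closed_at_scale sw (cw x).
Qed.

End Converse.

Theorem theorem6p5 (R : realType) (n : nat) (M : manifold R n)
    (eps J : M -> 'M[R]_n) (tamed : tamed_almost_symplectic eps J) :
  let Jp := J in
  let Jm := Jminus eps J in
  let L1 := tamed_L1 eps J in
  let L2 := tamed_L2 eps J in
  (generalized_Kahler L1 L2 ->
     [/\ integrable_J Jp, integrable_J Jm,
         holomorphic_Poisson Jp (rho_push Jp L2)
       & holomorphic_Poisson Jm (rho_push Jm L2)]) /\
  ((forall x, Jp x - Jm x \in unitmx) ->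
     ([/\ integrable_J Jp, integrable_J Jm,
          holomorphic_Poisson Jp (rho_push Jp L2)
        & holomorphic_Poisson Jm (rho_push Jm L2)] ->
        generalized_Kahler L1 L2) /\
     (generalized_Kahler L1 L2 ->
        holomorphic_symplectic Jp (rho_push Jp L2) /\
        holomorphic_symplectic Jm (rho_push Jm L2))).
Proof.
move=> Jp Jm L1 L2.
have aJ := tamed_complex tamed; have aJ' := Jminus_complex tamed.
have gJ := rho_push_tamed tamed aJ.2; have gJ' := rho_push_tamed tamed aJ'.2.
split=> [GK|uD].
  have [iJ iJ'] := tamed_integrable tamed GK.
  have [hP hP'] := tamed_holomorphic_Poisson tamed GK.
  split; [exact: iJ|exact: iJ'| |].
    by exists (biv10 eps J); split; [exact: hP|exact: gJ].
  by exists (biv10 eps (Jminus eps J)); split; [exact: hP'|exact: gJ'].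
split=> [[iJ iJ' hP hP']|GK].
  apply: (generalized_Kahler_converse tamed uD iJ iJ').
    exact: (holomorphic_Poisson_unique tamed aJ.2 hP).
  exact: (holomorphic_Poisson_unique tamed aJ'.2 hP').
have [hP hP'] := tamed_holomorphic_Poisson tamed GK.
have uD' x : Jminus eps J x - J x \in unitmx.
  by rewrite -opprB -scaleN1r unitmxZ ?uD // unitrN1.
split.
  exists (biv10 eps J); split; [exact: hP|exact: gJ|].
  exact: (biv10_nondegenerate (tamed_unit tamed) aJ aJ' erefl uD).
exists (biv10 eps (Jminus eps J)); split; [exact: hP'|exact: gJ'|].
exact: (biv10_nondegenerate (tamed_unit tamed) aJ' aJ
  (esym (Jminus_Jminus tamed)) uD').
Qed.
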